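(* Let $d\ge 1$, $T>0$, $b,\sigma,f,g$, the sampling density $\nu$ and the damping exponent $q\ge 0$ be as in the context (assumptions (1)--(4) there being in force). For a finite set of multi-indices $\Gamma\subset\mathbb N^d$ let $$\mathcal L_\Gamma:=\sum_{\mathbf k\in\Gamma}\|\phi_{\mathbf k}\|_\infty^2\ \bigl(\le 2^d\,\#\Gamma\bigr),$$ and for each $i$ let $$\mathcal E_i:=\sum_{\mathbf k\in\mathbb N^d\setminus\Gamma}\bigl(\alpha^{(q)}_{i,\mathbf k}\bigr)^2+\frac{\mathcal L_\Gamma}{M}\,\mathbb E\Bigl[\bigl(S^{(q)}_i(X^i_{i:N})\bigr)^2\Bigr].$$ Then for every $\kappa>0$ there is a finite positive constant $C$, depending only on $\kappa$ and on the model parameters ($d,T,b,\sigma,f,g,\nu,q$) but not otherwise on $N,M,\Gamma$, such that for all integers $N\ge1$, $M\ge1$, all finite $\Gamma\subset\mathbb N^d$ with $\mathcal L_\Gamma/M\le\kappa$, and all $i\in\{0,\dots,N-1\}$, $$\mathbb E\Bigl[\bigl\|\bar y^{(q,M)}_i-y^{(q)}_i\bigr\|_\nu^2\Bigr]\le C\Bigl(\mathcal E_i+\sum_{j=i}^{N-1}\mathcal E_{j+1}\Delta\Bigr),$$ where $\|v\|_\nu^2=\int_{\mathbb R^d}v^2\,\nu\,d\mathbf x$ and $\bar y^{(q,M)}_i$ is the output of the GQRMDP algorithm described in the context.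
   Context: $\mathbb N=\{0,1,2,\dots\}$; $|\cdot|$ is the Euclidean norm. For $N\ge1$ set $\Delta=T/N$, $t_j=j\Delta$. $W$ is a standard Brownian motion of dimension $d_W$. **Assumptions.** (1) $g:\mathbb R^d\to\mathbb R$ is measurable with $|g(\mathbf x)|\le C_g(1+|\mathbf x|^2)^{\eta_g/2}$; $f:[0,T]\times\mathbb R^d\times\mathbb R\to\mathbb R$, and $f_j(\mathbf x,y):=f(t_j,\mathbf x,y)$ is measurable with $|f_j(\mathbf x,y)-f_j(\mathbf x,y')|\le L_f|y-y'|$ and $|f_j(\mathbf x,0)|\le C_f(1+|\mathbf x|^2)^{\eta_f/2}$ for $j<N$; the constants $C_g,\eta_g,L_f,C_f,\eta_f$ are finite, nonnegative and independent of $N$. (2) $b:[0,T]\times\mathbb R^d\to\mathbb R^d$ and $\sigma:[0,T]\times\mathbb R^d\to\mathbb R^{d\times d_W}$ are bounded and measurable. Euler scheme: $X_{j+1}=X_j+b(t_j,X_j)\Delta+\sigma(t_j,X_j)(W_{t_{j+1}}-W_{t_j})$. Let $$C_\eta:=\sup_{0\le i\le j\le N,\ \mathbf x\in\mathbb R^d}\frac{\mathbb E[(1+|X_j|^2)^{(\eta_g\vee\eta_f)/2}\mid X_i=\mathbf x]}{(1+|\mathbf x|^2)^{(\eta_g\vee\eta_f)/2}},\qquad L^\star(\mathbf x):=C_\eta(C_g+TC_f)e^{C_\eta L_fT}(1+|\mathbf x|^2)^{(\eta_g\vee\eta_f)/2}.$$ (3) $\nu(\mathbf x)=\prod_{l=1}^d\nu_l(x_l)$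 with $\nu_l$ strictly positive probability densities on $\mathbb R$, and $\mathbf x\mapsto L^\star(\mathbf x)/(1+|\mathbf x|^2)^{q/2}$ is square integrable with respect to $\nu(\mathbf x)\,d\mathbf x$. For each $i$, $X^i_i$ has density $\nu$ and is independent of the increments of $W$ after $t_i$; $(X^i_j)_{j\ge i}$ is the Euler scheme started from $X^i_i$ at time $t_i$; $X^i_{i:N}=(X^i_i,\dots,X^i_N)$. (4) There is $c_\nu>0$ (depending on $q,b,\sigma,\nu,T$ only) such that for all measurable $\gamma\in L^2_\nu(\mathbb R^d)$ and all $N\ge j\ge i\ge0$: $\mathbb E\bigl[|\gamma(X^i_j)|^2(1+|X^i_j|^2)^q/(1+|X^i_i|^2)^q\bigr]\le c_\nu\,\mathbb E[|\gamma(X^i_i)|^2]$. **Exact solution.** $y_N=g$ and, for $i<N$, $y_i(\mathbf x)=\mathbb E\bigl[g(X_N)+\sum_{j=i}^{N-1}f_j(X_j,y_{j+1}(X_{j+1}))\Delta\mid X_i=\mathbf x\bigr]$. Put $y^{(q)}_i(\mathbf x)=y_i(\mathbf x)/(1+|\mathbf x|^2)^{q/2}$ and, for $x^i_{i:N}=(x^i_i,\dots,x^i_N)$, $$S^{(q)}_i(x^i_{i:N})=\frac{g(x^i_N)}{(1+|x^i_i|^2)^{q/2}}+\sum_{j=i}^{N-1}\frac{f_j\bigl(x^i_j,\,y^{(q)}_{j+1}(x^i_{j+1})(1+|x^i_{j+1}|^2)^{q/2}\bigr)}{(1+|x^i_i|^2)^{q/2}}\Delta .$$ **Basis.** $F_{\nu_l}(x)=\int_{-\infty}^x\nu_l$,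 $\phi^{(l)}_0\equiv1$, $\phi^{(l)}_k(x)=\sqrt2\cos(k\pi F_{\nu_l}(x))$ for $k\ge1$, $\phi_{\mathbf k}(\mathbf x)=\prod_{l=1}^d\phi^{(l)}_{k_l}(x_l)$ for $\mathbf k\in\mathbb N^d$. $\alpha^{(q)}_{i,\mathbf k}=\int_{\mathbb R^d}y^{(q)}_i\phi_{\mathbf k}\,\nu\,d\mathbf x$. The quantities $S^{(q)}_N,\alpha^{(q)}_{N,\mathbf k},\mathcal E_N$ are given by the same formulas with $i=N$ (empty sum). **GQRMDP algorithm.** For $0\le i<N$ let $\mathcal C_i=\{X^{i,m}_{i:N}:m=1,\dots,M\}$ be $M$ independent copies of $X^i_{i:N}$, the clouds $\mathcal C_0,\dots,\mathcal C_{N-1}$ being independent. For $L\ge 0$ and $z\in\mathbb R$ let $\mathcal T_L(z)=-L\vee z\wedge L$. Set $\bar y^{(q,M)}_N(\mathbf x)=g(\mathbf x)/(1+|\mathbf x|^2)^{q/2}$; for $i=N-1,\dots,0$ set $$S^{(q,M)}_i(x^i_{i:N})=\frac{g(x^i_N)}{(1+|x^i_i|^2)^{q/2}}+\sum_{j=i}^{N-1}\frac{f_j\Bigl(x^i_j,\mathcal T_{L^\star(x^i_{j+1})}\bigl(\bar y^{(q,M)}_{j+1}(x^i_{j+1})(1+|x^i_{j+1}|^2)^{q/2}\bigr)\Bigr)}{(1+|x^i_i|^2)^{q/2}}\Delta,$$ $$\bar\alpha^{(q,M)}_{i,\mathbf k}=\frac1M\sum_{m=1}^MS^{(q,M)}_i(X^{i,m}_{i:N})\phi_{\mathbf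 k}(X^{i,m}_i)\ (\mathbf k\in\Gamma),\qquad \bar y^{(q,M)}_i=\sum_{\mathbf k\in\Gamma}\bar\alpha^{(q,M)}_{i,\mathbf k}\phi_{\mathbf k}.$$ *)

(* Defs.v *)
(* R^d is d.-tuple R, with the library sigma-algebra generated by coordinates. *)
From HB Require Import structures.
From mathcomp Require Export all_boot all_order all_algebra.
From mathcomp Require Export finmap.
From mathcomp Require Export all_classical all_reals all_analysis.
Export numFieldNormedType.Exports.
Set Implicit Arguments.
Unset Strict Implicit.
Unset Printing Implicit Defensive.
Import Order.TTheory GRing.Theory Num.Theory.

Global Open Scope classical_set_scope.
Global Open Scope ring_scope.

Section lebesgue_cons.
Context (R : realType) (n : nat).
Variable m : {sigma_finite_measure set (n.-tuple R) -> \bar R}.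

Let f (p : R * n.-tuple R) : n.+1.-tuple R := [tuple of p.1 :: p.2].

Let mf : measurable_fun setT f.
Proof. exact: (@measurable_cons _ _ _ _ fst n snd). Qed.

Definition lebesgue_cons : set (n.+1.-tuple R) -> \bar R :=
  pushforward (lebesgue_measure \x m)%E f.

Let lebesgue_cons0 : lebesgue_cons set0 = 0%E.
Proof. by rewrite /lebesgue_cons /pushforward preimage_set0 measure0. Qed.

Let lebesgue_cons_ge0 A : (0 <= lebesgue_cons A)%E.
Proof. exact: measure_ge0. Qed.

Let lebesgue_cons_semi_sigma_additive : semi_sigma_additive lebesgue_cons.
Proof. exact: (@measure_semi_sigma_additive _ _ _ (pushforward _ _)). Qed.

HB.instance Definition _ := isMeasure.Build _ _ _ lebesgue_cons
  lebesgue_cons0 lebesgue_cons_ge0 lebesgue_cons_semi_sigma_additive.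

Let sigma_finite_cons : sigma_finite setT lebesgue_cons.
Proof.
pose g (t : n.+1.-tuple R) : R * n.-tuple R := (thead t, [tuple of behead t]).
have mg : measurable_fun setT g.
  by apply: measurable_fun_pair; [exact: measurable_tnth|exact: measurable_behead].
have gf p : g (f p) = p.
  by rewrite /g /f theadE; case: p => a t; congr pair; apply/val_inj.
have /sigma_finiteP[F [UF ndF Foo]] : sigma_finite setT (@lebesgue_measure R).
  exact: sigma_finiteT.
have /sigma_finiteP[G [UG ndG Goo]] := sigma_finiteT m.
exists (fun i => g @^-1` (F i `*` G i)).
  apply/esym/seteqP; split => // t _.
  have [i _ Fi] : (\bigcup_i F i) (g t).1 by rewrite -UF.
  have [j _ Gj] : (\bigcup_i G i) (g t).2 by rewrite -UG.
  exists (maxn i j) => //; split.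
    by move: Fi; exact/subsetPset/ndF/leq_maxl.
  by move: Gj; exact/subsetPset/ndG/leq_maxr.
move=> i; have [mF Fi] := Foo i; have [mG Gi] := Goo i; split.
  by rewrite -[X in measurable X]setTI; apply: mg => //; exact: measurableX.
rewrite /lebesgue_cons /pushforward (_ : _ @^-1` _ = F i `*` G i).
  by rewrite product_measure1E// lte_mul_pinfty// ge0_fin_numE.
by apply/funext => p; rewrite /preimage /mkset gf.
Qed.

HB.instance Definition _ :=
  Measure_isSigmaFinite.Build _ _ _ lebesgue_cons sigma_finite_cons.

End lebesgue_cons.

(* Lebesgue measure on R^n, as an iterated product of the one on R. *)
Fixpoint lebesgue_tuple (R : realType) (n : nat) :
    {sigma_finite_measure set (n.-tuple R) -> \bar R} :=
  if n is n'.+1 then lebesgue_cons (lebesgue_tuple R n')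
  else \d_([tuple] : 0.-tuple R).

Lemma lebesgue_tuple_box (R : realType) n (A : 'I_n -> set R) :
  (forall l, measurable (A l)) ->
  (lebesgue_tuple R n [set x | forall l, A l (tnth x l)] =
   \prod_(l < n) lebesgue_measure (A l))%E.
Proof.
elim: n A => [|n IH] A mA.
  by rewrite big_ord0 /= diracE mem_set//= => -[].
have mB : measurable
    ([set x | forall l, A (lift ord0 l) (tnth x l)] : set (n.-tuple R)).
  rewrite (_ : mkset _ =
      \bigcap_(l in [set: 'I_n]) ((@tnth n R ^~ l) @^-1` A (lift ord0 l))).
    apply: fin_bigcap_measurable => // l _.
    by rewrite -[X in measurable X]setTI; exact: measurable_tnth.
  by apply/seteqP; split => x H l; [move=> _; exact: H|exact: H].
rewrite big_ord_recl -IH// /= /lebesgue_cons /pushforward -product_measure1E//=.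
congr (product_measure1 _ _ _); apply/seteqP; split => -[a t] /=.
  by move=> H; split => [|l]; [exact: (H ord0)|have := H (lift ord0 l); rewrite tnthS].
by move=> [Ha Ht] l; case: (unliftP ord0 l) => [j|] ->; rewrite ?tnthS.
exact: mA.
Qed.

Section generic.
Context (R : realType).

Definition enorm n (x : n.-tuple R) : R := Num.sqrt (\sum_l tnth x l ^+ 2).

Definition jbracket n (p : R) (x : n.-tuple R) : R :=
  (1 + enorm x ^+ 2) `^ p.

Definition trunc (L z : R) : R := Num.max (- L) (Num.min z L).

Definition incr n d (Omega : measurableType d) (W : R -> Omega -> n.-tuple R)
    (s t : R) (w : Omega) : n.-tuple R :=
  [tuple tnth (W t w) r - tnth (W s w) r | r < n].

(* Generators of the sigma-algebras of W up to time s, and of the increments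
   of W after time s. *)
Definition past_gen n d (Omega : measurableType d) (W : R -> Omega -> n.-tuple R)
    (s : R) : set (set Omega) :=
  [set E | exists u (B : set (n.-tuple R)),
     [/\ 0 <= u <= s, measurable B & E = W u @^-1` B]].

Definition future_gen n d (Omega : measurableType d)
    (W : R -> Omega -> n.-tuple R) (s : R) : set (set Omega) :=
  [set E | exists u v (B : set (n.-tuple R)),
     [/\ s <= u, u <= v, measurable B & E = incr W u v @^-1` B]].

Record standard_brownian n d (Omega : measurableType d)
    (P : probability Omega R) (W : R -> Omega -> n.-tuple R) : Prop := {
  bm_measurable : forall t, 0 <= t -> measurable_fun setT (W t) ;
  bm_start : {ae P, forall w, forall r, tnth (W 0 w) r = 0} ;
  bm_gaussian : forall s t, 0 <= s < t ->
    forall B : 'I_n -> set R, (forall r, measurable (B r)) ->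
    P [set w | forall r, B r (tnth (incr W s t w) r)] =
    (\prod_(r < n) normal_prob 0 (Num.sqrt (t - s)) (B r))%E ;
  bm_indep : forall s t, 0 <= s < t ->
    forall (E : set Omega) (B : set (n.-tuple R)),
    <<s past_gen W s >> E -> measurable B ->
    P (E `&` incr W s t @^-1` B) = (P E * P (incr W s t @^-1` B))%E ;
  bm_continuous : {ae P, forall w, forall r,
    {within `[0, +oo[, continuous (fun t => tnth (W t w) r)}} }.

End generic.

(* Data and constants of the problem; b, sigma, f are only constrained, and
   only used, at times in [0,T]. *)
Record model (R : realType) (d dW : nat) := Model {
  mT : R ;
  mq : R ;
  mb : R -> d.-tuple R -> d.-tuple R ;
  msigma : R -> d.-tuple R -> 'M[R]_(d, dW) ;
  mf : R -> d.-tuple R -> R -> R ;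
  mg : d.-tuple R -> R ;
  mnu1 : 'I_d -> R -> R ;
  mCg : R ; metag : R ; mLf : R ; mCf : R ; metaf : R }.

Section scheme.
Context (R : realType) (d dW : nat) (m : model R d dW).
Local Notation V := (d.-tuple R).
Local Notation T := (mT m).
Local Notation q := (mq m).
Local Notation leb := (lebesgue_tuple R d).

Definition step (N : nat) : R := T / N%:R.
Definition grid (N j : nat) : R := j%:R * step N.

Definition nu (x : V) : R := \prod_(l < d) mnu1 m l (tnth x l).

Definition sqnorm_nu (v : V -> R) : \bar R :=
  (\int[leb]_x (v x ^+ 2 * nu x)%:E)%E.

Definition in_L2nu (v : V -> R) : Prop :=
  measurable_fun setT v /\ (sqnorm_nu v < +oo)%E.

Definition eta : R := Num.max (metag m) (metaf m).

Definition growth_assumption : Prop :=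
  [/\ [/\ 0 <= mCg m, 0 <= metag m, 0 <= mLf m, 0 <= mCf m & 0 <= metaf m],
      measurable_fun setT (mg m),
      (forall x, `|mg m x| <= mCg m * jbracket (metag m / 2) x) &
      forall N j, (0 < N)%N -> (j < N)%N ->
      [/\ measurable_fun setT (fun p : V * R => mf m (grid N j) p.1 p.2),
          (forall x y y', `|mf m (grid N j) x y - mf m (grid N j) x y'|
                          <= mLf m * `|y - y'|) &
          (forall x, `|mf m (grid N j) x 0| <= mCf m * jbracket (metaf m / 2) x)]].

Definition coefficient_assumption : Prop :=
  [/\ measurable_fun (`[0, T] `*` setT) (fun p : R * V => mb m p.1 p.2),
      (forall l r, measurable_fun (`[0, T] `*` setT)
                     (fun p : R * V => msigma m p.1 p.2 l r)) &
      exists K : R, forall t x, 0 <= t <= T ->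
        enorm (mb m t x) <= K /\ forall l r, `|msigma m t x l r| <= K].

Definition density_assumption : Prop :=
  forall l, [/\ measurable_fun setT (mnu1 m l),
                (forall u, 0 < mnu1 m l u) &
                (\int[lebesgue_measure]_u (mnu1 m l u)%:E = 1)%E].

Definition euler_step (N j : nat) (x : V) (dw : dW.-tuple R) : V :=
  [tuple tnth x l + tnth (mb m (grid N j) x) l * step N
         + \sum_r msigma m (grid N j) x l r * tnth dw r | l < d].

Section space.
Context (dO : measure_display) (Omega : measurableType dO).
Context (P : probability Omega R) (W : R -> Omega -> dW.-tuple R).

(* Value at time t_j of the scheme started from x at time t_i; it is x for
   j <= i. *)
Fixpoint euler (N i : nat) (x : V) (j : nat) (w : Omega) : V :=
  if j is j'.+1 then
    if (i <= j')%N then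
      euler_step N j' (euler N i x j' w) (incr W (grid N j') (grid N j'.+1) w)
    else x
  else x.

(* Conditional expectations given X_i = x are expectations for the scheme
   started from x at time t_i. The supremum is finite when b and sigma are
   bounded, so that fine loses nothing. *)
Definition C_eta (N : nat) : R :=
  fine (ereal_sup [set r | exists i j x, (i <= j <= N)%N /\
    r = 'E_P[fun w => (jbracket (eta / 2) (euler N i x j w)
                       / jbracket (eta / 2) x)%R]%E]).

Definition Lstar (N : nat) (x : V) : R :=
  C_eta N * (mCg m + T * mCf m) * expR (C_eta N * mLf m * T)
  * jbracket (eta / 2) x.

Definition has_density_nu (xi : Omega -> V) : Prop :=
  measurable_fun setT xi /\
  forall A, measurable A -> P (xi @^-1` A) = (\int[leb]_(x in A) (nu x)%:E)%E.

Definition indep_future (s : R) (xi : Omega -> V) : Prop :=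
  forall (A : set V) (E : set Omega), measurable A -> <<s future_gen W s >> E ->
  P (xi @^-1` A `&` E) = (P (xi @^-1` A) * P E)%E.

Definition initial_condition (N i : nat) (xi : Omega -> V) : Prop :=
  has_density_nu xi /\ indep_future (grid N i) xi.

Definition pathX (N i : nat) (xi : Omega -> V) (j : nat) (w : Omega) : V :=
  euler N i (xi w) j w.

(* x_{i:N}, for a path x indexed by the absolute time index. *)
Definition segment (N i : nat) (x : nat -> V) : (N - i).+1.-tuple V :=
  [tuple x (i + k)%N | k < (N - i).+1].

(* y determines y_0, ..., y_N by backward recursion. *)
Definition exact_solution (N : nat) (y : nat -> V -> R) : Prop :=
  y N = mg m /\
  forall i x, (i < N)%N ->
    y i x = fine 'E_P[fun w => (mg m (euler N i x N w)
      + \sum_(i <= j < N) mf m (grid N j) (euler N i x j w)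
                            (y j.+1 (euler N i x j.+1 w)) * step N)%R]%E.

Definition damped (v : V -> R) (x : V) : R := v x / jbracket (q / 2) x.

Definition Sq (N : nat) (y : nat -> V -> R) (i : nat) (x : nat -> V) : R :=
  mg m (x N) / jbracket (q / 2) (x i)
  + \sum_(i <= j < N)
      mf m (grid N j) (x j)
        (damped (y j.+1) (x j.+1) * jbracket (q / 2) (x j.+1))
      / jbracket (q / 2) (x i) * step N.

Definition cdf (l : 'I_d) (u : R) : R :=
  fine (\int[lebesgue_measure]_(v in `]-oo, u]) (mnu1 m l v)%:E)%E.

Definition phi1 (l : 'I_d) (k : nat) (u : R) : R :=
  if k == 0%N then 1 else Num.sqrt 2 * cos (k%:R * pi * cdf l u).

Definition phi (k : d.-tuple nat) (x : V) : R :=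
  \prod_(l < d) phi1 l (tnth k l) (tnth x l).

Definition LGamma (Gamma : {fset d.-tuple nat}) : R :=
  \sum_(k <- Gamma) sup [set `|phi k x| | x in setT] ^+ 2.

Definition alpha (y : nat -> V -> R) (i : nat) (k : d.-tuple nat) : R :=
  fine (\int[leb]_x (damped (y i) x * phi k x * nu x)%:E)%E.

Definition local_error (N M : nat) (Gamma : {fset d.-tuple nat})
    (xi : nat -> Omega -> V) (y : nat -> V -> R) (i : nat) : \bar R :=
  (\esum_(k in [set k | k \notin Gamma]) (alpha y i k ^+ 2)%:E
   + (LGamma Gamma / M%:R)%:E
     * 'E_P[fun w => (Sq N y i (fun j => pathX N i (xi i) j w) ^+ 2)%R])%E.

(* cl i k j is the value at t_j of the k-th path of the i-th cloud; each path
   has the law of X^i_{i:N} and all paths are mutually independent. *)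
Definition clouds (N M : nat) (xi : nat -> Omega -> V)
    (cl : 'I_N -> 'I_M -> nat -> Omega -> V) : Prop :=
  [/\ (forall (i : 'I_N) (k : 'I_M),
        measurable_fun setT (fun w => segment N i (fun j => cl i k j w))),
      (forall (i : 'I_N) (k : 'I_M) (B : set ((N - i).+1.-tuple V)),
        measurable B ->
        P [set w | B (segment N i (fun j => cl i k j w))] =
        P [set w | B (segment N i (fun j => pathX N i (xi i) j w))]) &
      forall B : forall i : 'I_N, 'I_M -> set ((N - i).+1.-tuple V),
        (forall i k, measurable (B i k)) ->
        P [set w | forall i k, B i k (segment N i (fun j => cl i k j w))] =
        (\prod_(i < N) \prod_(k < M)
          P [set w | B i k (segment N i (fun j => cl i k j w))])%E].

Definition SqM (N : nat) (ybar : nat -> V -> R) (i : nat) (x : nat -> V) : R :=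
  mg m (x N) / jbracket (q / 2) (x i)
  + \sum_(i <= j < N)
      mf m (grid N j) (x j)
        (trunc (Lstar N (x j.+1))
           (ybar j.+1 (x j.+1) * jbracket (q / 2) (x j.+1)))
      / jbracket (q / 2) (x i) * step N.

Definition alphabar (N M : nat) (cl : 'I_N -> 'I_M -> nat -> Omega -> V)
    (ybar : nat -> Omega -> V -> R) (i : 'I_N) (k : d.-tuple nat) (w : Omega) : R :=
  M%:R^-1 * \sum_(n < M)
    SqM N (fun j => ybar j w) i (fun j => cl i n j w) * phi k (cl i n i w).

(* ybar determines ybar_0, ..., ybar_N by backward recursion. *)
Definition gqrmdp (N M : nat) (Gamma : {fset d.-tuple nat})
    (cl : 'I_N -> 'I_M -> nat -> Omega -> V)
    (ybar : nat -> Omega -> V -> R) : Prop :=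
  (forall w, ybar N w = damped (mg m)) /\
  forall (i : 'I_N) w x,
    ybar i w x = \sum_(k <- Gamma) alphabar cl ybar i k w * phi k x.

End space.

(* In the next two definitions the quantification over all probability spaces
   carrying a Brownian motion is harmless, since the conditions only involve
   laws; it makes the constants independent of the space. *)
Definition Lstar_assumption : Prop :=
  forall (dO : measure_display) (Omega : measurableType dO)
    (P : probability Omega R) (W : R -> Omega -> dW.-tuple R),
  standard_brownian P W ->
  forall N, (0 < N)%N -> in_L2nu (damped (Lstar P W N)).

Definition stability_assumption : Prop :=
  exists c_nu : R, 0 < c_nu /\
  forall (dO : measure_display) (Omega : measurableType dO)
    (P : probability Omega R) (W : R -> Omega -> dW.-tuple R),
  standard_brownian P W ->
  forall (N i j : nat) (xi : Omega -> V) (gamma : V -> R),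
  (0 < N)%N -> (i <= j <= N)%N -> initial_condition P W N i xi ->
  in_L2nu gamma ->
  ('E_P[fun w => (`|gamma (pathX W N i xi j w)| ^+ 2 * jbracket q (pathX W N i xi j w)
                  / jbracket q (pathX W N i xi i w))%R]
   <= c_nu%:E * 'E_P[fun w => (`|gamma (pathX W N i xi i w)| ^+ 2)%R])%E.

End scheme.

(* Main.v *)
From HB Require Import structures.
Require Import Defs.
Import Order.TTheory GRing.Theory Num.Theory.
From mathcomp Require Import measurable_realfun zify ring lra.
Set Implicit Arguments.
Unset Strict Implicit.
Unset Printing Implicit Defensive.

(* The i-th step regresses S_i on the basis (phi_k), which is orthonormal and
   complete in L^2(nu): F_{nu_l} pushes nu_l to the uniform law on [0,1], and
   Bernstein polynomials in cos(pi F_{nu_l}) approximate indicators of half-lines.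
   By Parseval the mean squared error of the step is the truncation tail plus the
   error on the coefficients of Gamma. As the M paths are independent, the latter
   splits into a variance, at most L_Gamma / M times a second moment, and a bias,
   which Bessel's inequality bounds by E|S_i^M - S_i|^2. A priori, |y_j| <= L*, so the
   1-Lipschitz truncation fixes y_j, and with the stability assumption
   E|S_i^M - S_i|^2 <= T L_f^2 c_nu Delta sum_{j >= i} |ybar_{j+1} - y_{j+1}^(q)|_nu^2.
   The later clouds are independent of the i-th one, so the estimate may be applied
   with ybar_{j+1}, j >= i, frozen, and then integrated; Gronwall concludes. *)

(** * Square-integrable functions, densities and independence *)

(** The condition [L_Gamma / M <= kappa] is there because the variance is governed by the second
    moment of S_i^M rather than of S_i: the splitting E|S_i^M|^2 <= 2 E|S_i|^2 + 2 E|S_i^M - S_i|^2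
    puts L_Gamma / M in front of the propagated error, whence the rate (1 + 2 kappa) T L_f^2 c_nu
    that Gronwall exponentiates. Truncation has a second job: it bounds S_i^M along the path by
    multiples of [Lstar] / (1 + |X_i|^2)^(q/2), square integrable by stability whatever the computed
    coefficients are. So each regression has a finite variance once the later outputs are frozen,
    while the expected errors, not known to be finite, stay in the extended reals. Freezing does not
    go through the joint law of the clouds: Omega is viewed through two independent
    sub-sigma-algebras, generated by the later clouds and by the i-th one, and the identity into
    each plays the role of a random variable. The same device, with the sigma-algebra of the
    increments after t_i, turns the definition of y_i by deterministic starts into the regression
    identity E[S_i phi_k(X_i)] = alpha_(i,k). *)

Section square_integrable.
Context d (T : measurableType d) (R : realType) (mu : {measure set T -> \bar R}).
Implicit Types f g : T -> R.

Definition sqintegrable f : Prop :=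
  measurable_fun setT f /\ (\int[mu]_x (f x ^+ 2)%:E < +oo)%E.

Lemma sqintegrable_integrable_sqr f : sqintegrable f ->
  mu.-integrable setT (EFin \o (fun x => f x ^+ 2)).
Proof.
move=> [mf foo]; apply/integrableP; split.
  by apply/measurable_EFinP; exact: measurable_funX.
by under eq_integral do rewrite /= ger0_norm ?sqr_ge0//.
Qed.

Lemma sqintegrableM_integrable f g : sqintegrable f -> sqintegrable g ->
  mu.-integrable setT (EFin \o (fun x => f x * g x)).
Proof.
move=> sf sg.
have /integrableD : mu.-integrable setT (EFin \o (fun x => f x ^+ 2)).
  exact: sqintegrable_integrable_sqr.
move=> /(_ measurableT _ (sqintegrable_integrable_sqr sg)).
apply: le_integrable => //.
  by apply/measurable_EFinP/measurable_funM; [case: sf|case: sg].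
move=> x _ /=; rewrite lee_fin [X in _ <= X]ger0_norm; last first.
  by rewrite addr_ge0// sqr_ge0.
rewrite normrM -(real_normK (num_real (f x))) -(real_normK (num_real (g x))).
set a := `|f x|; set b := `|g x|.
have := sqr_ge0 (a - b); have := sqr_ge0 a; have := sqr_ge0 b.
by rewrite sqrrB; nra.
Qed.

Lemma sqintegrable_le f g : measurable_fun setT f ->
  (forall x, `|f x| <= `|g x|) -> sqintegrable g -> sqintegrable f.
Proof.
move=> mf fg [mg goo]; split => //; apply: le_lt_trans goo.
apply: ge0_le_integral => //=.
- by move=> x _; rewrite lee_fin sqr_ge0.
- by apply/measurable_EFinP; exact: measurable_funX.
- by apply/measurable_EFinP; exact: measurable_funX.
- move=> x _; rewrite lee_fin -(real_normK (num_real (f x))) -(real_normK (num_real (g x))).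
  by rewrite lerXn2r// nnegrE.
Qed.

Lemma sqintegrableD f g : sqintegrable f -> sqintegrable g ->
  sqintegrable (fun x => f x + g x).
Proof.
move=> sf sg; split; first by apply: measurable_funD; [case: sf|case: sg].
have If := sqintegrable_integrable_sqr sf.
have Ig := sqintegrable_integrable_sqr sg.
have Ifg := sqintegrableM_integrable sf sg.
have := integrableD measurableT (integrableD measurableT If Ig)
          (integrableD measurableT Ifg Ifg).
move/(integrable_lty measurableT); congr (_ < _)%E.
apply: eq_integral => x _ /=; rewrite -!EFinD; congr EFin; ring.
Qed.

Lemma sqintegrableZ (c : R) f : sqintegrable f -> sqintegrable (fun x => c * f x).
Proof.
move=> sf; split; first by apply: measurable_funM => //; case: sf.
have := integrableZl measurableT (c ^+ 2) (sqintegrable_integrable_sqr sf).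
move/(integrable_lty measurableT); congr (_ < _)%E.
by apply: eq_integral => x _ /=; rewrite -!EFinM exprMn.
Qed.

Lemma sqintegrableN f : sqintegrable f -> sqintegrable (fun x => - f x).
Proof.
by move=> /(sqintegrableZ (-1)); congr sqintegrable; apply/funext => x; rewrite mulN1r.
Qed.

Lemma sqintegrableB f g : sqintegrable f -> sqintegrable g ->
  sqintegrable (fun x => f x - g x).
Proof. by move=> sf sg; apply: sqintegrableD => //; exact: sqintegrableN. Qed.

Lemma sqintegrable0 : sqintegrable (fun=> 0).
Proof.
split => //; under eq_integral do rewrite expr0n /=.
by rewrite integral0.
Qed.

Lemma sqintegrable_sum I (s : seq I) (P : pred I) (f : I -> T -> R) :
  (forall i, P i -> sqintegrable (f i)) ->
  sqintegrable (fun x => \sum_(i <- s | P i) f i x).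
Proof.
move=> sf; elim: s => [|i s IH].
  by under eq_fun do rewrite big_nil; exact: sqintegrable0.
under eq_fun do rewrite big_cons.
by have [Pi|//] := boolP (P i); apply: sqintegrableD => //; exact: sf.
Qed.

Lemma sqintegrableM_bounded f g (c : R) : measurable_fun setT f ->
  (forall x, `|f x| <= c) -> sqintegrable g -> sqintegrable (fun x => g x * f x).
Proof.
move=> mf fc sg; apply: (@sqintegrable_le _ (fun x => c * g x)).
- by apply: measurable_funM => //; case: sg.
- move=> x; rewrite !normrM mulrC ler_wpM2r//.
  exact: le_trans (fc x) (ler_norm _).
- exact: sqintegrableZ.
Qed.

Lemma EFin_Rintegral f : mu.-integrable setT (EFin \o f) ->
  (\int[mu]_x f x)%:E = (\int[mu]_x (f x)%:E)%E.
Proof. by move=> If; rewrite fineK//; exact: integrable_fin_num. Qed.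

Lemma EFin_Rintegral_sqr f : sqintegrable f ->
  (\int[mu]_x f x ^+ 2)%:E = (\int[mu]_x (f x ^+ 2)%:E)%E.
Proof.
by move=> sf; rewrite -EFin_Rintegral//; exact: sqintegrable_integrable_sqr.
Qed.

Lemma Rintegral_sum I (s : seq I) (P : pred I) (f : I -> T -> R) :
  (forall i, mu.-integrable setT (EFin \o f i)) ->
  \int[mu]_x (\sum_(i <- s | P i) f i x) = \sum_(i <- s | P i) \int[mu]_x f i x.
Proof.
move=> If; apply: EFin_inj; rewrite -sumEFin.
under eq_bigr do rewrite EFin_Rintegral//.
rewrite EFin_Rintegral.
  by under eq_integral do rewrite -sumEFin; rewrite integral_sum.
rewrite (_ : _ \o _ = fun x => (\sum_(i <- s | P i) (f i x)%:E)%E).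
  by apply: integrable_sum => // i _; exact: If.
by apply/funext => x /=; rewrite sumEFin.
Qed.

Lemma Rintegral_sqrB f g : sqintegrable f -> sqintegrable g ->
  \int[mu]_x (f x - g x) ^+ 2 =
  \int[mu]_x f x ^+ 2 - 2 * \int[mu]_x (f x * g x) + \int[mu]_x g x ^+ 2.
Proof.
move=> sf sg.
have If := sqintegrable_integrable_sqr sf.
have Ig := sqintegrable_integrable_sqr sg.
have Ifg := sqintegrableM_integrable sf sg.
have I2 : mu.-integrable setT (EFin \o (fun x => (-2) * (f x * g x))).
  by have := integrableZl measurableT (-2) Ifg; apply: eq_integrable.
rewrite (eq_Rintegral mu (g := fun x => f x ^+ 2 + (-2) * (f x * g x) + g x ^+ 2)); last by move=> x _; ring.
rewrite RintegralD//; last by have := integrableD measurableT If I2.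
by rewrite RintegralD// RintegralZl// mulNr.
Qed.

End square_integrable.

Section square_integrable_probability.
Context d (T : measurableType d) (R : realType) (P : probability T R).

Lemma sqintegrable_bounded (f : T -> R) (c : R) :
  measurable_fun setT f -> (forall x, `|f x| <= c) -> sqintegrable P f.
Proof.
move=> mf fc; apply: (@sqintegrable_le _ _ _ _ f (cst c)) => //.
  by move=> x; exact: le_trans (fc x) (ler_norm _).
split => //; rewrite (eq_integral (cst (c ^+ 2)%:E))// integral_cst//=.
by rewrite probability_setT mule1 ltry.
Qed.

Lemma sqintegrable_integrable (f : T -> R) :
  sqintegrable P f -> P.-integrable setT (EFin \o f).
Proof.
move=> sf; have s1 : sqintegrable P (cst 1).
  by apply: (@sqintegrable_bounded _ 1) => // x; rewrite normr1.
have := sqintegrableM_integrable sf s1; apply: eq_integrable => // x _ /=.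
by rewrite mulr1.
Qed.

End square_integrable_probability.

(** * Orthonormal families *)

Section orthonormal.
Context d (T : measurableType d) (R : realType) (mu : {measure set T -> \bar R}).
Variables (K : choiceType) (psi : K -> T -> R).
Hypothesis psi_sq : forall k, sqintegrable mu (psi k).
Hypothesis psi_on : forall k l, \int[mu]_x (psi k x * psi l x) = (k == l)%:R.

(** Each index contributes a_k^2 - 2 a_k c_k = (a_k - c_k)^2 - c_k^2. Bessel's inequality,
    Parseval's inequality and the error of a regression with empirical coefficients are all read off
    this identity. *)
Lemma orthonormal_decomp (v : T -> R) (G : {fset K}) (a : K -> R) :
  sqintegrable mu v ->
  let c k := \int[mu]_x (v x * psi k x) in
  \int[mu]_x (v x - \sum_(k <- G) a k * psi k x) ^+ 2 =
  \int[mu]_x v x ^+ 2 - \sum_(k <- G) c k ^+ 2 + \sum_(k <- G) (a k - c k) ^+ 2.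
Proof.
move=> sv c.
have sa k : sqintegrable mu (fun x => a k * psi k x) by exact: sqintegrableZ.
have cross (w : T -> R) : sqintegrable mu w ->
    \int[mu]_x (w x * \sum_(k <- G) a k * psi k x) =
    \sum_(k <- G) a k * \int[mu]_x (w x * psi k x).
  move=> sw.
  rewrite (eq_Rintegral mu (g := fun x => \sum_(k <- G) a k * (w x * psi k x)));
    last by move=> x _; rewrite mulr_sumr; apply: eq_bigr => k _; rewrite mulrCA.
  have I k : mu.-integrable setT (EFin \o (fun x => w x * psi k x)).
    exact: sqintegrableM_integrable.
  rewrite Rintegral_sum; last first.
    by move=> k; have := integrableZl measurableT (a k) (I k); apply: eq_integrable.
  by apply: eq_bigr => k _; rewrite RintegralZl.
rewrite Rintegral_sqrB//; last exact: sqintegrable_sum.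
rewrite (cross v)// [X in _ + X](eq_Rintegral mu (g := fun x =>
  (\sum_(k <- G) a k * psi k x) * \sum_(k <- G) a k * psi k x)); last first.
  by move=> x _; rewrite expr2.
rewrite (cross (fun x => \sum_(k <- G) a k * psi k x)); last exact: sqintegrable_sum.
rewrite -!addrA; congr (_ + _).
rewrite mulr_sumr -!sumrN -!big_split /= !big_seq; apply: eq_bigr => k kG.
rewrite [X in _ + _ * X = _](_ : _ = a k); first by rewrite -/(c k); ring.
rewrite (eq_Rintegral mu (g := fun x => psi k x * \sum_(k <- G) a k * psi k x));
  last by move=> x _; rewrite mulrC.
rewrite cross// (big_fsetD1 k)//= psi_on eqxx mulr1 big_seq big1 ?addr0// => l.
by rewrite !inE => /andP[lk _]; rewrite psi_on eq_sym (negbTE lk) mulr0.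
Qed.

Lemma bessel (v : T -> R) (G : {fset K}) : sqintegrable mu v ->
  \sum_(k <- G) (\int[mu]_x (v x * psi k x)) ^+ 2 <= \int[mu]_x v x ^+ 2.
Proof.
move=> sv; rewrite -subr_ge0.
have := orthonormal_decomp G (fun k => \int[mu]_x (v x * psi k x)) sv.
rewrite /= [X in _ = _ + X]big1 ?addr0; last by move=> k _; rewrite subrr expr0n.
by move=> <-; apply: Rintegral_ge0 => x _; exact: sqr_ge0.
Qed.

End orthonormal.

(** * Densities, image measures and laws *)

Section density.
Context d (T : measurableType d) (R : realType).
Variables (mu nu : {measure set T -> \bar R}) (h : T -> R).
Hypothesis mh : measurable_fun setT h.
Hypothesis h_ge0 : forall x, 0 <= h x.
Hypothesis nuE : forall A, measurable A -> nu A = (\int[mu]_(x in A) (h x)%:E)%E.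

Import HBNNSimple.

Let integral_density_indic E : measurable E ->
  (\int[nu]_x (\1_E x)%:E = \int[mu]_x ((\1_E x)%:E * (h x)%:E))%E.
Proof.
move=> mE; rewrite integral_indic//= setIT nuE// integral_mkcond.
apply: eq_integral => x _; rewrite patchE indicE.
by case: ifPn; rewrite ?mul1e ?mul0e.
Qed.

Let integral_density_nnsfun (f : {nnsfun T >-> R}) :
  (\int[nu]_x (f x)%:E = \int[mu]_x ((f x)%:E * (h x)%:E))%E.
Proof.
under [LHS]eq_integral do rewrite fimfunE -fsumEFin//.
rewrite [LHS]ge0_integral_fsum//; last 2 first.
  - by move=> r; exact/measurable_EFinP/measurableT_comp.
  - by move=> n x _; rewrite EFinM nnfun_muleindic_ge0.
under [RHS]eq_integral.
  move=> x xD; rewrite fimfunE -fsumEFin// muleC ge0_mule_fsumr; last first.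
    by move=> r; rewrite EFinM nnfun_muleindic_ge0.
  over.
rewrite [RHS]ge0_integral_fsum//; last 2 first.
  - move=> r; apply: emeasurable_funM; first exact/measurable_EFinP.
    by apply/measurable_EFinP/measurableT_comp.
  - move=> n x _; rewrite EFinM mule_ge0 ?lee_fin//.
    by have := nnfun_muleindic_ge0 f n x; rewrite -EFinM lee_fin.
apply: eq_fsbigr => r _; rewrite integralZl_indic_nnsfun//= integral_density_indic//.
have [->|r0] := eqVneq r 0.
  rewrite mul0e; apply/esym/integral0_eq => x _.
  by rewrite mul0r mule0.
(* A nonnegative scalar leaves the integral; a negative value is not attained, so its level set is
   empty. *)
have [r_ge0|r_lt0] := leP 0 r.
  rewrite -ge0_integralZl//.
  - by apply: eq_integral => x _; rewrite [in RHS]EFinM [RHS]muleC muleA.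
  - apply: emeasurable_funM; last exact/measurable_EFinP.
    by apply/measurable_EFinP.
  - by move=> x _; rewrite mule_ge0 ?lee_fin.
rewrite preimage_nnfun0//; under eq_integral do rewrite indic0 /= mul0e.
rewrite integral0 mule0.
by apply/esym/integral0_eq => x _; rewrite indic0 /= mulr0 mule0.
Qed.

Lemma ge0_integral_density (f : T -> \bar R) : measurable_fun setT f ->
  (forall x, 0 <= f x)%E -> (\int[nu]_x f x = \int[mu]_x (f x * (h x)%:E))%E.
Proof.
move=> mf f0; pose f_ := nnsfun_approx measurableT mf.
have cf x : ((f_ n x)%:E @[n --> \oo] --> f x)%E by exact: cvg_nnsfun_approx.
transitivity (limn (fun n => \int[nu]_x (f_ n x)%:E)%E).
  rewrite -monotone_convergence//=.
  - by apply: eq_integral => x _; apply/esym/cvg_lim => //; exact: cf.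
  - by move=> n; exact/measurable_EFinP/measurable_funTS.
  - by move=> n ? _; rewrite lee_fin.
  - by move=> ? _ ? ? mn; rewrite lee_fin; exact/lefP/nd_nnsfun_approx.
under eq_fun do rewrite integral_density_nnsfun.
rewrite -monotone_convergence//=.
- apply: eq_integral => x _; apply/cvg_lim => //.
  by apply: cvgeZr => //; exact: cf.
- move=> n; apply: emeasurable_funM; last exact/measurable_EFinP.
  exact/measurable_EFinP/measurable_funTS.
- by move=> n ? _; rewrite mule_ge0 ?lee_fin.
- move=> x _ m n mn; rewrite lee_wpmul2r ?lee_fin//.
  exact/lefP/nd_nnsfun_approx.
Qed.

(** Valid without integrability: as [h] is nonnegative, the positive and negative parts of f h are
    those of f times h, and both integrals are the differences of the integrals of these parts. *)
Lemma integral_density (f : T -> R) : measurable_fun setT f ->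
  (\int[nu]_x (f x)%:E = \int[mu]_x (f x * h x)%:E)%E.
Proof.
move=> mf; have mEf : measurable_fun setT (EFin \o f) by exact/measurable_EFinP.
rewrite integralE [RHS]integralE; congr (_ - _)%E.
  rewrite ge0_integral_density; last by move=> x; exact: funepos_ge0.
    apply: eq_integral => x _; rewrite !funeposE -!EFin_max -EFinM; congr EFin.
    by rewrite maxr_pMl// mul0r.
  exact: measurable_funepos.
rewrite ge0_integral_density; last by move=> x; exact: funeneg_ge0.
  apply: eq_integral => x _; rewrite !funenegE -!EFinN -!EFin_max -EFinM; congr EFin.
  by rewrite maxr_pMl// mul0r mulNr.
exact: measurable_funeneg.
Qed.

End density.

Section image_measure.
Context d1 d2 (T1 : measurableType d1) (T2 : measurableType d2) (R : realType).
Variables (mu : {measure set T1 -> \bar R}) (nu : {measure set T2 -> \bar R}).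
Variables (X : T1 -> T2) (f : T2 -> \bar R).
Hypothesis mX : measurable_fun setT X.
Hypothesis nuE : forall A, measurable A -> nu A = mu (X @^-1` A).

Lemma ge0_integral_image : measurable_fun setT f -> (forall x, 0 <= f x)%E ->
  (\int[nu]_x f x = \int[mu]_w f (X w))%E.
Proof.
move=> mf f0.
have /= <- := @ge0_integral_pushforward _ _ _ _ _ _ mX mu setT f measurableT mf (fun y _ => f0 y).
by apply: eq_measure_integral => A mA _; exact: nuE.
Qed.

End image_measure.

Lemma integral_image d1 d2 (T1 : measurableType d1) (T2 : measurableType d2)
    (R : realType) (mu : {measure set T1 -> \bar R})
    (nu : {measure set T2 -> \bar R}) (X : T1 -> T2) (f : T2 -> \bar R) :
  measurable_fun setT X -> (forall A, measurable A -> nu A = mu (X @^-1` A)) ->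
  measurable_fun setT f -> (\int[nu]_x f x = \int[mu]_w f (X w))%E.
Proof.
move=> mX nuE mf; rewrite integralE [RHS]integralE.
congr (_ - _)%E.
  rewrite (ge0_integral_image mX nuE (measurable_funepos mf)); last first.
    by move=> x; exact: funepos_ge0.
  by apply: eq_integral => w _; rewrite !funeposE.
rewrite (ge0_integral_image mX nuE (measurable_funeneg mf)); last first.
  by move=> x; exact: funeneg_ge0.
by apply: eq_integral => w _; rewrite !funenegE.
Qed.

Section law.
Context d (Omega : measurableType d) (R : realType) (P : probability Omega R).

(** Hides the bundling of X as a measurable map: only a probability and its defining equation
    remain. *)
Lemma law_exists d' (E : measurableType d') (X : Omega -> E) :
  measurable_fun setT X ->
  exists Q : probability E R, forall A, measurable A -> Q A = P (X @^-1` A).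
Proof.
move=> mX; pose X' : {mfun Omega >-> E} :=
  HB.pack X (isMeasurableFun.Build _ _ _ _ X mX).
by exists (distribution P X').
Qed.

End law.

(** * Decoupling of independent variables *)

Section decoupling.
Context d (Omega : measurableType d) (R : realType) (P : probability Omega R).
Context d1 (E1 : measurableType d1) d2 (E2 : measurableType d2).
Variables (X : Omega -> E1) (Y : Omega -> E2).
Hypotheses (mX : measurable_fun setT X) (mY : measurable_fun setT Y).
Hypothesis indepXY : forall A B, measurable A -> measurable B ->
  P (X @^-1` A `&` Y @^-1` B) = (P (X @^-1` A) * P (Y @^-1` B))%E.

Let mXY : measurable_fun setT (fun w => (X w, Y w)).
Proof. exact: measurable_fun_pair. Qed.

Let lawXY (Q1 : probability E1 R) (Q2 : probability E2 R) :
  (forall A, measurable A -> Q1 A = P (X @^-1` A)) ->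
  (forall A, measurable A -> Q2 A = P (Y @^-1` A)) ->
  forall A, measurable A ->
    (Q1 \x Q2)%E A = P ((fun w => (X w, Y w)) @^-1` A).
Proof.
move=> QX QY A mA; have [Q QE] := law_exists P mXY.
rewrite -QE//; apply: product_measure_unique => // B C mB mC.
apply: etrans (QE _ (measurableX mB mC)) _.
by apply: etrans (indepXY mB mC) _; congr (_ * _)%E; apply/esym; [exact: QX|exact: QY].
Qed.

(** Tonelli for the law of (X, Y), a product by independence. [E1] and [E2] may be Omega itself with
    coarser sigma-algebras and X, Y the identity; conditioning is expressed in that form later
    on. *)
Lemma ge0_integral_decoupling (H : E1 * E2 -> \bar R) :
  measurable_fun setT H -> (forall z, 0 <= H z)%E ->
  (\int[P]_w H (X w, Y w) = \int[P]_w \int[P]_w' H (X w, Y w'))%E.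
Proof.
move=> mH H0.
have [Q1 Q1E] := law_exists P mX; have [Q2 Q2E] := law_exists P mY.
rewrite -(ge0_integral_image mXY (lawXY Q1E Q2E))// fubini_tonelli1//.
rewrite (ge0_integral_image mX Q1E)//; last 2 first.
- exact: measurable_fun_fubini_tonelli_F.
- by move=> x; apply: integral_ge0.
apply: eq_integral => w _; rewrite /fubini_F (ge0_integral_image mY Q2E)//.
by apply: measurableT_comp => //; exact: measurable_pair1.
Qed.

Lemma integral_decoupling (H : E1 * E2 -> \bar R) :
  measurable_fun setT H -> P.-integrable setT (fun w => H (X w, Y w)) ->
  (\int[P]_w H (X w, Y w) = \int[P]_w \int[P]_w' H (X w, Y w'))%E.
Proof.
move=> mH /integrableP[mHXY iHXY].
have [Q1 Q1E] := law_exists P mX; have [Q2 Q2E] := law_exists P mY.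
have iH : (Q1 \x Q2)%E.-integrable setT H.
  apply/integrableP; split => //.
  rewrite (ge0_integral_image mXY (lawXY Q1E Q2E))//.
  exact: measurableT_comp.
rewrite -(integral_image mXY (lawXY Q1E Q2E))// -integral12_prod_meas1//.
rewrite (integral_image mX Q1E)//; last exact: measurable_fubini_F iH.
apply: eq_integral => w _; rewrite /fubini_F (integral_image mY Q2E)//.
by apply: measurableT_comp => //; exact: measurable_pair1.
Qed.

End decoupling.

Lemma integral_indepM d (Omega : measurableType d) (R : realType)
    (P : probability Omega R) d1 (E1 : measurableType d1)
    d2 (E2 : measurableType d2) (X : Omega -> E1) (Y : Omega -> E2)
    (f : E1 -> R) (g : E2 -> R) :
  measurable_fun setT X -> measurable_fun setT Y ->
  (forall A B, measurable A -> measurable B ->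
    P (X @^-1` A `&` Y @^-1` B) = (P (X @^-1` A) * P (Y @^-1` B))%E) ->
  measurable_fun setT f -> measurable_fun setT g ->
  sqintegrable P (f \o X) -> sqintegrable P (g \o Y) ->
  \int[P]_w (f (X w) * g (Y w)) = \int[P]_w f (X w) * \int[P]_w g (Y w).
Proof.
move=> mX mY XY mf mg sf sg.
have i1 := @sqintegrable_integrable _ _ _ P.
apply: EFin_inj; rewrite EFin_Rintegral; last exact: sqintegrableM_integrable sf sg.
have /= -> := @integral_decoupling _ _ _ P _ _ _ _ _ _ mX mY XY
  (fun z => (f z.1 * g z.2)%:E).
- rewrite EFinM EFin_Rintegral ?EFin_Rintegral; [|exact: i1 sg|exact: i1 sf].
  have c : (\int[P]_w (g (Y w))%:E)%E \is a fin_num.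
    by apply: integrable_fin_num => //; exact: i1 sg.
  rewrite -(fineK c) -integralZr//; last exact: i1 sf.
  by apply: eq_integral => w _; rewrite fineK// -integralZl//; exact: i1 sg.
- apply/measurable_EFinP; apply: measurable_funM.
    exact: measurableT_comp mf measurable_fst.
  exact: measurableT_comp mg measurable_snd.
- exact: sqintegrableM_integrable sf sg.
Qed.

(** In the variable A both sides are finite measures, the restriction of P to F and the multiple of
    P by P(F); they agree on a pi-system that contains the whole space. *)
Lemma indep_g_sigma_algebra d (Omega : measurableType d) (R : realType)
    (P : probability Omega R) (G : set (set Omega)) (F : set Omega) :
  G `<=` measurable -> setI_closed G -> G setT -> measurable F ->
  (forall A, G A -> P (A `&` F) = (P A * P F)%E) ->
  forall A, <<s G >> A -> P (A `&` F) = (P A * P F)%E.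
Proof.
move=> Gm GI GT mF GF A sA.
have PF : (P F = (fine (P F))%:E) by rewrite fineK//; exact: fin_num_measure.
pose r : {nonneg R} := NngNum (fine_ge0 (measure_ge0 P F)).
have rE B : mscale r P B = (P F * P B)%E by rewrite [in RHS]PF.
have -> : P (A `&` F) = mrestr P mF A by [].
rewrite (@g_sigma_algebra_measure_unique _ _ _ G Gm (fun=> setT) _ _
  (mrestr P mF) (mscale r P))//.
- by apply: etrans (rE A) _; rewrite muleC.
- by rewrite bigcup_const.
- by move=> B GB; apply: etrans (GF _ GB) (esym _); rewrite muleC; exact: rE.
- by move=> _; suff: (P (setT `&` F) < +oo)%E by []; rewrite setTI PF ltry.
Qed.

(** * Parseval's inequality *)

Section approximation.
Context d (T : measurableType d) (R : realType) (Q : probability T R).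
Variables (K : choiceType) (psi : K -> T -> R).
Hypothesis psi_sq : forall k, sqintegrable Q (psi k).

(** A list that may repeat an index, so that the sum of two combinations is a concatenation. *)
Definition spanned (f : T -> R) : Prop :=
  exists s : seq (R * K), forall x, f x = \sum_(p <- s) p.1 * psi p.2 x.

(** Membership in the L^2(Q)-closure of the linear span of [psi]. *)
Definition approximable (f : T -> R) : Prop :=
  sqintegrable Q f /\ forall e : R, 0 < e ->
    exists2 g, spanned g & \int[Q]_x (f x - g x) ^+ 2 <= e.

Lemma spanned_sqintegrable f : spanned f -> sqintegrable Q f.
Proof.
move=> [s fE]; have -> : f = (fun x => \sum_(p <- s) p.1 * psi p.2 x) by apply/funext.
by apply: sqintegrable_sum => p _; exact: sqintegrableZ.
Qed.

Lemma spannedD f g : spanned f -> spanned g -> spanned (fun x => f x + g x).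
Proof.
by move=> [s fE] [t gE]; exists (s ++ t) => x; rewrite big_cat fE gE.
Qed.

Lemma spannedZ (c : R) f : spanned f -> spanned (fun x => c * f x).
Proof.
move=> [s fE]; exists [seq (c * p.1, p.2) | p <- s] => x.
by rewrite big_map fE mulr_sumr; apply: eq_bigr => p _; rewrite mulrA.
Qed.

Lemma spanned_approximable f : spanned f -> approximable f.
Proof.
move=> sf; split; first exact: spanned_sqintegrable.
move=> e e0; exists f => //; rewrite (eq_Rintegral Q (g := cst 0)).
  by rewrite Rintegral_cst// mul0r ltW.
by move=> x _; rewrite subrr expr0n.
Qed.

Lemma le_Rintegral_sqr2 (f g h : T -> R) :
  sqintegrable Q f -> sqintegrable Q g -> sqintegrable Q h ->
  (forall x, f x ^+ 2 <= 2 * g x ^+ 2 + 2 * h x ^+ 2) ->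
  \int[Q]_x f x ^+ 2 <= 2 * \int[Q]_x g x ^+ 2 + 2 * \int[Q]_x h x ^+ 2.
Proof.
move=> sf sg sh fgh.
have i2 (u : T -> R) : sqintegrable Q u ->
    Q.-integrable setT (EFin \o (fun x => 2 * u x ^+ 2)).
  move=> su; have := integrableZl measurableT 2 (sqintegrable_integrable_sqr su).
  exact: eq_integrable.
rewrite -!RintegralZl//; [|exact: sqintegrable_integrable_sqr..].
rewrite -RintegralD//; [|exact: i2..].
apply: le_Rintegral => //; first exact: sqintegrable_integrable_sqr.
by have := integrableD measurableT (i2 _ sg) (i2 _ sh).
Qed.

Lemma approximable_close f : sqintegrable Q f ->
  (forall e : R, 0 < e ->
    exists2 g, approximable g & \int[Q]_x (f x - g x) ^+ 2 <= e) ->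
  approximable f.
Proof.
move=> sf H; split => // e e0.
(* Two squared errors of e / 4 add up to e through (u + v)^2 <= 2 u^2 + 2 v^2. *)
have e4 : 0 < e / 4 by rewrite divr_gt0.
have [g [sg Hg] fg] := H _ e4; have [h sh gh] := Hg _ e4.
exists h => //; have sqh := spanned_sqintegrable sh.
apply: le_trans (@le_Rintegral_sqr2 _ (fun x => f x - g x) (fun x => g x - h x) _ _ _ _) _.
- exact: sqintegrableB.
- exact: sqintegrableB.
- exact: sqintegrableB.
- move=> x; have := sqr_ge0 ((f x - g x) - (g x - h x)); nra.
- by lra.
Qed.

Lemma approximableD f g : approximable f -> approximable g ->
  approximable (fun x => f x + g x).
Proof.
move=> [sf Hf] [sg Hg]; split; first exact: sqintegrableD.
move=> e e0; have e4 : 0 < e / 4 by rewrite divr_gt0.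
have [f' sf' ff'] := Hf _ e4; have [g' sg' gg'] := Hg _ e4.
exists (fun x => f' x + g' x); first exact: spannedD.
have qf := spanned_sqintegrable sf'; have qg := spanned_sqintegrable sg'.
apply: le_trans (@le_Rintegral_sqr2 _ (fun x => f x - f' x) (fun x => g x - g' x) _ _ _ _) _.
- by apply: sqintegrableB; exact: sqintegrableD.
- exact: sqintegrableB.
- exact: sqintegrableB.
- move=> x; have := sqr_ge0 ((f x - f' x) - (g x - g' x)); nra.
- by lra.
Qed.

Lemma approximableZ (c : R) f : approximable f -> approximable (fun x => c * f x).
Proof.
move=> [sf Hf]; split; first exact: sqintegrableZ.
(* The added 1 keeps the tolerance e / (c^2 + 1) meaningful when c = 0. *)
move=> e e0; have c0 : 0 < c ^+ 2 + 1 by rewrite ltr_wpDl// sqr_ge0.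
have [g sg fg] := Hf (e / (c ^+ 2 + 1)) (divr_gt0 e0 c0).
exists (fun x => c * g x); first exact: spannedZ.
have qg := spanned_sqintegrable sg.
rewrite (eq_Rintegral Q (g := fun x => c ^+ 2 * (f x - g x) ^+ 2)); last first.
  by move=> x _; rewrite -mulrBr exprMn.
rewrite RintegralZl//; last by apply: sqintegrable_integrable_sqr; exact: sqintegrableB.
apply: le_trans (ler_wpM2l (sqr_ge0 c) fg) _.
rewrite mulrA ler_pdivrMr// mulrC ler_wpM2l ?(ltW e0)//.
by rewrite lerDl.
Qed.

Lemma approximable_sum I (s : seq I) (f : I -> T -> R) :
  (forall i, approximable (f i)) ->
  approximable (fun x => \sum_(i <- s) f i x).
Proof.
move=> H; elim: s => [|i s IH].
  apply: spanned_approximable; exists [::] => x.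
  by rewrite !big_nil.
under eq_fun do rewrite big_cons.
exact: approximableD.
Qed.

(** Dominated convergence for (f - f_n)^2 <= 4 D^2. It carries the three limits of the density
    proof: countable unions, simple functions, Bernstein polynomials. *)
Lemma approximable_dominated (f_ : nat -> T -> R) (f D : T -> R) :
  (forall n, approximable (f_ n)) -> sqintegrable Q D ->
  (forall n x, `|f_ n x| <= D x) ->
  (forall x, f_ n x @[n --> \oo] --> f x) ->
  approximable f.
Proof.
move=> H sD fD cf.
have mf : measurable_fun setT f.
  apply: (@measurable_fun_cvg _ _ _ setT f_ f) => //.
  by move=> n; case: (H n) => -[].
have fleD x : `|f x| <= D x.
  have /cvg_norm cn := cf x.
  apply: (cvgr_to_le cn); near=> n; exact: fD.
have sf : sqintegrable Q f.
  by apply: (sqintegrable_le mf _ sD) => x; exact: le_trans (fleD x) (ler_norm _).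
have D0 x : 0 <= D x by exact: le_trans (fD 0%N x).
have bnd n x : (f x - f_ n x) ^+ 2 <= 4 * D x ^+ 2.
  have : `|f x - f_ n x| <= 2 * D x.
    apply: le_trans (ler_normB _ _) _.
    by have := fleD x; have := fD n x; lra.
  rewrite -(real_normK (num_real (f x - f_ n x))) => h.
  have -> : 4 * D x ^+ 2 = (2 * D x) ^+ 2 by ring.
  by rewrite lerXn2r// nnegrE// mulr_ge0.
have c0 : \int[Q]_x (f x - f_ n x) ^+ 2 @[n --> \oo] --> 0.
  apply: fine_cvg.
  have m1 n : measurable_fun setT (fun x => ((f x - f_ n x) ^+ 2)%:E).
    apply/measurable_EFinP/measurable_funX/measurable_funB => //.
    by case: (H n) => -[].
  have c1 : {ae Q, forall x, setT x ->
      ((f x - f_ n x) ^+ 2)%:E @[n --> \oo] --> (cst 0%E x : \bar R)}.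
    apply: aeW => x _; apply: cvg_EFin; first by near=> n.
    rewrite [X in _ --> X](_ : _ = (f x - f x) ^+ 2); last by rewrite subrr expr0n.
    apply: (@cvg_comp _ _ _ _ (fun z => z ^+ 2)); last exact: exprn_continuous.
    by apply: cvgB; [exact: cvg_cst|exact: cf].
  have i1 : Q.-integrable setT (fun x => (4 * D x ^+ 2)%:E).
    have := integrableZl measurableT 4 (sqintegrable_integrable_sqr sD).
    exact: eq_integrable.
  have b1 : {ae Q, forall x n, setT x ->
      (`|((f x - f_ n x) ^+ 2)%:E| <= (4 * D x ^+ 2)%:E)%E}.
    by apply: aeW => x n _; rewrite /= lee_fin ger0_norm ?sqr_ge0.
  have [_ _] := dominated_convergence measurableT m1 (measurable_cst _) c1 i1 b1.
  by rewrite integral0.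
apply: approximable_close => // e e0.
have /cvgrPdist_le /(_ _ e0) [N _ HN] := c0.
exists (f_ N); first exact: H.
have := HN N (leqnn N); rewrite sub0r normrN; apply: le_trans; exact: ler_norm.
Unshelve. all: by end_near. Qed.

Section dense.
Variable G : set (set T).
Hypothesis GE : @measurable _ T = <<s G >>.
Hypothesis GI : setI_closed G.
Hypothesis approx1 : approximable (cst 1).
Hypothesis approxG : forall A, G A -> approximable (\1_A).

(** Dynkin's theorem: the sets with approximable indicator are closed under complement, by 1 - 1_S,
    and under disjoint countable union, by dominated convergence of the partial sums. *)
Lemma approximable_indic A : measurable A -> approximable (\1_A).
Proof.
rewrite GE; apply: (dynkin_induction (P := fun A => approximable (\1_A)) GE GI).
- by rewrite indicT.
- by [].
- move=> S mS aS.
  have : approximable (fun x => 1 + (-1) * \1_S x).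
    by apply: approximableD => //; exact: approximableZ.
  congr approximable; apply/funext => x; rewrite !indicE in_setC.
  by case: (x \in S) => /=; rewrite ?mulr1 ?mulr0 ?addr0 ?subrr.
- move=> F mF tF aF.
  pose f_ n : T -> R := fun x => \sum_(0 <= i < n) \1_(F i) x.
  have cf x : ((f_ n x)%:E @[n --> \oo] --> (\1_(\bigcup_n F n) x)%:E)%E.
    rewrite indic_bigcup//; under eq_fun do rewrite /f_ -sumEFin.
    by apply: is_cvg_nneseries => n _ _; rewrite lee_fin.
  apply: (@approximable_dominated f_ _ (cst 1)).
  - by move=> n; exact: approximable_sum.
  - by apply: (@sqintegrable_bounded _ _ _ _ _ 1) => // x; rewrite normr1.
  - move=> n x; rewrite ger0_norm ?sumr_ge0//= -lee_fin.
    apply: (@le_trans _ _ (\1_(\bigcup_n F n) x)%:E); last first.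
      by rewrite lee_fin indicE; case: (_ \in _).
    rewrite indic_bigcup// /f_ -sumEFin; apply: nneseries_lim_ge => k _ _.
    by rewrite lee_fin.
  - by move=> x; have /fine_cvgP[_] := cf x.
Qed.

Import HBNNSimple.

Lemma approximable_ge0 f : sqintegrable Q f -> (forall x, 0 <= f x) -> approximable f.
Proof.
move=> sf f0; have mf : measurable_fun setT (EFin \o f).
  by apply/measurable_EFinP; case: sf.
pose f_ := nnsfun_approx measurableT mf.
have cf x : ((f_ n x)%:E @[n --> \oo] --> (f x)%:E)%E.
  by apply: (cvg_nnsfun_approx measurableT mf) => // y _; rewrite lee_fin.
have cf' x : f_ n x @[n --> \oo] --> f x.
  by have /fine_cvgP[] := cf x.
apply: (@approximable_dominated (fun n x => f_ n x) f f) => //.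
- move=> n.
  have -> : (fun x => f_ n x) = (fun x => \sum_(y <- fset_set (range (f_ n))) y * \1_(f_ n @^-1` [set y]) x).
    by apply/funext => x; rewrite {1}(fimfunE (f_ n)) fsbig_finite.
  apply: approximable_sum => y; apply: approximableZ; exact: approximable_indic.
- move=> n x; rewrite ger0_norm//.
  have nd : nondecreasing_seq (fun k => f_ k x).
    by move=> a b ab; exact/lefP/nd_nnsfun_approx.
  have := nondecreasing_cvgn_le nd _ n; rewrite (cvg_lim _ (cf' x))//; apply.
  exact: cf'.
Qed.

Lemma sqintegrable_approximable f : sqintegrable Q f -> approximable f.
Proof.
move=> sf.
have -> : f = (fun x => f^\+ x + (-1) * f^\- x)%R.
  apply/funext => x; rewrite mulN1r.
  by have /(congr1 (fun h => h x)) /= <- := funrposBneg f.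
have mf : measurable_fun setT f by case: sf.
have fE x : `|f x| = f^\+ x + f^\- x.
  by have /(congr1 (fun h => h x)) /= <- := funrposDneg f.
apply: approximableD; last apply: approximableZ.
- apply: approximable_ge0; last by move=> x; exact: funrpos_ge0.
  apply: (sqintegrable_le _ _ sf); first exact: measurable_funrpos.
  by move=> x; rewrite fE ger0_norm ?funrpos_ge0// lerDl funrneg_ge0.
- apply: approximable_ge0; last by move=> x; exact: funrneg_ge0.
  apply: (sqintegrable_le _ _ sf); first exact: measurable_funrneg.
  by move=> x; rewrite fE ger0_norm ?funrneg_ge0// lerDr funrpos_ge0.
Qed.

End dense.

End approximation.

Lemma sum_fset_split (K : choiceType) (R : realDomainType) (H G : {fset K})
    (F : K -> R) : (forall k, 0 <= F k) ->
  \sum_(k <- H) F k <= \sum_(k <- (H `\` G)%fset) F k + \sum_(k <- G) F k.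
Proof.
move=> F0; rewrite (bigID (mem G))/= addrC; apply: lerD.
  rewrite big_fset_condE le_eqVlt; apply/orP; left; apply/eqP; congr bigop.
  by congr (enum_fset _); apply/fsetP => k; rewrite !inE andbC.
rewrite [leRHS](bigID (mem H))/= -[leLHS]addr0; apply: lerD.
  rewrite [leLHS]big_fset_condE [leRHS]big_fset_condE le_eqVlt; apply/orP; left; apply/eqP; congr bigop.
  by congr (enum_fset _); apply/fsetP => k; rewrite !inE andbC.
by apply: sumr_ge0.
Qed.

Section parseval.
Context d (T : measurableType d) (R : realType) (Q : probability T R).
Variables (K : choiceType) (psi : K -> T -> R).
Hypothesis psi_sq : forall k, sqintegrable Q (psi k).
Hypothesis psi_on : forall k l, \int[Q]_x (psi k x * psi l x) = (k == l)%:R.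

(** A combination within e of v involves a finite index set H, and no combination over H is closer
    than |v|^2 - sum_H c_k^2. The indices of H outside G form a finite part of the infinite sum. *)
Lemma parseval_tail (v : T -> R) (c : K -> R) (G : {fset K}) :
  approximable Q psi v ->
  (forall k, c k = \int[Q]_x (v x * psi k x)) ->
  ((\int[Q]_x v x ^+ 2 - \sum_(k <- G) c k ^+ 2)%:E <=
   \esum_(k in [set k | k \notin G]) (c k ^+ 2)%:E)%E.
Proof.
move=> [sv Hv] cE.
apply/lee_addgt0Pr => e e0; have [g [s gE] vg] := Hv _ e0.
pose H := [fset p.2 | p in s]%fset.
(* Terms of the list with equal index are merged, as [orthonormal_decomp] has one coefficient per
   index. *)
pose a k := \sum_(p <- s | p.2 == k) p.1.
have gE' x : g x = \sum_(k <- H) a k * psi k x.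
  rewrite gE.
  transitivity (\sum_(p <- s) \sum_(k <- H | p.2 == k) p.1 * psi k x).
    rewrite big_seq [RHS]big_seq; apply: eq_bigr => p ps.
    have pH : p.2 \in H by apply/imfsetP; exists p.
    rewrite (eq_bigl (pred1 p.2)); last by move=> k; rewrite /= eq_sym.
    by rewrite -big_filter filter_pred1_uniq ?fset_uniq// big_seq1.
  rewrite (exchange_big_dep xpredT)//=; apply: eq_bigr => k _.
  by rewrite mulr_suml.
have := orthonormal_decomp psi_sq psi_on H a sv => /= dec.
have bound : \int[Q]_x v x ^+ 2 <= e + \sum_(k <- H) c k ^+ 2.
  under [X in _ + X]eq_bigr do rewrite cE.
  rewrite -lerBlDr; apply: le_trans vg.
  rewrite [leRHS](eq_Rintegral Q (g := fun x => (v x - \sum_(k <- H) a k * psi k x) ^+ 2)).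
    by rewrite dec lerDl sumr_ge0// => k _; exact: sqr_ge0.
  by move=> x _; rewrite gE'.
apply: (@le_trans _ _ (e + \sum_(k <- (H `\` G)%fset) c k ^+ 2)%:E).
  rewrite lee_fin lerBlDr; apply: le_trans bound _; rewrite -addrA lerD2l.
  by apply: sum_fset_split => k; exact: sqr_ge0.
rewrite EFinD addeC leeD2r//; apply: esum_ge.
exists [set` (H `\` G)%fset].
  split; first exact: finite_fset.
  by move=> k /=; rewrite inE => /andP[].
by rewrite fsbig_finite ?finite_fset//= set_fsetK sumEFin.
Qed.

End parseval.

(** * Measures with a density and distribution functions *)

Section density_measure.
Context d (T : measurableType d) (R : realType).
Variables (mu : {measure set T -> \bar R}) (h : T -> R).
Hypothesis mh : measurable_fun setT h.
Hypothesis h_ge0 : forall x, 0 <= h x.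
Hypothesis h1 : (\int[mu]_x (h x)%:E = 1)%E.

Let dens (A : set T) : \bar R := (\int[mu]_(x in A) (h x)%:E)%E.

Let dens0 : dens set0 = 0%E. Proof. by rewrite /dens integral_set0. Qed.

Let dens_ge0 A : (0 <= dens A)%E.
Proof. by apply: integral_ge0 => x _; rewrite lee_fin. Qed.

Let dens_sigma_additive : semi_sigma_additive dens.
Proof.
move=> /= F mF tF mUF; rewrite /dens; apply: cvg_toP.
  apply: ereal_nondecreasing_is_cvgn => m n mn.
  apply: lee_sum_nneg_natr => // k _ _.
  by apply: integral_ge0 => /= x Fkx; rewrite lee_fin.
rewrite ge0_integral_bigcup//=.
- by apply: measurable_funTS; apply: measurableT_comp.
- by move=> x _; rewrite lee_fin.
Qed.

HB.instance Definition _ := isMeasure.Build _ _ _ dens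
  dens0 dens_ge0 dens_sigma_additive.

Let densT : dens setT = 1%E. Proof. exact: h1. Qed.

HB.instance Definition _ := @Measure_isProbability.Build _ _ R dens densT.

Lemma density_probability : exists Q : probability T R,
  forall A, Q A = (\int[mu]_(x in A) (h x)%:E)%E.
Proof. by exists dens. Qed.

End density_measure.

Section tuple_product.
Context (R : realType).
Local Notation leb := (@lebesgue_measure R).

(** Induction on n by Fubini, the measure in dimension n + 1 being the image of a product under
    cons. Integrability is part of the induction since Fubini for signed functions requires it. *)
Lemma lebesgue_tuple_prod n (h : 'I_n -> R -> R) :
  (forall l, leb.-integrable setT (EFin \o h l)) ->
  (lebesgue_tuple R n).-integrable setT
    (EFin \o (fun x => \prod_(l < n) h l (tnth x l))) /\
  \int[lebesgue_tuple R n]_x (\prod_(l < n) h l (tnth x l)) =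
  \prod_(l < n) \int[leb]_u h l u.
Proof.
elim: n h => [|n IH] h ih.
  have E x : \prod_(l < 0) h l (tnth x l) = 1 by rewrite big_ord0.
  have mE : measurable_fun [set: 0.-tuple R]
      (fun x => (\prod_(l < 0) h l (tnth x l))%:E).
    under eq_fun do rewrite E.
    exact: measurable_cst.
  have dE (f : 0.-tuple R -> \bar R) : measurable_fun setT f ->
      (\int[lebesgue_tuple R 0]_x f x = f [tuple])%E.
    move=> mf; apply: etrans (integral_dirac _ measurableT mf) _.
    by rewrite diracE in_setT mul1e.
  split; last by rewrite big_ord0 /Rintegral dE//= E.
  apply/integrableP; split => //.
  by rewrite dE ?ltry//; exact: measurableT_comp.
have mh l : measurable_fun setT (h l).
  by have /integrableP[/measurable_EFinP] := ih l.
pose m := lebesgue_tuple R n.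
pose f (p : measurableTypeR R * n.-tuple R) : n.+1.-tuple R := [tuple of p.1 :: p.2].
have mf : measurable_fun setT f.
  exact: (@measurable_cons _ _ _ _ fst n snd).
have consE A : measurable A -> lebesgue_tuple R n.+1 A = (leb \x m)%E (f @^-1` A) by [].
have [iG GE] := IH (fun l => h (lift ord0 l)) (fun l => ih _).
pose G (t : n.-tuple R) := \prod_(l < n) h (lift ord0 l) (tnth t l).
have mG : measurable_fun setT G by have /integrableP[/measurable_EFinP] := iG.
pose F (x : n.+1.-tuple R) := \prod_(l < n.+1) h l (tnth x l).
have mF : measurable_fun setT F.
  apply: measurable_prod => l _.
  by apply: measurableT_comp => //; exact: measurable_tnth.
have FfE p : F (f p) = h ord0 p.1 * G p.2.
  rewrite /F big_ord_recl /G; congr (_ * _).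
  by apply: eq_bigr => l _; rewrite tnthS.
have mH : measurable_fun setT (fun p : R * n.-tuple R => (h ord0 p.1 * G p.2)%:E).
  apply/measurable_EFinP; apply: measurable_funM.
    by apply: measurableT_comp => //; exact: measurable_fst.
  by apply: measurableT_comp => //; exact: measurable_snd.
have mn : measurable_fun setT (fun x => `|h ord0 x|%:E).
  by apply/measurable_EFinP/measurableT_comp.
have iH : (leb \x m)%E.-integrable setT (fun p => (h ord0 p.1 * G p.2)%:E).
  apply/integrable12ltyP => //=.
  under eq_integral => a _.
    under eq_integral do rewrite normrM EFinM.
    rewrite ge0_integralZl//; last by apply/measurable_EFinP/measurableT_comp.
    over.
  rewrite ge0_integralZr//; last exact: integral_ge0.
  apply: lte_mul_pinfty.
  - exact: integral_ge0.
  - rewrite ge0_fin_numE; last exact: integral_ge0.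
    by have /integrableP[_] := ih ord0.
  - by have /integrableP[_] := iG.
have iFf : (leb \x m)%E.-integrable setT ((EFin \o F) \o f).
  by apply: eq_integrable iH => // p _ /=; rewrite FfE.
have iF : (lebesgue_tuple R n.+1).-integrable setT (EFin \o F).
  apply/integrableP; split; first exact/measurable_EFinP.
  rewrite (ge0_integral_image mf consE)//.
    by have /integrableP[_] := iFf.
  by apply: measurableT_comp => //; exact/measurable_EFinP.
split => //; apply: EFin_inj.
rewrite big_ord_recl -GE EFinM.
rewrite EFin_Rintegral//.
rewrite (integral_image mf consE)//; last exact/measurable_EFinP.
transitivity (\int[leb \x m]_p (h ord0 p.1 * G p.2)%:E)%E.
  by apply: eq_integral => p _; congr EFin; exact: FfE.
rewrite -(integral12_prod_meas1 iH) /fubini_F /=.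
rewrite (EFin_Rintegral (ih ord0)) -integralZr//; last exact: (ih ord0).
apply: eq_integral => a _; under eq_integral do rewrite EFinM.
by rewrite integralZl// EFin_Rintegral.
Qed.

End tuple_product.

(** * The probability integral transform *)

Section uniform_law.
Context (R : realType) (h : R -> R).
Local Notation leb := (@lebesgue_measure R).
Hypothesis mh : measurable_fun setT h.
Hypothesis h_gt0 : forall u, 0 < h u.
Hypothesis h1 : (\int[leb]_u (h u)%:E = 1)%E.

Definition distrib (u : R) : R := fine (\int[leb]_(v in `]-oo, u]) (h v)%:E)%E.

Let ih : leb.-integrable setT (EFin \o h).
Proof.
apply/integrableP; split; first exact/measurable_EFinP.
rewrite (_ : (\int[leb]_x _)%E = 1%E) ?ltry// -h1.
by apply: eq_integral => x _ /=; rewrite gtr0_norm.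
Qed.

Let Fdiff (u v : R) : u <= v -> distrib v - distrib u = \int[leb]_(x in `]u, v]) h x.
Proof.
move=> uv.
have := @Rintegral_itvB R h -oo%O (BRight v) u.
rewrite /distrib /Rintegral => -> //.
by apply: integrableS ih.
Qed.

(** Strictness comes from the positivity of h: a zero integral over []u, v]] would make h vanish
    almost everywhere on a set of positive Lebesgue measure. *)
Lemma distrib_mono : {homo distrib : u v / u < v}.
Proof.
move=> u v uv; rewrite -subr_gt0 Fdiff ?ltW// lt_neqAle Rintegral_ge0 ?andbT; last first.
  by move=> x _; exact: ltW.
apply/eqP => I0.
have [+ _] := @ae_eq_integral_abs _ _ _ leb `]u, v]%classic
  (measurable_itv _) (EFin \o h) (measurable_funTS ((measurable_EFinP _ _).2 mh)).
have -> : (\int[leb]_(x in `]u, v]) `|(EFin \o h) x|)%E = 0%E.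
  under eq_integral do rewrite /= gtr0_norm//.
  rewrite -[LHS]fineK; first by congr EFin; rewrite [RHS]I0.
  have iuv : leb.-integrable `]u, v]%classic (EFin \o h) by exact: integrableS ih.
  exact: (integrable_fin_num _ iuv).
move=> /(_ erefl) H.
have N0 : leb `]u, v]%classic = 0%E.
  apply: measure_negligible => //; apply: negligibleS H => x /= xuv Hx.
  by have := h_gt0 x; have [->] := Hx xuv; rewrite ltxx.
by move: N0; rewrite lebesgue_measure_itv /= lte_fin uv -EFinD => -[/eqP]; rewrite subr_eq0 gt_eqF.
Qed.

(** Absolute continuity of the integral of h. *)
Lemma distrib_continuous : continuous distrib.
Proof.
move=> u; apply/cvgrPdist_lt => e e0.
have [dl [dl0 Hd]] := integral_normr_continuous ih e0.
have close a b : a <= b -> b - a < dl -> `|distrib b - distrib a| < e.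
  move=> ab bad; rewrite Fdiff// ger0_norm; last first.
    by apply: Rintegral_ge0 => x _; exact: ltW.
  have lE : (leb `]a, b]%classic < dl%:E)%E.
    by rewrite lebesgue_measure_itv /= lte_fin; case: ifPn; rewrite ?lte_fin// -EFinD lte_fin.
  apply: le_lt_trans (Hd `]a, b]%classic (measurable_itv _) lE).
  rewrite le_eqVlt; apply/orP; left; apply/eqP; apply: eq_Rintegral => x _.
  by rewrite gtr0_norm.
near=> t.
have : `|u - t| < dl by near: t; exact: cvgr_dist_lt.
move=> utd; have [ut|tu] := leP u t.
  by rewrite distrC close// -(ger0_norm (_ : 0 <= t - u)) ?subr_ge0// distrC.
by rewrite close ?(ltW tu)// -(gtr0_norm (_ : 0 < u - t)) ?subr_gt0.
Unshelve. all: by end_near. Qed.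

Lemma measurable_distrib : measurable_fun setT distrib.
Proof. exact: continuous_measurable_fun distrib_continuous. Qed.

Section with_probability.
Variable Q : probability (measurableTypeR R) R.
Hypothesis QE : forall A, Q A = (\int[leb]_(x in A) (h x)%:E)%E.

Let distribE u : (distrib u)%:E = Q `]-oo, u]%classic.
Proof. by rewrite /distrib -QE fineK// fin_num_measure. Qed.

Let distrib_lt v : Q `]-oo, v[%classic = (distrib v)%:E.
Proof.
rewrite distribE !QE; apply: integral_itv_bndo_bndc.
by apply: measurable_funTS; exact/measurable_EFinP.
Qed.

Let distrib_le1 u : distrib u <= 1.
Proof. by rewrite -lee_fin distribE probability_le1. Qed.

Let distrib_ge0 u : 0 <= distrib u.
Proof. by rewrite -lee_fin distribE. Qed.

Lemma distrib_01 u : 0 < distrib u < 1.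
Proof.
apply/andP; split.
  by apply: le_lt_trans (distrib_ge0 (u - 1)) _; apply: distrib_mono; rewrite ltrBlDr ltrDl.
by apply: lt_le_trans (distrib_le1 (u + 1)); apply: distrib_mono; rewrite ltrDl.
Qed.

(** Intermediate values between the limits 0 and 1, which come from continuity of Q along decreasing
    and increasing half-lines. *)
Lemma distrib_surj v : 0 < v < 1 -> exists u, distrib u = v.
Proof.
move=> /andP[v0 v1].
have [b vb] : exists b, v < distrib b.
  have : Q `]-oo, n%:R]%classic @[n --> \oo] --> Q (\bigcup_n `]-oo, n%:R]%classic).
    apply: nondecreasing_cvg_mu => //; first exact: bigcup_measurable.
    by move=> m n mn; apply/subsetPset/subset_itvl; rewrite bnd_simp ler_nat.
  rewrite (_ : \bigcup_n _ = setT); last first.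
    apply/seteqP; split => // x _; exists (Num.truncn `|x|).+1 => //=.
    by rewrite in_itv /= (le_trans (ler_norm _))// ltW// truncnS_gt.
  rewrite probability_setT; under eq_fun do rewrite -distribE.
  move=> /fine_cvgP[_] /cvgr_gt /(_ _ v1) [N _ HN].
  by exists N%:R; exact: HN (leqnn N).
have [a va] : exists a, distrib a < v.
  have : Q `]-oo, - n%:R]%classic @[n --> \oo] --> Q (\bigcap_n `]-oo, - n%:R]%classic).
    apply: nonincreasing_cvg_mu => //.
    - by apply: le_lt_trans (probability_le1 _ _) _ => //; rewrite ltry.
    - exact: bigcapT_measurable.
    by move=> m n mn; apply/subsetPset/subset_itvl; rewrite bnd_simp lerN2 ler_nat.
  rewrite (_ : \bigcap_n _ = set0); last first.
    apply/seteqP; split => // x /(_ (Num.truncn `|x|).+1 I) /=.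
    rewrite in_itv /= lerNr leNgt => /negP; apply.
    by rewrite (le_lt_trans _ (truncnS_gt _))// -normrN ler_norm.
  rewrite measure0; under eq_fun do rewrite -distribE.
  move=> /fine_cvgP[_] /cvgr_lt /(_ _ v0) [N _ HN].
  by exists (- N%:R); exact: HN (leqnn N).
have ab : a <= b.
  rewrite leNgt; apply/negP => /distrib_mono ba.
  by have := lt_trans vb (lt_trans ba va); rewrite ltxx.
have [||c _ <-] := @IVT R distrib a b v ab.
- exact/continuous_subspaceT/distrib_continuous.
- by rewrite ge_min le_max (ltW va) (ltW vb) orbT.
by exists c.
Qed.

(** It suffices to compare on the half-lines below v. For 0 < v < 1 write v as the value of
    [distrib] at some a; strict monotonicity then turns [distrib x < v] into x < a. *)
Lemma distrib_uniform A : measurable A ->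
  uniform_prob (@ltr01 R) A = Q (distrib @^-1` A).
Proof.
move=> mA; have [Q' Q'E] := @law_exists _ _ R Q _ (measurableTypeR R) distrib measurable_distrib.
rewrite -Q'E//.
apply: (@measure_unique _ R (measurableTypeR R) (@RGenInftyO.G R)
  (fun n => `]-oo, n%:R[%classic) _ _ _ _ (uniform_prob (@ltr01 R)) Q') => //.
- exact: RGenInftyO.measurableE.
- move=> _ _ [x ->] [y ->]; exists (Num.min x y).
  by apply/seteqP; split => z /=; rewrite !in_itv /= lt_min => /andP.
- by move=> n; exists n%:R.
- apply/seteqP; split => // x _; exists (Num.truncn `|x|).+1 => //=.
  by rewrite in_itv /= (le_lt_trans (ler_norm _))// truncnS_gt.
- move=> _ [v ->].
  apply: etrans (esym (Q'E _ (measurable_itv _))).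
  have [v1|v1] := ltP 1 v.
    rewrite (_ : _ @^-1` _ = setT); last first.
      apply/seteqP; split => // u _ /=; rewrite in_itv /=.
      by apply: le_lt_trans v1; exact: distrib_le1.
    rewrite probability_setT; apply: integral_uniform_pdf1 => //.
    by apply: subset_itv; rewrite bnd_simp.
  have [v0|v0] := leP v 0.
    rewrite (_ : _ @^-1` _ = set0); last first.
      apply/seteqP; split => // u /=; rewrite in_itv /=.
      by rewrite ltNge (le_trans v0 (distrib_ge0 u)).
    rewrite [RHS]measure0; apply: etrans (integral_uniform_pdf 0 1 _) _.
    rewrite (_ : _ `&` _ = set0) ?integral_set0//.
    apply/seteqP; split => // x /= []; rewrite !in_itv /= => xv /andP[x0 _].
    by have := lt_le_trans xv (le_trans v0 x0); rewrite ltxx.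
  transitivity v%:E.
    apply: etrans (integral_uniform_pdf 0 1 _) _.
    rewrite (_ : _ `&` _ = `[0, v[%classic); last first.
      apply/seteqP; split => x /=; rewrite !in_itv /=.
        by move=> [-> /andP[->]].
      by move=> /andP[-> xv]; split => //; exact: ltW (lt_le_trans xv v1).
    rewrite (eq_integral (fun=> 1%:E)); last first.
      move=> x; rewrite inE /= in_itv /= => /andP[x0 xv].
      by rewrite /uniform_pdf x0 (ltW (lt_le_trans xv v1)) subr0 invr1.
    by rewrite integral_cst//= mul1e lebesgue_measure_itv /= lte_fin v0 oppr0 adde0.
  have [v1'|v1'] := ltP v 1; last first.
    have -> : v = 1 by apply/eqP; rewrite eq_le v1 v1'.
    rewrite (_ : _ @^-1` _ = setT) ?probability_setT//.
    by apply/seteqP; split => // u _ /=; rewrite in_itv /=; have /andP[] := distrib_01 u.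
  have [a av] := distrib_surj (introT andP (conj v0 v1')).
  rewrite (_ : _ @^-1` _ = `]-oo, a[%classic) ?distrib_lt ?av//.
  apply/seteqP; split => x /=; rewrite !in_itv /= -av; last exact: distrib_mono.
  by rewrite !ltNge; apply: contra; rewrite le_eqVlt => /predU1P[->//|/distrib_mono/ltW].
- by move=> k; apply: le_lt_trans (probability_le1 _ _) _ => //; rewrite ltry.
Qed.

End with_probability.

(** The constant 1 makes the integrand nonnegative, so that the integral can be transported by the
    lemmas on nonnegative functions; the mass of h is subtracted afterwards. *)
Let integral_cos01 (k : nat) : (0 < k)%N ->
  (\int[leb]_(u in `[0%R, 1%R]) (1 + cos (k%:R * pi * u))%:E = 1)%E.
Proof.
move=> k0; set a : R := k%:R * pi.
have a0 : a != 0 by rewrite mulf_neq0 ?pnatr_eq0 -?lt0n// gt_eqF ?pi_gt0.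
(* A primitive, whose sine term vanishes at both ends because a is a multiple of pi. *)
pose F (u : R) := u + a^-1 * sin (a * u).
have dF (u : R) : is_derive u (1 : R) F (1 + cos (a * u)).
  have d1 : is_derive u (1 : R) ( *%R a) a.
    by apply: is_derive_eq (is_deriveZ a (is_derive_id u 1)) _; exact: mulr1.
  have d2 := is_derive1_comp (is_derive_sin (a * u)) d1.
  apply: is_derive_eq (is_deriveD (is_derive_id u 1) (is_deriveZ a^-1 d2)) _.
  by congr (1 + _); rewrite -[LHS]/(a^-1 * (cos (a * u) * a)) mulrCA mulVf ?mulr1.
have cF : continuous F.
  move=> u; apply: differentiable_continuous; apply/derivable1_diffP.
  by have [] := dF u.
rewrite (@continuous_FTC2 _ _ F)//.
- rewrite /F mulr1 mulr0 sin0 mulr0 addr0 -EFinD subr0.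
  rewrite (_ : sin a = 0) ?mulr0 ?addr0//.
  rewrite /a; elim: (k) => [|j IH]; first by rewrite mul0r sin0.
  by rewrite -natr1 mulrDl mul1r sinD sinpi mulr0 addr0 IH mul0r.
- apply: continuous_subspaceT => u.
  apply: cvgD; first exact: cvg_cst.
  apply: (@cvg_comp _ _ _ (fun u => a * u) cos); last exact: continuous_cos.
  by apply: cvgM; [exact: cvg_cst|exact: cvg_id].
- split => [u _| |].
  + by have [] := dF u.
  + by apply: cvg_at_right_filter; exact: cF.
  + by apply: cvg_at_left_filter; exact: cF.
- by move=> u _; rewrite derive1E; have [_ ->] := dF u.
Qed.

Lemma integral_cos_distrib (k : nat) : (0 < k)%N ->
  \int[leb]_u (cos (k%:R * pi * distrib u) * h u) = 0.
Proof.
move=> k0; have h_ge0 u : 0 <= h u by exact: ltW.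
have [Q QE] := @density_probability _ (measurableTypeR R) R leb h mh h_ge0 h1.
pose c (u : R) := 1 + cos (k%:R * pi * u).
have c_ge0 u : 0 <= c u by have := cos_geN1 (k%:R * pi * u); rewrite /c; lra.
have mcos : measurable_fun setT (fun u : R => cos (k%:R * pi * u)).
  apply: measurableT_comp; first exact: continuous_measurable_fun (@continuous_cos R).
  exact: measurable_funM.
have mc : measurable_fun setT c by exact: measurable_funD.
have mcd : measurable_fun setT (c \o distrib) by exact: measurableT_comp mc measurable_distrib.
have E1 : (\int[leb]_u (c (distrib u) * h u)%:E = 1)%E.
  rewrite -(integral_cos01 k0).
  transitivity (\int[uniform_prob (@ltr01 R)]_u (c u)%:E)%E; last first.
    rewrite integral_uniform//=; last exact/measurable_EFinP.
    by rewrite subr0 invr1 mul1e.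
  rewrite (@ge0_integral_image _ _ _ _ _ Q (uniform_prob (@ltr01 R)) distrib (EFin \o c))//; last 3 first.
  - exact: measurable_distrib.
  - exact: distrib_uniform QE.
  - exact/measurable_EFinP.
  rewrite (@ge0_integral_density _ (measurableTypeR R) R leb Q h mh h_ge0
    (fun A _ => QE A) (EFin \o (c \o distrib)))//; first exact/measurable_EFinP.
  by move=> u /=; rewrite lee_fin; exact: c_ge0.
have icos : leb.-integrable setT (EFin \o (fun u => cos (k%:R * pi * distrib u) * h u)).
  apply: (le_integrable measurableT _ _ ih).
    apply/measurable_EFinP; apply: measurable_funM => //.
    exact: measurableT_comp mcos measurable_distrib.
  move=> u _; rewrite /= lee_fin normrM ler_piMl//.
  by rewrite ler_norml cos_geN1 cos_le1.
have := RintegralD measurableT ih icos.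
rewrite [LHS](_ : _ = 1); last first.
  rewrite /Rintegral -[RHS]/(fine 1%E) -E1; congr fine.
  by apply: eq_integral => u _; rewrite /c mulrDl mul1r.
rewrite [X in _ = X + _](_ : _ = 1); last by rewrite /Rintegral h1.
by move/eqP; rewrite -subr_eq0 opprD addNKr oppr_eq0 => /eqP.
Qed.

End uniform_law.

(** * Bernstein approximation of step functions *)

Section bernstein.
Context (R : realType).
Implicit Types (g : nat -> R) (u : R).

(* [bernstein n g u] is the expectation of [g] under the binomial law of
   parameters [n] and [u]. *)
Fixpoint bernstein n g u : R :=
  if n is n'.+1 then
    (1 - u) * bernstein n' g u + u * bernstein n' (fun j => g j.+1) u
  else g 0%N.

Lemma le_bernstein n g g' u : 0 <= u <= 1 -> (forall j, g j <= g' j) ->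
  bernstein n g u <= bernstein n g' u.
Proof.
move=> /andP[u0 u1]; elim: n g g' => [|n IH] g g' gg' /=; first exact: gg'.
by apply: lerD; rewrite ler_wpM2l ?subr_ge0//; apply: IH.
Qed.

Lemma bernstein_affine n g u (a c : R) :
  bernstein n (fun j => a + c * g j) u = a + c * bernstein n g u.
Proof. by elim: n g => [|n IH] g //=; rewrite !IH; ring. Qed.

Lemma bernstein_cst n (c u : R) : bernstein n (fun=> c) u = c.
Proof. by elim: n => //= n ->; ring. Qed.

(** Mean n u and variance n u (1 - u) of the binomial law. The free shift c makes the induction
    close: a success replaces c by 1 + c. *)
Lemma bernstein_sqr n (c u : R) :
  bernstein n (fun j => (j%:R + c) ^+ 2) u =
  (n%:R * u + c) ^+ 2 + n%:R * (u * (1 - u)).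
Proof.
elim: n c => [|n IH] c /=; first by ring.
rewrite IH (_ : (fun j => _) = fun j => (j%:R + (1 + c)) ^+ 2); last first.
  by apply/funext => j; rewrite -natr1; ring.
by rewrite IH -natr1; ring.
Qed.

Definition above (t : R) (j : nat) : R := (t < j%:R)%R%:R.

Lemma above_01 t j : 0 <= above t j <= 1.
Proof. by rewrite /above; case: (_ < _); rewrite ?lexx ler01. Qed.

Lemma bernstein_above_01 n t u : 0 <= u <= 1 -> 0 <= bernstein n (above t) u <= 1.
Proof.
move=> u01; apply/andP; split.
  rewrite -[leLHS](bernstein_cst n 0 u); apply: le_bernstein => // j.
rewrite -[leRHS](bernstein_cst n 1 u); apply: le_bernstein => // j.
by have /andP[] := above_01 t j.
Qed.

Lemma chebyshev_sqr (dl x : R) : 0 < dl -> dl <= `|x| -> 1 <= dl ^- 2 * x ^+ 2.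
Proof.
move=> dl0 h; rewrite mulrC ler_pdivlMr ?exprn_gt0// mul1r.
by rewrite -(real_normK (num_real x)) lerXn2r// nnegrE ltW.
Qed.

(** Chebyshev's inequality, with the variance bounded by n. The boolean tells on which side of the
    threshold the mean n u lies, at distance at least dl: below for true (limit 0), above for false
    (limit 1). *)
Lemma bernstein_above_error n t u (dl : R) : 0 < dl -> 0 <= u <= 1 ->
  (forall b : bool, (if b then n%:R * u + dl <= t else t + dl <= n%:R * u) ->
    `|(~~ b)%:R - bernstein n (above t) u| <= dl ^- 2 * n%:R).
Proof.
move=> dl0 u01 b H.
have d2 : 0 <= dl ^- 2 by rewrite invr_ge0 sqr_ge0.
have vle : dl ^- 2 * bernstein n (fun j => (j%:R + (- (n%:R * u))) ^+ 2) u <= dl ^- 2 * n%:R.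
  rewrite ler_wpM2l// bernstein_sqr subrr expr0n add0r.
  rewrite -[leRHS]mulr1 ler_wpM2l//.
  by move: u01 => /andP[u0 u1]; nra.
have /andP[b0 b1] := bernstein_above_01 n t u01.
apply: le_trans vle; case: b H => /= H.
  rewrite sub0r normrN ger0_norm// -[leRHS]add0r -bernstein_affine.
  apply: le_bernstein => // j; rewrite add0r /above; case: ltP => /= tj; last first.
    by rewrite mulr_ge0// sqr_ge0.
  apply: chebyshev_sqr => //; apply: le_trans (ler_norm _); lra.
rewrite ger0_norm ?subr_ge0// lerBlDr -lerBlDl -mulNr -bernstein_affine.
apply: le_bernstein => // j; rewrite mulNr /above; case: ltP => /= tj.
  by rewrite gerBl mulr_ge0// sqr_ge0.
rewrite subr_le0; apply: chebyshev_sqr => //.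
by rewrite -normrN; apply: le_trans (ler_norm _); lra.
Qed.

(* Shifting the threshold by n^2 while using n^3 trials makes the limit exact
   also at [u = a]. *)
Definition step_poly (a : R) (n : nat) (u : R) : R :=
  bernstein (n.+1 ^ 3) (above ((n.+1 ^ 3)%:R * a + (n.+1 ^ 2)%:R)) u.

Lemma step_poly_01 a n u : 0 <= u <= 1 -> 0 <= step_poly a n u <= 1.
Proof. exact: bernstein_above_01. Qed.

(** With M = n + 1 take dl = M^2 in [bernstein_above_error]: the error is M^3 / M^4 = 1 / M. If u <=
    a, the mean is M^2 below the threshold; if a < u, it is M^2 above as soon as M (u - a) >= 2. *)
Lemma cvg_step_poly a u : 0 <= u <= 1 ->
  step_poly a n u @[n --> \oo] --> ((a < u)%R%:R : R).
Proof.
move=> u01; apply/cvgrPdist_le => e e0.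
have e0' : e = (PosNum e0)%:num by [].
have [N HN] : exists N : nat, forall n, (N <= n)%N ->
    n.+1%:R ^-1 <= e /\ (a < u -> 2 <= n.+1%:R * (u - a)).
  exists (maxn (Num.truncn e^-1) (Num.truncn (2 / (u - a)))) => n.
  rewrite geq_max => /andP[n1 n2]; split.
    rewrite -(invrK e) lef_pV2 ?posrE ?invr_gt0//.
    by rewrite (le_trans (ltW (truncnS_gt _)))// ler_nat.
  rewrite -subr_gt0 => ua; rewrite -ler_pdivrMr//.
  by rewrite (le_trans (ltW (truncnS_gt _)))// ler_nat.
exists N => // n /= /HN[Ne Nu]; apply: le_trans Ne.
set M : R := n.+1%:R.
have M0 : 0 < M by rewrite ltr0n.
have -> : M^-1 = (M ^+ 2) ^- 2 * (n.+1 ^ 3)%:R.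
  by rewrite natrX -/M; field; rewrite gt_eqF.
have M2 : 0 < M ^+ 2 by rewrite exprn_gt0.
rewrite -[a < u]negbK; apply: bernstein_above_error => //.
rewrite !natrX -/M; case: (ltP a u) => /= au.
  have := Nu au; rewrite -/M => H; nra.
rewrite lerD2r ler_wpM2l// ltW// exprn_gt0//.
Qed.

End bernstein.

(** * Cosine polynomials *)

Section cosine_polynomials.
Context (R : realType).
Implicit Types f : R -> R.

Definition cos_poly f : Prop := exists s : seq (R * nat),
  forall t, f t = \sum_(p <- s) p.1 * cos (p.2%:R * t).

Lemma cos_poly_cst (c : R) : cos_poly (fun=> c).
Proof.
exists [:: (c, 0%N)] => t.
by rewrite big_seq1 /= mul0r cos0 mulr1.
Qed.

Lemma cos_polyD f g : cos_poly f -> cos_poly g -> cos_poly (fun t => f t + g t).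
Proof.
by move=> [s fE] [r gE]; exists (s ++ r) => t; rewrite big_cat fE gE.
Qed.

Lemma cos_polyZ (c : R) f : cos_poly f -> cos_poly (fun t => c * f t).
Proof.
move=> [s fE]; exists [seq (c * p.1, p.2) | p <- s] => t.
by rewrite big_map fE mulr_sumr; apply: eq_bigr => p _; rewrite mulrA.
Qed.

Lemma cos_poly_mulcos f : cos_poly f -> cos_poly (fun t => cos t * f t).
Proof.
move=> [s fE].
(* From 2 cos t cos (n t) = cos ((n + 1) t) + cos ((n - 1) t); at n = 0 the frequency -1 is replaced
   by 1, the cosine being even. *)
exists ([seq (p.1 / 2, p.2.+1) | p <- s] ++
        [seq (p.1 / 2, if p.2 is n.+1 then n else 1%N) | p <- s]) => t.
rewrite big_cat /= !big_map -big_split fE mulr_sumr /=; apply: eq_bigr => -[c n] _ /=.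
have -> : cos (n.+1%:R * t) = cos (n%:R * t) * cos t - sin (n%:R * t) * sin t.
  by rewrite -natr1 mulrDl mul1r cosD.
have -> : cos ((if n is k.+1 then k else 1%N)%:R * t) =
    cos (n%:R * t) * cos t + sin (n%:R * t) * sin t.
  case: n => [|n]; first by rewrite mul1r mul0r cos0 sin0; ring.
  by rewrite -cosB -natr1 mulrDl mul1r addrK.
by field.
Qed.

(** The recursion of [bernstein] multiplies by f and 1 - f alone, so closure under multiplication by
    this one function stands in for closure under products. *)
Lemma cos_poly_bernstein n g (f : R -> R) : cos_poly f ->
  (forall h, cos_poly h -> cos_poly (fun t => f t * h t)) ->
  cos_poly (fun t => bernstein n g (f t)).
Proof.
move=> cf fM; elim: n g => [|n IH] g /=; first exact: cos_poly_cst.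
have -> : (fun t => (1 - f t) * bernstein n g (f t) +
    f t * bernstein n (fun j => g j.+1) (f t)) =
  (fun t => (bernstein n g (f t) + (-1) * (f t * bernstein n g (f t))) +
    f t * bernstein n (fun j => g j.+1) (f t)).
  by apply/funext => t; ring.
apply: cos_polyD; last exact: fM.
by apply: cos_polyD => //; apply/cos_polyZ/fM.
Qed.

Lemma cos_poly_step_poly a n : cos_poly (fun t => step_poly a n ((1 + cos t) / 2)).
Proof.
have c1 : cos_poly (@cos R).
  by exists [:: (1, 1%N)] => t; rewrite big_seq1 /= !mul1r.
have -> : (fun t => step_poly a n ((1 + cos t) / 2)) =
    (fun t => step_poly a n (2^-1 + 2^-1 * cos t)).
  by apply/funext => t; congr step_poly; field.
apply: (@cos_poly_bernstein _ _ (fun t => 2^-1 + 2^-1 * cos t)).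
  by apply: cos_polyD; [exact: cos_poly_cst|exact: cos_polyZ].
move=> h ch.
have -> : (fun t => (2^-1 + 2^-1 * cos t) * h t) =
    (fun t => 2^-1 * h t + 2^-1 * (cos t * h t)) by apply/funext => t; ring.
by apply: cos_polyD; apply: cos_polyZ => //; exact: cos_poly_mulcos.
Qed.

End cosine_polynomials.

(** * The cosine basis *)

Section basis.
Context (R : realType) (d dW : nat) (m : model R d dW).
Hypothesis Hnu : density_assumption m.
Local Notation V := (d.-tuple R).
Local Notation leb := (@lebesgue_measure R).

Let mnu l : measurable_fun setT (mnu1 m l). Proof. by have [] := Hnu l. Qed.
Let nu_gt0 l u : 0 < mnu1 m l u. Proof. by have [] := Hnu l. Qed.
Let nu_1 l : (\int[leb]_u (mnu1 m l u)%:E = 1)%E. Proof. by have [] := Hnu l. Qed.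

Let inu l : leb.-integrable setT (EFin \o mnu1 m l).
Proof.
have ml := mnu l; apply/integrableP; split; first exact/measurable_EFinP.
rewrite (_ : (\int[leb]_x _)%E = 1%E) ?ltry// -(nu_1 l).
by apply: eq_integral => x _ /=; rewrite gtr0_norm.
Qed.

Let ck l (k : nat) (u : R) := cos (k%:R * pi * Defs.cdf m l u).

Let mck l k : measurable_fun setT (ck l k).
Proof.
apply: (measurableT_comp (continuous_measurable_fun (@continuous_cos R))).
apply: measurable_funM => //.
exact: measurable_distrib (mnu l) (nu_gt0 l) (nu_1 l).
Qed.

Lemma measurable_phi1 l k : measurable_fun setT (phi1 m l k).
Proof.
case: k => [|k]; first exact: measurable_cst.
by apply: measurable_funM => //; exact: mck.
Qed.

Lemma phi1_bound l k u : `|phi1 m l k u| <= Num.sqrt 2.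
Proof.
have s1 : (1 : R) <= Num.sqrt 2 by rewrite -[leLHS]sqrtr1 ler_wsqrtr// ler1n.
rewrite /phi1; case: ifP => _; first by rewrite normr1.
rewrite normrM ger0_norm ?sqrtr_ge0// ler_piMr ?sqrtr_ge0//.
by rewrite ler_norml cos_geN1 cos_le1.
Qed.

Let ick l k : leb.-integrable setT (EFin \o (fun u => ck l k u * mnu1 m l u)).
Proof.
have mf : measurable_fun setT (fun u => ck l k u * mnu1 m l u).
  by apply: measurable_funM => //; exact: mck.
apply: (le_integrable measurableT _ _ (inu l)); first exact/measurable_EFinP.
move=> u _; rewrite /= lee_fin normrM ler_piMl//.
by rewrite ler_norml cos_geN1 cos_le1.
Qed.

Let Ick l k : \int[leb]_u (ck l k u * mnu1 m l u) = (k == 0%N)%:R.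
Proof.
case: k => [|k].
  rewrite (eq_Rintegral leb (g := mnu1 m l)); first by rewrite /Rintegral nu_1.
  by move=> u _; rewrite /ck mul0r mul0r cos0 mul1r.
exact: (integral_cos_distrib (mnu l) (nu_gt0 l) (nu_1 l)).
Qed.

Let iphi1 l j k : leb.-integrable setT
  (EFin \o (fun u => phi1 m l j u * phi1 m l k u * mnu1 m l u)).
Proof.
have mf : measurable_fun setT (fun u => phi1 m l j u * phi1 m l k u * mnu1 m l u).
  by apply: measurable_funM => //; apply: measurable_funM; exact: measurable_phi1.
have := integrableZl measurableT 2 (inu l).
apply: le_integrable => //; first exact/measurable_EFinP.
move=> u _; rewrite /= lee_fin !normrM ler_wpM2r//.
rewrite (@ger0_norm _ 2)// -[leRHS](@sqr_sqrtr R 2)//.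
by rewrite expr2 ler_pM// phi1_bound.
Qed.

(** Product-to-sum formulas leave cosines of frequencies k - j and k + j, whose integrals vanish
    except at frequency 0. For j = k = 0 both terms count, each with weight 1/2; for j = k > 0 only
    the first, with weight 1. *)
Lemma phi1_orthonormal l j k :
  \int[leb]_u (phi1 m l j u * phi1 m l k u * mnu1 m l u) = (j == k)%:R.
Proof.
wlog jk : j k / (j <= k)%N.
  move=> H; have [/H//|/ltnW/H] := leqP j k.
  rewrite eq_sym => <-; apply: eq_Rintegral => u _.
  by rewrite [X in X * _]mulrC.
pose a (k : nat) : R := if k == 0%N then 1 else Num.sqrt 2.
have phiE k' u : phi1 m l k' u = a k' * ck l k' u.
  by rewrite /phi1 /a /ck; case: ifP => // /eqP ->; rewrite mul0r mul0r cos0 mulr1.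
pose w := a j * a k / 2.
have wE u : phi1 m l j u * phi1 m l k u * mnu1 m l u =
    w * (ck l (k - j) u * mnu1 m l u) + w * (ck l (k + j) u * mnu1 m l u).
  rewrite !phiE /w /ck natrB// natrD !mulrBl !mulrDl cosB cosD.
  by field.
rewrite (eq_Rintegral leb (g := _) (fun u _ => wE u)).
have iw i : leb.-integrable setT (EFin \o (fun u => w * (ck l i u * mnu1 m l u))).
  by have := integrableZl measurableT w (ick l i); apply: eq_integrable.
rewrite RintegralD//; [|exact: iw..].
rewrite !RintegralZl//; [|exact: ick..].
rewrite !Ick subn_eq0 addn_eq0.
rewrite /w /a [in RHS]eqn_leq jk /=; case: (leqP k j) => kj.
  have -> : j = k by apply/eqP; rewrite eqn_leq jk.
  rewrite !andbb; case: (k == 0%N) => /=; first by lra.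
  by rewrite -expr2 sqr_sqrtr// mulr0 mulr1 addr0 divff.
by rewrite (gtn_eqF (leq_ltn_trans _ kj)) ?mulr0 ?addr0.
Qed.

Lemma measurable_nu : measurable_fun setT (nu m).
Proof.
apply: measurable_prod => l _.
by apply: measurableT_comp => //; exact: measurable_tnth.
Qed.

Lemma nu_ge0 x : 0 <= nu m x.
Proof. by apply: prodr_ge0 => l _; exact: ltW. Qed.

Lemma integral_nu : (\int[lebesgue_tuple R d]_x (nu m x)%:E = 1)%E.
Proof.
have [i E] := lebesgue_tuple_prod inu.
rewrite -EFin_Rintegral// E big1// => l _.
by rewrite /Rintegral nu_1.
Qed.

Lemma measurable_phi k : measurable_fun setT (phi m k).
Proof.
apply: measurable_prod => l _.
by apply: measurableT_comp; [exact: measurable_phi1|exact: measurable_tnth].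
Qed.

Lemma phi_bound k x : `|phi m k x| <= Num.sqrt 2 ^+ d.
Proof.
rewrite /phi normr_prod -[X in _ <= _ ^+ X]card_ord -prodr_const.
by apply: ler_prod => l _; rewrite normr_ge0 phi1_bound.
Qed.

Section law.
Variable Q : probability V R.
Hypothesis QE : forall A, measurable A ->
  Q A = (\int[lebesgue_tuple R d]_(x in A) (nu m x)%:E)%E.

Lemma phi_sqintegrable k : sqintegrable Q (phi m k).
Proof. exact: sqintegrable_bounded (measurable_phi k) (phi_bound k). Qed.

Lemma phi_orthonormal j k : \int[Q]_x (phi m j x * phi m k x) = (j == k)%:R.
Proof.
rewrite /Rintegral (integral_density measurable_nu nu_ge0 QE); last first.
  by apply: measurable_funM; exact: measurable_phi.
have [_ E] := lebesgue_tuple_prod (fun l => iphi1 l (tnth j l) (tnth k l)).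
have -> : (j == k)%:R = \prod_(l < d) ((tnth j l == tnth k l)%:R : R).
  have [->|jk] := eqVneq j k; first by rewrite big1// => l _; rewrite eqxx.
  have [l jkl] : exists l, tnth j l != tnth k l.
    apply/existsP; apply: contra_neqT jk => /existsPn H; apply/eq_from_tnth => l.
    by apply/eqP; rewrite -[_ == _]negbK H.
  by rewrite (bigD1 l)//= (negbTE jkl) mul0r.
rewrite -(eq_bigr _ (fun l _ => phi1_orthonormal l (tnth j l) (tnth k l))) -E.
congr fine; apply: eq_integral => x _; congr EFin.
by rewrite /phi /nu -!big_split.
Qed.

Lemma sqnorm_nuE v : measurable_fun setT v ->
  sqnorm_nu m v = (\int[Q]_x (v x ^+ 2)%:E)%E.
Proof.
move=> mv; rewrite (integral_density measurable_nu nu_ge0 QE)//.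
exact: measurable_funX.
Qed.

Lemma in_L2nuE v : in_L2nu m v <-> sqintegrable Q v.
Proof. by split => -[mv]; rewrite ?sqnorm_nuE// => ?; split => //; rewrite sqnorm_nuE. Qed.

(** Distributing the product over the d sums gives one basis function per choice of a term in each
    coordinate. The lists are padded to a common length N, with coefficient 0 from the default of
    [nth], so that the choices form a single function type. *)
Lemma spanned_tensor (f : 'I_d -> R -> R) : (forall l, cos_poly (f l)) ->
  spanned (phi m) (fun x => \prod_(l < d) f l (pi * Defs.cdf m l (tnth x l))).
Proof.
move=> /(_ _)/cid Hf; pose s l := projT1 (Hf l).
pose N := \max_(l < d) size (s l).
have sN l : (size (s l) <= N)%N by exact: leq_bigmax.
pose c l (j : nat) : R := (nth (0, 0%N) (s l) j).1.
pose e l (j : nat) : nat := (nth (0, 0%N) (s l) j).2.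
(* The division undoes the normalization of [phi1] at nonzero frequencies. *)
pose c' l j : R := if e l j == 0%N then c l j else c l j / Num.sqrt 2.
have fE l u : f l (pi * Defs.cdf m l u) = \sum_(j < N) c' l j * phi1 m l (e l j) u.
  rewrite (projT2 (Hf l)) -/(s l) (big_nth (0, 0%N)) big_mkord.
  rewrite (big_ord_widen N (fun j => c l j * cos ((e l j)%:R * (pi * Defs.cdf m l u))))//.
  rewrite big_mkcond; apply: eq_bigr => j _.
  rewrite /c' /phi1 mulrA; case: ltnP => js.
    case: eqP => [->|_]; first by rewrite mul0r mul0r cos0.
    by rewrite [RHS]mulrA divfK// sqrtr_eq0 -ltNge.
  by rewrite /c nth_default// mul0r if_same mul0r.
exists [seq (\prod_(l < d) c' l (g l), [tuple e l (g l) | l < d]) | g : {ffun 'I_d -> 'I_N}].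
move=> x; under eq_bigr do rewrite fE.
rewrite bigA_distr_bigA big_map big_enum /=; apply: eq_bigr => g _.
rewrite big_split; congr (_ * _); apply: eq_bigr => l _.
by rewrite tnth_mktuple.
Qed.

(** [None] leaves a coordinate free; thus the whole space is a box and boxes are closed under
    intersection. *)
Definition boxes : set (set V) :=
  [set E | exists A : 'I_d -> option R,
     E = [set x | forall l, if A l is Some a then tnth x l < a else true]].

Lemma measurable_boxes : @measurable _ V = <<s boxes >>.
Proof.
apply/seteqP; split => [E mE|].
  pose U := g_sigma_algebraType boxes.
  (* Measurability of this identity is the inclusion sought, and it can be checked coordinate by
     coordinate on half-lines. *)
  have mid : measurable_fun setT (idfun : U -> V).
    apply/measurable_fun_tnthP => l.
    apply: (@measurability _ _ U (measurableTypeR R) setT _ (@RGenInftyO.G R)).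
      exact: RGenInftyO.measurableE.
    move=> _ [_ [a ->] <-]; rewrite setTI.
    apply: sub_sigma_algebra; exists (fun i => if i == l then Some a else None).
    apply/seteqP; split => x /=; rewrite in_itv /=.
      by move=> xa i; case: eqP => [->|].
    by move=> /(_ l); rewrite eqxx.
  by have := mid measurableT E mE; rewrite setTI.
apply: smallest_sub; first exact: sigma_algebra_measurable.
move=> _ [A ->]; rewrite (_ : mkset _ = \bigcap_(l in [set: 'I_d])
    [set x | if A l is Some a then tnth x l < a else true]); last first.
  by apply/seteqP; split => x /= H l; [move=> _; have := H l|have := H l I]; rewrite /=; case: (A l).
apply: fin_bigcap_measurable => // l _; case: (A l) => [a|].
  rewrite (_ : mkset _ = (fun x : V => tnth x l) @^-1` `]-oo, a[%classic).
    by rewrite -[X in measurable X]setTI; exact: measurable_tnth.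
  by apply/seteqP; split => x /=; rewrite in_itv.
by rewrite (_ : mkset _ = setT)//; exact/seteqP.
Qed.

Lemma setI_closed_boxes : setI_closed boxes.
Proof.
move=> _ _ [A ->] [B ->].
exists (fun l => if A l is Some a then (if B l is Some b then Some (Num.min a b) else Some a) else B l).
apply/seteqP; split => x /=.
  move=> [HA HB] l; have := HA l; have := HB l.
  by case: (A l) => [a|]; case: (B l) => [b|]// xb xa; rewrite lt_min xa xb.
by move=> H; split => l; have := H l; case: (A l) => [a|]; case: (B l) => [b|]//; rewrite lt_min => /andP[].
Qed.

Lemma cvg_prod_seq (I : Type) (r : seq I) (f : nat -> I -> R) (c : I -> R) :
  (forall i, f n i @[n --> \oo] --> c i) ->
  \prod_(i <- r) f n i @[n --> \oo] --> \prod_(i <- r) c i.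
Proof.
move=> H; elim: r => [|i r IH].
  by under eq_fun do rewrite big_nil; rewrite big_nil; exact: cvg_cst.
by under eq_fun do rewrite big_cons; rewrite big_cons; exact: cvgM.
Qed.

(** [th] is a strictly decreasing function of u with values in [0,1], so u < a means th a < th u,
    and [step_poly] with threshold th a tends pointwise to the indicator of the half-line. Being
    affine in the cosine, [th] makes each approximant a cosine polynomial; the products are bounded
    by 1. *)
Lemma approximable_boxes E : boxes E -> approximable Q (phi m) (\1_E).
Proof.
move=> [A ->].
pose th l u := (1 + cos (pi * Defs.cdf m l u)) / 2.
have th01 l u : 0 <= th l u <= 1.
  have := cos_geN1 (pi * Defs.cdf m l u); have := cos_le1 (pi * Defs.cdf m l u).
  by rewrite /th => ? ?; apply/andP; split; lra.
pose f n l t : R := if A l is Some a then step_poly (th l a) n ((1 + cos t) / 2) else 1.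
have fp n l : cos_poly (f n l).
  rewrite /f; case: (A l) => [a|]; last exact: cos_poly_cst.
  exact: cos_poly_step_poly.
have f01 n l u : 0 <= f n l (pi * Defs.cdf m l u) <= 1.
  by rewrite /f; case: (A l) => [a|]; rewrite ?ler01 ?lexx//; exact: step_poly_01 (th01 l u).
have cdf_pi l u : pi * Defs.cdf m l u \in `[0, pi].
  have /andP[c0 c1] : 0 < Defs.cdf m l u < 1.
    have [Q1 Q1E] := @density_probability _ (measurableTypeR R) R leb _ (mnu l) (fun u => ltW (nu_gt0 l u)) (nu_1 l).
    exact: (distrib_01 (mnu l) (nu_gt0 l) (nu_1 l) Q1E).
  rewrite in_itv /=; apply/andP; split.
    by rewrite mulr_ge0 ?pi_ge0// ltW.
  by rewrite ler_piMr ?pi_ge0// ltW.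
have thlt l a u : (th l a < th l u) = (u < a).
  rewrite /th ltr_pM2r ?invr_gt0// ltrD2l.
  rewrite ltr_cos// ltr_pM2l ?pi_gt0//.
  have mono := distrib_mono (mnu l) (nu_gt0 l) (nu_1 l).
  apply/idP/idP; last exact: mono.
  by rewrite !ltNge; apply: contra; rewrite le_eqVlt => /predU1P[->//|/mono/ltW].
apply: (@approximable_dominated _ _ _ _ _ _ phi_sqintegrable
  (fun n x => \prod_(l < d) f n l (pi * Defs.cdf m l (tnth x l))) _ (cst 1)).
- by move=> n; apply: spanned_approximable phi_sqintegrable _ _; exact: spanned_tensor.
- by apply: (@sqintegrable_bounded _ _ _ _ _ 1) => // x; rewrite normr1.
- move=> n x; rewrite normr_prod (_ : cst 1 x = \prod_(l < d) (1 : R)); last by rewrite big1.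
  apply: ler_prod => l _; rewrite normr_ge0 ger0_norm//.
    by have /andP[] := f01 n l (tnth x l).
  by have /andP[] := f01 n l (tnth x l).
- move=> x.
  have -> : \1_[set x : V | forall l, if A l is Some a then tnth x l < a else true] x =
      \prod_(l < d) (if A l is Some a then (tnth x l < a)%R%:R else 1 : R).
    rewrite indicE; have [/set_mem /= H|] := boolP (x \in _).
      rewrite big1// => l _; have := H l; case: (A l) => [a ->|]//.
    rewrite notin_setE /= => /existsNP[l]; case El : (A l) => [a|]// /negP xa.
    by rewrite (bigD1 l)//= El (negbTE xa) mul0r.
  apply: cvg_prod_seq => l; rewrite /f; case: (A l) => [a|]; last exact: cvg_cst.
  by rewrite -(thlt l a); exact: cvg_step_poly (th01 _ _).
Qed.

Lemma phi_dense v : sqintegrable Q v -> approximable Q (phi m) v.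
Proof.
apply: (sqintegrable_approximable phi_sqintegrable measurable_boxes setI_closed_boxes).
  have := approximable_boxes; move=> /(_ setT); rewrite indicT; apply.
  by exists (fun=> None); apply/seteqP; split.
exact: approximable_boxes.
Qed.

End law.

End basis.

(** * Moments of Gaussian increments *)

Section moments.
Context d (Omega : measurableType d) (R : realType) (P : probability Omega R).
Implicit Types f g : Omega -> R.

(** Even powers make every integrand nonnegative; having all orders at once gives closure under
    products. *)
Definition finite_moments f : Prop :=
  measurable_fun setT f /\
  forall n, (\int[P]_w (f w ^+ n.*2)%:E < +oo)%E.

Lemma exprn_double_ge0 (x : R) n : 0 <= x ^+ n.*2.
Proof. by rewrite -mul2n exprM exprn_ge0// sqr_ge0. Qed.

Lemma normr_exprn_double (x : R) n : `|x| ^+ n.*2 = x ^+ n.*2.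
Proof. by rewrite -normrX ger0_norm// exprn_double_ge0. Qed.

Let measurable_pow f n : measurable_fun setT f ->
  measurable_fun setT (fun w => (f w ^+ n.*2)%:E).
Proof. by move=> mf; apply/measurable_EFinP; exact: measurable_funX. Qed.

(** The maps k and l allow a moment of f to be paid for by higher moments of g and h: the same order
    for sums, twice the order for products. *)
Lemma finite_momentsW f (g h : Omega -> R) (c : nat -> R) (k l : nat -> nat) :
  measurable_fun setT f -> finite_moments g -> finite_moments h ->
  (forall n, 0 <= c n) ->
  (forall n w, f w ^+ n.*2 <= c n * (g w ^+ (k n).*2 + h w ^+ (l n).*2)) ->
  finite_moments f.
Proof.
move=> mf [mg Mg] [mh Mh] c0 H; split => // n.
apply: (@le_lt_trans _ _ (\int[P]_w ((c n)%:E * ((g w ^+ (k n).*2)%:E + (h w ^+ (l n).*2)%:E)))%E).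
  apply: ge0_le_integral => //.
  - by move=> w _; rewrite lee_fin exprn_double_ge0.
  - exact: measurable_pow.
  - apply: emeasurable_funM => //; apply: emeasurable_funD; exact: measurable_pow.
  - by move=> w _; rewrite -EFinD -EFinM lee_fin.
rewrite ge0_integralZl//; last 3 first.
- by apply: emeasurable_funD; exact: measurable_pow.
- by move=> w _; rewrite adde_ge0 ?lee_fin ?exprn_double_ge0.
- by rewrite lee_fin.
rewrite ge0_integralD//; last 4 first.
- by move=> w _; rewrite lee_fin exprn_double_ge0.
- exact: measurable_pow.
- by move=> w _; rewrite lee_fin exprn_double_ge0.
- exact: measurable_pow.
by rewrite lte_mul_pinfty ?lee_fin// lte_add_pinfty.
Qed.

Lemma finite_moments_cst (c : R) : finite_moments (fun=> c).
Proof.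
split => // n; rewrite integral_cst//= probability_setT mule1 ltry//.
Qed.

Lemma finite_momentsD f g : finite_moments f -> finite_moments g ->
  finite_moments (fun w => f w + g w).
Proof.
move=> Mf Mg; apply: (@finite_momentsW _ _ _ (fun n => 2 ^+ n.*2) id id _ Mf Mg).
- by apply: measurable_funD; [case: Mf|case: Mg].
- by move=> n; rewrite exprn_ge0.
- move=> n w; rewrite -normr_exprn_double -(normr_exprn_double (f w)) -(normr_exprn_double (g w)).
  set a := `|f w|; set b := `|g w|.
  have a0 : 0 <= a by exact: normr_ge0.
  have b0 : 0 <= b by exact: normr_ge0.
  apply: (@le_trans _ _ ((2 * Num.max a b) ^+ n.*2)).
    rewrite lerXn2r ?nnegrE ?mulr_ge0 ?le_max ?a0//.
    apply: le_trans (ler_normD _ _) _; rewrite -/a -/b mulrDl mul1r lerD//.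
      by rewrite le_max lexx.
    by rewrite le_max lexx orbT.
  rewrite exprMn ler_wpM2l ?exprn_ge0//.
  by case: (leP a b) => _; [rewrite lerDr|rewrite lerDl]; exact: exprn_ge0.
Qed.

Lemma finite_momentsM f g : finite_moments f -> finite_moments g ->
  finite_moments (fun w => f w * g w).
Proof.
move=> Mf Mg; apply: (@finite_momentsW _ _ _ (fun=> 1) double double _ Mf Mg).
- by apply: measurable_funM; [case: Mf|case: Mg].
- by [].
- move=> n w; rewrite mul1r exprMn -(muln2 n.*2) !exprM.
  have := sqr_ge0 (f w ^+ n.*2 - g w ^+ n.*2).
  have := exprn_double_ge0 (f w) n; have := exprn_double_ge0 (g w) n.
  by nra.
Qed.

Lemma finite_momentsX f n : finite_moments f -> finite_moments (fun w => f w ^+ n).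
Proof.
move=> Mf; elim: n => [|n IH].
  by under eq_fun do rewrite expr0; exact: finite_moments_cst.
by under eq_fun do rewrite exprS; exact: finite_momentsM.
Qed.

Lemma finite_moments_norm f : finite_moments f -> finite_moments (fun w => `|f w|).
Proof.
move=> [mf Mf]; split; first exact: measurableT_comp.
by move=> n; under eq_integral do rewrite normr_exprn_double.
Qed.

Lemma finite_moments_sum I (s : seq I) (f : I -> Omega -> R) :
  (forall i, finite_moments (f i)) -> finite_moments (fun w => \sum_(i <- s) f i w).
Proof.
move=> Mf; elim: s => [|i s IH].
  by under eq_fun do rewrite big_nil; exact: finite_moments_cst.
by under eq_fun do rewrite big_cons; exact: finite_momentsD.
Qed.

Lemma finite_moments_integrable f : finite_moments f ->
  P.-integrable setT (EFin \o f).
Proof.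
move=> [mf Mf]; apply: sqintegrable_integrable; split => //.
exact: (Mf 1%N).
Qed.

End moments.

Section gaussian_moments.
Context (R : realType).

(** The inequality t / n <= exp (t / n), raised to the power n. *)
Lemma le_exprn_expR (t : R) n : 0 <= t -> t ^+ n <= n%:R ^+ n * expR t.
Proof.
move=> t0; case: n => [|n]; first by rewrite !expr0 mul1r -expR0 ler_expR.
have n0 : (0 : R) < n.+1%:R by rewrite ltr0n.
rewrite -[t in leLHS](@divfK _ n.+1%:R) ?gt_eqF// exprMn mulrC ler_wpM2l ?exprn_ge0 ?ler0n//.
rewrite -[t in leRHS](@divfK _ n.+1%:R) ?gt_eqF// [in leRHS]mulrC expRM_natl.
rewrite lerXn2r ?nnegrE ?divr_ge0 ?expR_ge0 ?ler0n//.
by apply: le_trans (expR_ge1Dx _); rewrite lerDr.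
Qed.

(** Half of the Gaussian exponent absorbs the power. With t = x^2 / (4 s^2) the density has exponent
    -2t, and t^n exp(-2t) <= n^n exp(-t), which is up to its peak the normal density of deviation s
    sqrt 2; [K] collects the constants and the ratio of the peaks. *)
Lemma normal_prob_moment (s : R) n : s != 0 ->
  (\int[normal_prob 0 s]_x (x ^+ n.*2)%:E < +oo)%E.
Proof.
move=> s0.
have mx : measurable_fun setT (fun x : R => x ^+ n.*2) by exact: measurable_funX.
rewrite (@ge0_integral_density _ (measurableTypeR R) R lebesgue_measure _
  (normal_pdf 0 s)) //; last 4 first.
- exact: measurable_normal_pdf.
- exact: normal_pdf_ge0.
- exact/measurable_EFinP.
- by move=> x; rewrite lee_fin exprn_double_ge0.
pose s2 := s * Num.sqrt 2.
have s20 : s2 != 0 by rewrite mulf_neq0// sqrtr_eq0 -ltNge.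
pose K := (4 * s ^+ 2) ^+ n * n%:R ^+ n * normal_peak s / normal_peak s2.
have K0 : 0 <= K.
  rewrite /K !mulr_ge0 ?invr_ge0 ?normal_peak_ge0 ?exprn_ge0 ?ler0n//.
  by rewrite mulr_ge0 ?sqr_ge0.
have ss0 : 0 < s ^+ 2 by rewrite exprn_even_gt0.
have bnd x : x ^+ n.*2 * normal_pdf 0 s x <= K * normal_pdf 0 s2 x.
  rewrite !normal_pdfE//= /normal_fun.
  pose t := x ^+ 2 / (4 * s ^+ 2).
  have t0 : 0 <= t.
    by apply: divr_ge0; [exact: sqr_ge0|rewrite mulr_ge0// sqr_ge0].
  have xE : x ^+ n.*2 = (4 * s ^+ 2) ^+ n * t ^+ n.
    rewrite -exprMn /t mulrCA divff ?mulr1 -?mul2n ?exprM//.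
    by rewrite mulf_neq0// gt_eqF.
  have e1 : - (x - 0) ^+ 2 / (s ^+ 2 *+ 2) = - t - t.
    by rewrite /t subr0 -mulr_natr; field.
  have e2 : - (x - 0) ^+ 2 / (s2 ^+ 2 *+ 2) = - t.
    by rewrite /t /s2 subr0 exprMn sqr_sqrtr// -mulr_natr; field.
  rewrite e1 e2 xE /K expRD.
  rewrite (_ : _ / _ * (normal_peak s2 * _) = (4 * s ^+ 2) ^+ n * (n%:R ^+ n * expR t) * (normal_peak s * (expR (- t) * expR (- t)))); last first.
    have ett : expR t * expR (- t) = 1 by rewrite -expRD subrr expR0.
    rewrite (_ : forall a b c d e f : R, a * (b * c) * (d * (e * f)) = a * b * d * f * (c * e)); last by move=> *; ring.
    rewrite ett; field; rewrite gt_eqF// normal_peak_gt0//.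
  rewrite ler_wpM2r ?mulr_ge0 ?normal_peak_ge0 ?expR_ge0//.
  have s4 : 0 <= 4 * s ^+ 2 by rewrite mulr_ge0// sqr_ge0.
  rewrite ler_wpM2l ?exprn_ge0//.
  exact: le_exprn_expR.
apply: (@le_lt_trans _ _ (\int[lebesgue_measure]_x (K%:E * (normal_pdf 0 s2 x)%:E))%E).
  apply: ge0_le_integral => //.
  - by move=> x _; rewrite mule_ge0 ?lee_fin ?exprn_double_ge0 ?normal_pdf_ge0.
  - apply: emeasurable_funM; apply/measurable_EFinP => //.
    exact: measurable_normal_pdf.
  - apply: emeasurable_funM => //; apply/measurable_EFinP.
    exact: measurable_normal_pdf.
  - by move=> x _; rewrite -!EFinM lee_fin.
rewrite ge0_integralZl//; last 2 first.
- by apply/measurable_EFinP; exact: measurable_normal_pdf.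
- by move=> x _; rewrite lee_fin normal_pdf_ge0.
by rewrite integral_normal_pdf mule1 ltry.
Qed.

End gaussian_moments.

Section brownian_increments.
Context (R : realType) (n : nat) dO (Omega : measurableType dO).
Context (P : probability Omega R) (W : R -> Omega -> n.-tuple R).
Hypothesis BM : standard_brownian P W.

Lemma measurable_incr s t : 0 <= s -> 0 <= t ->
  measurable_fun setT (incr W s t).
Proof.
move=> s0 t0; apply/measurable_fun_tnthP => r.
have -> : (tnth (T:=R))^~ r \o incr W s t = (fun w => tnth (W t w) r - tnth (W s w) r).
  by apply/funext => w /=; rewrite tnth_mktuple.
by apply: measurable_funB; apply: measurableT_comp (measurable_tnth r) _; exact: bm_measurable BM _ _.
Qed.

Lemma incr_finite_moments s t r : 0 <= s < t ->
  finite_moments P (fun w => tnth (incr W s t w) r).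
Proof.
move=> st; have /andP[s0 lt_st] := st.
have mZ : measurable_fun setT (fun w => tnth (incr W s t w) r).
  apply: measurableT_comp (measurable_tnth r) _.
  by apply: measurable_incr => //; exact: le_trans s0 (ltW lt_st).
split => // k.
have sd0 : Num.sqrt (t - s) != 0 by rewrite sqrtr_eq0 -ltNge subr_gt0.
apply: le_lt_trans (normal_prob_moment k sd0).
rewrite le_eqVlt; apply/orP; left; apply/eqP/esym.
apply: (@ge0_integral_image _ _ _ (measurableTypeR R) R P
  (normal_prob 0 (Num.sqrt (t - s))) (fun w => tnth (incr W s t w) r)
  (fun x => (x ^+ k.*2)%:E)) => //.
(* [bm_gaussian] speaks of boxes; full sets at the other coordinates isolate the law of coordinate
   r. *)
- move=> A mA; pose B i := if i == r then A else setT.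
  have mB i : measurable (B i) by rewrite /B; case: ifP.
  have -> : A = B r by rewrite /B eqxx.
  have := bm_gaussian BM st mB.
  rewrite (bigD1 r)//= big1 ?mule1 => [|i ir]; last first.
    by rewrite /B (negbTE ir) probability_setT.
  move=> <-; congr (P _); apply/seteqP; split => w /=.
    by move=> /(_ r).
  by move=> Br i; have [->//|ir] := eqVneq i r; rewrite /B (negbTE ir).
- by apply/measurable_EFinP; exact: measurable_funX.
- by move=> x; rewrite lee_fin exprn_double_ge0.
Qed.

End brownian_increments.

(** * The Euler scheme *)

Lemma expectationE d (Omega : measurableType d) (R : realType)
    (P : probability Omega R) (X : Omega -> R) :
  ('E_P[X] = \int[P]_w (X w)%:E)%E.
Proof. by rewrite unlock. Qed.

Lemma measurable_fun_integral d1 (E : measurableType d1) d2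
    (Omega : measurableType d2) (R : realType) (P : probability Omega R)
    (H : E * Omega -> \bar R) : measurable_fun setT H ->
  measurable_fun setT (fun x => \int[P]_w H (x, w))%E.
Proof.
move=> mH; under eq_fun do rewrite integralE.
apply: emeasurable_funB.
  have := @measurable_fun_fubini_tonelli_F _ _ _ _ _ P (H^\+)%E (measurable_funepos mH) _.
  rewrite /fubini_F.
  have -> : (fun x => \int[P]_y H^\+ (x, y))%E = (fun x => \int[P]_x0 (fun w => H (x, w))^\+ x0)%E.
    by apply/funext => x; apply: eq_integral => w _; rewrite !funeposE.
  by apply => z; exact: funepos_ge0.
have := @measurable_fun_fubini_tonelli_F _ _ _ _ _ P (H^\-)%E (measurable_funeneg mH) _.
rewrite /fubini_F.
have -> : (fun x => \int[P]_y H^\- (x, y))%E = (fun x => \int[P]_x0 (fun w => H (x, w))^\- x0)%E.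
  by apply/funext => x; apply: eq_integral => w _; rewrite !funenegE.
by apply => z; exact: funeneg_ge0.
Qed.

(** * The weights (1 + |x|^2)^p *)

Section bracket.
Context (R : realType) (n : nat).
Local Notation V := (n.-tuple R).
Implicit Types (x : V) (p : R).

Lemma enorm_sqr x : enorm x ^+ 2 = \sum_l tnth x l ^+ 2.
Proof. by rewrite sqr_sqrtr// sumr_ge0// => l _; exact: sqr_ge0. Qed.

Lemma tnth_le_enorm x l : `|tnth x l| <= enorm x.
Proof.
rewrite -sqrtr_sqr ler_wsqrtr// (bigD1 l)//= lerDl.
by apply: sumr_ge0 => i _; exact: sqr_ge0.
Qed.

Let base_ge1 x : 1 <= 1 + enorm x ^+ 2. Proof. by rewrite lerDl sqr_ge0. Qed.
Let base_gt0 x : 0 < 1 + enorm x ^+ 2. Proof. exact: lt_le_trans (base_ge1 x). Qed.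

Lemma jbracket_gt0 p x : 0 < jbracket p x.
Proof. by rewrite powR_gt0. Qed.

Lemma jbracket_neq0 p x : jbracket p x != 0.
Proof. by rewrite gt_eqF// jbracket_gt0. Qed.

Lemma le_jbracket p p' x : p <= p' -> jbracket p x <= jbracket p' x.
Proof. exact: ler_powR. Qed.

Lemma jbracket_sqr p x : jbracket (p / 2) x ^+ 2 = jbracket p x.
Proof. by rewrite /jbracket -powR_mulrn ?powR_ge0// -powRrM divfK. Qed.

Lemma measurable_enorm_sqr : measurable_fun setT (fun x : V => enorm x ^+ 2).
Proof.
under eq_fun do rewrite enorm_sqr.
apply: measurable_sum => l.
by apply: measurable_funX; exact: measurable_tnth.
Qed.

Lemma measurable_jbracket p : measurable_fun setT (@jbracket R n p).
Proof.
apply: (measurableT_comp (measurable_powR p)).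
by apply: measurable_funD => //; exact: measurable_enorm_sqr.
Qed.

(* Peetre's inequality 1 + |x + z|^2 <= 2 (1 + |x|^2) (1 + |z|^2), to the power p. *)
Lemma jbracket_shift p k x x' (s : R) : 0 <= p <= k%:R ->
  (forall l, `|tnth x' l - tnth x l| <= s) ->
  jbracket p x' <= (2 * (1 + n%:R * s ^+ 2)) ^+ k * jbracket p x.
Proof.
move=> /andP[p0 pk] H.
have ns0 : 0 <= n%:R * s ^+ 2 by rewrite mulr_ge0 ?ler0n ?sqr_ge0.
have b1 : 1 <= 2 * (1 + n%:R * s ^+ 2) by lra.
have le1 : enorm x' ^+ 2 <= 2 * enorm x ^+ 2 + 2 * (n%:R * s ^+ 2).
  rewrite !enorm_sqr (_ : n%:R * s ^+ 2 = \sum_(l < n) s ^+ 2); last first.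
    by rewrite sumr_const card_ord mulr_natl.
  rewrite -mulrDr -big_split mulr_sumr; apply: ler_sum => l _ /=.
  have s0 : 0 <= s by exact: le_trans (H l).
  have := H l; rewrite ler_norml => /andP[h1 h2].
  have h3 : 0 <= (s - (tnth x' l - tnth x l)) * (s + (tnth x' l - tnth x l)).
    by rewrite mulr_ge0//; lra.
  have h4 := sqr_ge0 (2 * tnth x l - tnth x' l).
  by nra.
rewrite -powR_mulrn; last lra.
apply: (@le_trans _ _ ((2 * (1 + n%:R * s ^+ 2)) `^ p * jbracket p x)); last first.
  by rewrite ler_wpM2r ?ler_powR// ltW// jbracket_gt0.
rewrite /jbracket -powRM; [|lra|exact: ltW].
have nx : 0 <= enorm x ^+ 2 by exact: sqr_ge0.
apply: ge0_ler_powR; rewrite ?nnegrE//; first exact: ltW.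
  by rewrite mulr_ge0 ?(ltW (base_gt0 _))//; lra.
nra.
Qed.

End bracket.

Section euler.
Context (R : realType) (d dW : nat) (m : model R d dW).
Hypothesis H2 : coefficient_assumption m.
Hypothesis T_gt0 : 0 < mT m.
Local Notation V := (d.-tuple R).

Lemma step_gt0 N : (0 < N)%N -> 0 < step m N.
Proof. by move=> N0; rewrite divr_gt0// ltr0n. Qed.

Lemma step_ge0 N : 0 <= step m N.
Proof. by rewrite divr_ge0 ?ler0n// ltW. Qed.

Lemma grid_ge0 N j : 0 <= grid m N j.
Proof. by rewrite mulr_ge0 ?ler0n ?step_ge0. Qed.

Lemma grid_le N j : (0 < N)%N -> (j <= N)%N -> 0 <= grid m N j <= mT m.
Proof.
move=> N0 jN; rewrite grid_ge0 /= /grid /step mulrCA ler_piMr ?(ltW T_gt0)//.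
by rewrite ler_pdivrMr ?ltr0n// mul1r ler_nat.
Qed.

Lemma grid_lt N j : (0 < N)%N -> 0 <= grid m N j < grid m N j.+1.
Proof.
by move=> N0; rewrite grid_ge0 /= /grid ltr_pM2r ?step_gt0// ltr_nat.
Qed.

Lemma le_grid N i j : (i <= j)%N -> grid m N i <= grid m N j.
Proof. by move=> ij; rewrite /grid ler_wpM2r ?step_ge0// ler_nat. Qed.

Lemma step_sumT N : (0 < N)%N -> N%:R * step m N = mT m.
Proof. by move=> N0; rewrite /step mulrC divfK// pnatr_eq0 -lt0n. Qed.

Let measurable_section dU (U : measurableType dU) (F : R * V -> U) t :
  0 <= t <= mT m -> measurable_fun (`[0, mT m] `*` setT) F ->
  measurable_fun setT (fun x => F (t, x)).
Proof.
move=> tT mF; apply: (@measurable_comp _ _ _ _ _ _ (`[0, mT m]%classic `*` setT) F setT (fun x => (t, x))) => //.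
- by apply: measurableX.
- by move=> _ [x _ <-]; split => //=; rewrite in_itv.
- exact: measurable_pair1.
Qed.

Lemma measurable_euler_step dE (E : measurableType dE) N j (X : E -> V)
    (dw : E -> dW.-tuple R) :
  (0 < N)%N -> (j <= N)%N -> measurable_fun setT X -> measurable_fun setT dw ->
  measurable_fun setT (fun e => euler_step m N j (X e) (dw e)).
Proof.
move=> N0 jN mX mdw; have [mb ms _] := H2; have tT := grid_le N0 jN.
apply/measurable_fun_tnthP => l.
rewrite (_ : _ \o _ = fun e => tnth (X e) l + tnth (Defs.mb m (grid m N j) (X e)) l * step m N
    + \sum_r msigma m (grid m N j) (X e) l r * tnth (dw e) r); last first.
  by apply/funext => e /=; rewrite tnth_mktuple.
apply: measurable_funD.
  apply: measurable_funD; first exact: measurableT_comp (measurable_tnth l) mX.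
  apply: measurable_funM => //; apply: measurableT_comp (measurable_tnth l) _.
  exact: measurableT_comp (measurable_section tT mb) mX.
apply: measurable_sum => r; apply: measurable_funM.
  exact: measurableT_comp (measurable_section tT (ms l r)) mX.
exact: measurableT_comp (measurable_tnth r) mdw.
Qed.

(** Measurability is asked only of the increments from index i on, seen through u. This allows E to
    carry the sigma-algebra of the future of W, for which W itself need not be measurable. *)
Lemma measurable_euler dE (E : measurableType dE)
    dO (Omega : measurableType dO)
    (W : R -> Omega -> dW.-tuple R) N i j (X : E -> V) (u : E -> Omega) :
  (0 < N)%N -> (j <= N)%N -> measurable_fun setT X ->
  (forall j', (i <= j' < N)%N ->
    measurable_fun setT (fun e => incr W (grid m N j') (grid m N j'.+1) (u e))) ->
  measurable_fun setT (fun e => euler m W N i (X e) j (u e)).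
Proof.
move=> N0 + mX mW; elim: j => [|j IH] jN //=.
have [ij|//] := leqP i j.
apply: measurable_euler_step => //; first exact: ltnW.
- by apply: IH; exact: ltnW.
- by apply: mW; rewrite ij.
Qed.

Lemma euler_start dO (Omega : measurableType dO) (W : R -> Omega -> dW.-tuple R) N i x w :
  euler m W N i x i w = x.
Proof. by case: i => //= i; rewrite ltnn. Qed.

Section brownian.
Context dO (Omega : measurableType dO) (P : probability Omega R).
Context (W : R -> Omega -> dW.-tuple R).
Hypothesis BM : standard_brownian P W.

Lemma measurable_euler_fix N i j x : (0 < N)%N -> (j <= N)%N ->
  measurable_fun setT (fun w => euler m W N i x j w).
Proof.
move=> N0 jN; apply: (@measurable_euler _ Omega _ Omega W N i j (cst x) id) => //.
by move=> j' _; apply: (measurable_incr BM); exact: grid_ge0.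
Qed.

Lemma measurable_euler_pair N i j : (0 < N)%N -> (j <= N)%N ->
  measurable_fun setT (fun z : V * Omega => euler m W N i z.1 j z.2).
Proof.
move=> N0 jN; apply: measurable_euler => // j' _.
apply: (measurableT_comp _ (@measurable_snd _ _ V Omega)).
by apply: (measurable_incr BM); exact: grid_ge0.
Qed.

(** A bound on the displacement of each coordinate of the scheme, uniform in the start and in both
    times. *)
Definition noise (K : R) N (w : Omega) : R :=
  mT m * K + \sum_(j < N) \sum_r (K * `|tnth (incr W (grid m N j) (grid m N j.+1) w) r|).

Lemma euler_shift N i j x w (K : R) :
  (0 < N)%N -> (i <= j <= N)%N -> 0 <= K ->
  (forall t x, 0 <= t <= mT m ->
     enorm (Defs.mb m t x) <= K /\ forall l r, `|msigma m t x l r| <= K) ->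
  forall l, `|tnth (euler m W N i x j w) l - tnth x l| <= noise K N w.
Proof.
move=> N0 /andP[ij jN] K0 HK l.
pose inc j := step m N * K + \sum_r (K * `|tnth (incr W (grid m N j) (grid m N j.+1) w) r|).
have inc0 k : 0 <= inc k.
  by apply: addr_ge0; [rewrite mulr_ge0 ?step_ge0|apply: sumr_ge0 => r _; rewrite mulr_ge0].
have noiseE : noise K N w = \sum_(k < N) inc k.
  rewrite /noise /inc big_split /= sumr_const card_ord -mulr_natl mulrA.
  by rewrite step_sumT.
suff H : `|tnth (euler m W N i x j w) l - tnth x l| <= \sum_(k < j) inc k.
  apply: le_trans H _; rewrite noiseE (big_ord_widen N inc)// [leRHS](bigID (fun k : 'I_N => (k < j)%N)) /=.
  by rewrite lerDl sumr_ge0.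
elim: j ij jN => [|j IH] ij jN.
  by rewrite big_ord0 /= subrr normr0.
move: ij; rewrite leq_eqVlt ltnS => /predU1P[->|ij].
  by rewrite euler_start subrr normr0 sumr_ge0.
rewrite /= ij tnth_mktuple big_ord_recr /=.
set X := euler m W N i x j w.
have [b1 s1] := HK (grid m N j) X (grid_le N0 (ltnW jN)).
rewrite (_ : _ + _ + _ - _ = (tnth X l - tnth x l) + (tnth (Defs.mb m (grid m N j) X) l * step m N
   + \sum_r msigma m (grid m N j) X l r * tnth (incr W (grid m N j) (grid m N j.+1) w) r)); last by ring.
apply: le_trans (ler_normD _ _) _; apply: lerD; first exact: IH (ltnW jN).
apply: le_trans (ler_normD _ _) _; apply: lerD.
  rewrite normrM mulrC (ger0_norm (step_ge0 N)) ler_wpM2l ?step_ge0//.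
  exact: le_trans (tnth_le_enorm _ _) b1.
apply: le_trans (ler_norm_sum _ _ _) _; apply: ler_sum => r _.
by rewrite normrM ler_wpM2r.
Qed.

Lemma noise_finite_moments K N : (0 < N)%N -> finite_moments P (noise K N).
Proof.
move=> N0; apply: finite_momentsD; first exact: finite_moments_cst.
apply: finite_moments_sum => j; apply: finite_moments_sum => r.
apply: finite_momentsM; first exact: finite_moments_cst.
by apply/finite_moments_norm/(incr_finite_moments BM); exact: grid_lt.
Qed.

Hypothesis eta_ge0 : 0 <= eta m.
Local Notation br := (jbracket (eta m / 2)).

(** Peetre's inequality separates the noise from the start, so one integrable D serves all i, j and
    x. This bounds the supremum in [C_eta]. *)
Lemma euler_moment_dominated N : (0 < N)%N ->
  exists D : Omega -> R, [/\ P.-integrable setT (EFin \o D),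
    forall w, 0 <= D w &
    forall i j x w, (i <= j <= N)%N -> br (euler m W N i x j w) <= D w * br x].
Proof.
move=> N0; have [_ _ [K HK]] := H2.
have K0 : 0 <= K.
  have [h _] := HK 0 [tuple 0 | l < d] (introT andP (conj (lexx 0) (ltW T_gt0))).
  by apply: le_trans h; rewrite sqrtr_ge0.
pose k := (Num.truncn (eta m / 2)).+1.
have pk : 0 <= eta m / 2 <= k%:R.
  by rewrite divr_ge0//= ltW// truncnS_gt.
exists (fun w => (2 * (1 + d%:R * noise K N w ^+ 2)) ^+ k); split.
- apply: finite_moments_integrable; apply: finite_momentsX.
  apply: finite_momentsM; first exact: finite_moments_cst.
  apply: finite_momentsD; first exact: finite_moments_cst.
  apply: finite_momentsM; first exact: finite_moments_cst.
  by apply: finite_momentsX; exact: noise_finite_moments.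
- by move=> w; rewrite exprn_ge0// mulr_ge0// addr_ge0// mulr_ge0 ?ler0n ?sqr_ge0.
- move=> i j x w ijN; apply: jbracket_shift => // l.
  exact: euler_shift.
Qed.

Lemma integrable_br_euler N i j x : (0 < N)%N -> (i <= j <= N)%N ->
  P.-integrable setT (EFin \o (fun w => br (euler m W N i x j w))).
Proof.
move=> N0 ijN; have [D [iD D0 HD]] := euler_moment_dominated N0.
have jN : (j <= N)%N by have /andP[] := ijN.
have := integrableZr measurableT (br x) iD; apply: le_integrable => //.
  apply/measurable_EFinP.
  exact: measurableT_comp (@measurable_jbracket R d _) (measurable_euler_fix _ _ N0 jN).
move=> w _ /=; rewrite lee_fin !ger0_norm ?mulr_ge0 ?(ltW (jbracket_gt0 _ _))//.
exact: HD.
Qed.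

(** The supremum lies between 1, the ratio at i = j = 0, and the expectation of D; hence [fine]
    returns its true value. *)
Lemma C_eta_spec N : (0 < N)%N ->
  1 <= C_eta m P W N /\
  forall i j x, (i <= j <= N)%N ->
    \int[P]_w br (euler m W N i x j w) <= C_eta m P W N * br x.
Proof.
move=> N0; have [D [iD D0 HD]] := euler_moment_dominated N0.
set S := [set r | exists i j x, (i <= j <= N)%N /\
  r = 'E_P[fun w => (br (euler m W N i x j w) / br x)%R]%E].
have brx x : 0 < br x by exact: jbracket_gt0.
have iB i j x : (i <= j <= N)%N -> P.-integrable setT
    (EFin \o (fun w => br (euler m W N i x j w) / br x)).
  move=> ijN; have := integrableZr measurableT (br x)^-1 (integrable_br_euler x N0 ijN).
  exact: eq_integrable.
have SE i j x : (i <= j <= N)%N -> 'E_P[fun w => (br (euler m W N i x j w) / br x)%R]%E =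
    ((\int[P]_w br (euler m W N i x j w)) / br x)%:E.
  move=> ijN; rewrite expectationE -EFin_Rintegral; last exact: iB.
  by rewrite RintegralZr//; exact: integrable_br_euler.
have S1 : S 1%E.
  exists 0%N, 0%N, [tuple 0 | l < d]; split => //; rewrite SE// /=.
  rewrite Rintegral_cst// [fine _](_ : _ = 1) ?mulr1 ?divff ?jbracket_neq0//.
  exact: (congr1 fine (@probability_setT _ _ _ P)).
have Sub : (ereal_sup S <= (\int[P]_w D w)%:E)%E.
  apply: ge_ereal_sup => _ [i [j [x [ijN ->]]]].
  rewrite SE// lee_fin ler_pdivrMr// -RintegralZr//.
  apply: le_Rintegral => //.
  - exact: integrable_br_euler.
  - by have := integrableZr measurableT (br x) iD; apply: eq_integrable.
  - by move=> w _; exact: HD.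
have Sge1 : (1 <= ereal_sup S)%E by exact: ereal_sup_ubound.
have Sfin : ereal_sup S \is a fin_num.
  rewrite ge0_fin_numE; last exact: le_trans Sge1.
  by apply: le_lt_trans Sub _; rewrite ltry.
have CE : (C_eta m P W N)%:E = ereal_sup S by rewrite /C_eta fineK.
split; first by rewrite -lee_fin CE.
move=> i j x ijN; rewrite -ler_pdivrMr// -lee_fin CE -SE//.
by apply: ereal_sup_ubound; exists i, j, x.
Qed.

End brownian.

End euler.

(** * The exact solution *)

Section sums_over_intervals.
Context d (T : measurableType d) (R : realType).
Variables (i N : nat) (F : nat -> T -> R).

(** The extension by 0 satisfies at every index what F satisfies on the range only, as the general
    lemmas on sums require. *)
Let G j x := if (i <= j < N)%N then F j x else 0.

Let FG : (fun x => \sum_(i <= j < N) F j x) = (fun x => \sum_(i <= j < N) G j x).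
Proof. by apply/funext => x; apply: eq_big_nat => j ijN; rewrite /G ijN. Qed.

Lemma measurable_sum_nat :
  (forall j, (i <= j < N)%N -> measurable_fun setT (F j)) ->
  measurable_fun setT (fun x => \sum_(i <= j < N) F j x).
Proof.
move=> mF; rewrite FG; apply: measurable_sum => j; rewrite /G.
by have [/mF//|_] := boolP (i <= j < N)%N; exact: measurable_cst.
Qed.

Variable mu : {measure set T -> \bar R}.

Lemma sqintegrable_sum_nat :
  (forall j, (i <= j < N)%N -> sqintegrable mu (F j)) ->
  sqintegrable mu (fun x => \sum_(i <= j < N) F j x).
Proof.
move=> sF; rewrite FG; apply: sqintegrable_sum => j _; rewrite /G.
by have [/sF//|_] := boolP (i <= j < N)%N; exact: sqintegrable0.
Qed.

Lemma integrable_sum_nat :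
  (forall j, (i <= j < N)%N -> mu.-integrable setT (EFin \o F j)) ->
  mu.-integrable setT (EFin \o (fun x => \sum_(i <= j < N) F j x)).
Proof.
move=> iF; rewrite FG.
rewrite (_ : _ \o _ = fun x => (\sum_(i <= j < N) (G j x)%:E)%E); last first.
  by apply/funext => x /=; rewrite sumEFin.
apply: integrable_sum => // j _; rewrite /G.
by have [/iF//|_] := boolP (i <= j < N)%N; exact: integrable0.
Qed.

Lemma Rintegral_sum_nat :
  (forall j, (i <= j < N)%N -> mu.-integrable setT (EFin \o F j)) ->
  \int[mu]_x (\sum_(i <= j < N) F j x) = \sum_(i <= j < N) \int[mu]_x F j x.
Proof.
move=> iF; rewrite FG Rintegral_sum.
  by apply: eq_big_nat => j ijN; apply: eq_Rintegral => x _; rewrite /G ijN.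
move=> j; rewrite /G.
by have [/iF//|_] := boolP (i <= j < N)%N; exact: integrable0.
Qed.

End sums_over_intervals.

Lemma geometric_sum_nat (R : comRingType) (a : R) N i : (i <= N)%N ->
  a * \sum_(i <= j < N) (1 + a) ^+ (N - j.+1) = (1 + a) ^+ (N - i) - 1.
Proof.
move=> iN; rewrite -(subKn iN); move: (leq_subr i N); move: (N - i)%N => k {i iN}.
elim: k => [|k IH] kN; first by rewrite subn0 big_geq// subnn mulr0 expr0 subrr.
rewrite big_ltn ?ltn_subrL ?(leq_trans _ kN)// -subSn// subSS mulrDr IH 1?ltnW//.
rewrite !subKn// 1?ltnW//.
by rewrite exprS; ring.
Qed.

Lemma jbracket_growth (R : realType) d dW (m : model R d dW) (e : R)
    (x : d.-tuple R) :
  e <= eta m -> jbracket (e / 2) x <= jbracket (eta m / 2) x.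
Proof. by move=> ee; rewrite le_jbracket// ler_wpM2r// invr_ge0. Qed.

Section exact_solution.
Context (R : realType) (d dW : nat) (m : model R d dW).
Hypothesis H1 : growth_assumption m.
Hypothesis H2 : coefficient_assumption m.
Hypothesis T_gt0 : 0 < mT m.
Local Notation V := (d.-tuple R).
Local Notation br := (jbracket (eta m / 2)).

Lemma growth_eta_ge0 : 0 <= eta m.
Proof. by have [[_ e0 _ _ _] _ _ _] := H1; rewrite le_max e0. Qed.

Lemma mg_bound x : `|mg m x| <= mCg m * br x.
Proof.
have [[C0 _ _ _ _] _ Hg _] := H1; apply: le_trans (Hg x) _.
by rewrite ler_wpM2l// jbracket_growth// le_max lexx.
Qed.

Lemma mf_bound N j x z : (0 < N)%N -> (j < N)%N ->
  `|mf m (grid m N j) x z| <= mCf m * br x + mLf m * `|z|.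
Proof.
move=> N0 jN; have [[_ _ _ C0 _] _ _ Hf] := H1.
have [_ /(_ x z 0) h1 /(_ x) h2] := Hf N j N0 jN.
rewrite -[X in `|X|](subrK (mf m (grid m N j) x 0)) addrC.
apply: le_trans (ler_normD _ _) _; apply: lerD.
  apply: le_trans h2 _.
  by rewrite ler_wpM2l// jbracket_growth// le_max lexx orbT.
by move: h1; rewrite subr0.
Qed.

Lemma measurable_mf N j dE (E : measurableType dE) (X : E -> V) (z : E -> R) :
  (0 < N)%N -> (j < N)%N -> measurable_fun setT X -> measurable_fun setT z ->
  measurable_fun setT (fun e => mf m (grid m N j) (X e) (z e)).
Proof.
move=> N0 jN mX mz; have [_ _ _ Hf] := H1; have [h _ _] := Hf N j N0 jN.
exact: measurableT_comp h (measurable_fun_pair mX mz).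
Qed.

Section brownian.
Context dO (Omega : measurableType dO) (P : probability Omega R).
Context (W : R -> Omega -> dW.-tuple R).
Hypothesis BM : standard_brownian P W.
Variable N : nat.
Hypothesis N0 : (0 < N)%N.
Local Notation c := (C_eta m P W N).
Local Notation B := (mCg m + mT m * mCf m).

Lemma C_eta_ge1 : 1 <= c.
Proof. by have [] := C_eta_spec H2 T_gt0 BM growth_eta_ge0 N0. Qed.

Let c0 : 0 <= c. Proof. exact: le_trans C_eta_ge1. Qed.
Let B0 : 0 <= B.
Proof. by have [[C0 _ _ C1 _] _ _ _] := H1; rewrite addr_ge0// mulr_ge0// ltW. Qed.
Let L0 : 0 <= mLf m. Proof. by have [[]] := H1. Qed.
Let a := c * mLf m * step m N.
Let a0 : 0 <= a. Proof. apply: mulr_ge0; [exact: mulr_ge0|exact: step_ge0].  Qed.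

Lemma Lstar_ge0 x : 0 <= Lstar m P W N x.
Proof. by rewrite !mulr_ge0// ?expR_ge0// ltW// jbracket_gt0. Qed.

Lemma measurable_Lstar : measurable_fun setT (Lstar m P W N).
Proof. by apply: measurable_funM => //; exact: measurable_jbracket. Qed.

Let Lstar_lb : c * B <= c * B * expR (c * mLf m * mT m).
Proof.
rewrite ler_peMr ?mulr_ge0// -expR0 ler_expR !mulr_ge0//; exact: ltW.
Qed.

Lemma br_le_Lstar (C : R) x : 0 <= C -> C <= B ->
  C * br x <= Lstar m P W N x.
Proof.
move=> C0 CB; rewrite ler_wpM2r ?(ltW (jbracket_gt0 _ _))//.
apply: le_trans CB _; apply: le_trans Lstar_lb.
by rewrite ler_peMl// C_eta_ge1.
Qed.

Definition payoff (y : nat -> V -> R) i x w : R :=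
  mg m (euler m W N i x N w)
  + \sum_(i <= j < N) mf m (grid m N j) (euler m W N i x j w)
                        (y j.+1 (euler m W N i x j.+1 w)) * step m N.

Variable y : nat -> V -> R.
Hypothesis Hy : exact_solution m P W N y.

(** The three claims are proved together: the bound on the later y_(j+1) makes the payoff
    integrable, so that the [fine] defining y_i is the actual expectation, which is then bounded.
    Moments are compared directly between t_i and t_j, so [c] enters once per step and not as a
    power: the bound c B (1 + a)^(N - i) satisfies c B + c B a sum_(j >= i) (1 + a)^(N - j - 1) = c
    B (1 + a)^(N - i). *)
Let exact_solution_spec i : (i <= N)%N ->
  [/\ measurable_fun setT (y i),
      forall x, `|y i x| <= c * B * (1 + a) ^+ (N - i) * br x &
      (i < N)%N -> forall x, P.-integrable setT (EFin \o payoff y i x)].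
Proof.
have [yN yi] := Hy; have [_ mg_m _ _] := H1.
have [Cg0 _ _ Cf0 _] : [/\ 0 <= mCg m, 0 <= metag m, 0 <= mLf m, 0 <= mCf m & 0 <= metaf m] by case: H1.
have [c1 cE] := C_eta_spec H2 T_gt0 BM growth_eta_ge0 N0.
have st := step_ge0 T_gt0 N.
(* Backward induction as strong induction on k = N - i, since y_i involves all later y_(j+1). *)
move=> iN; rewrite -(subKn iN); move: (N - i)%N (leq_subr i N) => k {i iN}.
elim/ltn_ind: k => k IH kN; set i := (N - k)%N.
have [k0|k0] := posnP k.
  rewrite /i k0 subn0 subnn expr0 mulr1 yN; split => //; last by rewrite ltnn.
  move=> x.
  apply: le_trans (mg_bound x) _.
  rewrite ler_wpM2r ?(ltW (jbracket_gt0 _ _))//.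
  apply: (@le_trans _ _ B); last by rewrite ler_peMl.
  by rewrite lerDl mulr_ge0// ltW.
have iN : (i < N)%N by rewrite /i ltn_subrL k0 N0.
have IHj j : (i <= j < N)%N -> [/\ measurable_fun setT (y j.+1),
    forall x, `|y j.+1 x| <= c * B * (1 + a) ^+ (N - j.+1) * br x &
    (j.+1 < N)%N -> forall x, P.-integrable setT (EFin \o payoff y j.+1 x)].
  move=> /andP[ij jN]; rewrite -(subKn jN); apply: IH; last exact: leq_subr.
  by move: ij jN; rewrite /i; clear; lia.
pose F (z : V * Omega) := payoff y i z.1 z.2.
have mF : measurable_fun setT F.
  apply: measurable_funD.
    apply: measurableT_comp mg_m _.
    exact: (measurable_euler_pair H2 T_gt0 BM).
  apply: measurable_sum_nat => j ijN; have [my _ _] := IHj j ijN.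
  have /andP[ij jN] := ijN.
  apply: measurable_funM => //; apply: measurable_mf => //.
    by apply: (measurable_euler_pair H2 T_gt0 BM) => //; exact: ltnW.
  apply: measurableT_comp my _.
  exact: (measurable_euler_pair H2 T_gt0 BM).
have my : measurable_fun setT (y i).
  rewrite (_ : y i = fun x => fine (\int[P]_w (F (x, w))%:E)%E); last first.
    by apply/funext => x; rewrite yi// expectationE.
  apply: (measurableT_comp (fine_measurable measurableT)).
  by apply: (@measurable_fun_integral _ _ _ _ _ P (fun z => (F z)%:E)); exact/measurable_EFinP.
(* An integrable majorant of the payoff, with the inductive bound in place of y_(j+1). *)
pose G x w := mCg m * br (euler m W N i x N w)
  + \sum_(i <= j < N) (mCf m * br (euler m W N i x j w)
     + mLf m * (c * B * (1 + a) ^+ (N - j.+1)) * br (euler m W N i x j.+1 w)) * step m N.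
have ib x j : (i <= j <= N)%N -> P.-integrable setT (EFin \o (fun w => br (euler m W N i x j w))).
  by move=> ijN; exact: (integrable_br_euler H2 T_gt0 BM growth_eta_ge0).
have ibZ x (r : R) j : (i <= j <= N)%N -> P.-integrable setT (EFin \o (fun w => r * br (euler m W N i x j w))).
  by move=> ijN; have := integrableZl measurableT r (ib x j ijN); exact: eq_integrable.
have iNN : (i <= N <= N)%N by rewrite ltnW/=.
have iG2 x j : (i <= j < N)%N -> P.-integrable setT (EFin \o (fun w => mCf m * br (euler m W N i x j w)
     + mLf m * (c * B * (1 + a) ^+ (N - j.+1)) * br (euler m W N i x j.+1 w))).
  move=> /andP[ij jN].
  have h1 : (i <= j <= N)%N by rewrite ij ltnW.
  have h2 : (i <= j.+1 <= N)%N by rewrite ltnW ?ltnS.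
  by have := integrableD measurableT (ibZ x (mCf m) j h1) (ibZ x (mLf m * (c * B * (1 + a) ^+ (N - j.+1))) j.+1 h2).
have iG1 x j : (i <= j < N)%N -> P.-integrable setT (EFin \o (fun w => (mCf m * br (euler m W N i x j w)
     + mLf m * (c * B * (1 + a) ^+ (N - j.+1)) * br (euler m W N i x j.+1 w)) * step m N)).
  by move=> ijN; have := integrableZr measurableT (step m N) (iG2 x j ijN); exact: eq_integrable.
have iG x : P.-integrable setT (EFin \o G x).
  by have := integrableD measurableT (ibZ x (mCg m) _ iNN) (integrable_sum_nat (iG1 x)).
have FG x w : `|payoff y i x w| <= G x w.
  apply: le_trans (ler_normD _ _) _; apply: lerD; first exact: mg_bound.
  apply: le_trans (ler_norm_sum _ _ _) _; rewrite big_nat_cond [leRHS]big_nat_cond.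
  apply: ler_sum => j /andP[ijN _].
  have /andP[ij jN] := ijN.
  rewrite normrM (ger0_norm st) ler_wpM2r//.
  apply: le_trans (mf_bound _ _ N0 jN) _; rewrite lerD2l -[leRHS]mulrA ler_wpM2l//.
  by have [_ h _] := IHj j ijN; exact: h.
have iF x : P.-integrable setT (EFin \o payoff y i x).
  apply: le_integrable (iG x) => //.
    exact/measurable_EFinP/(measurableT_comp mF (measurable_pair1 x)).
  move=> w _ /=; rewrite lee_fin; apply: le_trans (FG x w) _; exact: ler_norm.
split => // x.
have iG3 := integrable_sum_nat (iG1 x).
have -> : y i x = \int[P]_w payoff y i x w by rewrite yi// expectationE.
apply: le_trans (le_normr_Rintegral _ (iF x)) _ => //.
apply: (@le_trans _ _ (\int[P]_w G x w)).
  apply: le_Rintegral => //.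
  by have := integrable_norm (iF x); exact: eq_integrable.
rewrite /G RintegralD// ?RintegralZl//; [|exact: ib|exact: ibZ].
rewrite Rintegral_sum_nat//; last exact: iG1.
apply: (@le_trans _ _ (mCg m * (c * br x) + \sum_(i <= j < N)
   (mCf m * (c * br x) + mLf m * (c * B * (1 + a) ^+ (N - j.+1)) * (c * br x)) * step m N)).
  apply: lerD; first by rewrite ler_wpM2l// cE.
  rewrite big_nat_cond [leRHS]big_nat_cond; apply: ler_sum => j /andP[ijN _].
  have /andP[ij jN] := ijN.
  have h1 : (i <= j <= N)%N by rewrite ij ltnW.
  have h2 : (i <= j.+1 <= N)%N by rewrite ltnW ?ltnS.
  rewrite RintegralZr//; last exact: iG2.
  rewrite RintegralD//; [|exact: ibZ|exact: ibZ].
  rewrite !RintegralZl//; [|exact: ib|exact: ib].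
  rewrite ler_wpM2r// lerD// ler_wpM2l// ?cE//.
  by rewrite !mulr_ge0// exprn_ge0// addr_ge0.
rewrite -mulr_suml big_split /= sumr_const_nat.
have -> : \sum_(i <= j < N) mLf m * (c * B * (1 + a) ^+ (N - j.+1)) * (c * br x)
   = mLf m * (c * B) * (c * br x) * \sum_(i <= j < N) (1 + a) ^+ (N - j.+1).
  by rewrite mulr_sumr; apply: eq_bigr => j _; ring.
(* With (1 + a)^(N - i) = 1 + a g, what remains is linear in g and uses (N - i) Delta <= T. *)
have := geometric_sum_nat a (ltnW iN); set g := \sum_(_ <= _ < _) _ => gE.
rewrite -/i; have -> : (1 + a) ^+ (N - i) = 1 + a * g by rewrite gE; ring.
have Dn : (N - i)%:R * step m N <= mT m.
  by rewrite -(step_sumT m N0) ler_wpM2r// ler_nat leq_subr.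
have nB : 0 <= mCf m * (c * br x) by rewrite !mulr_ge0// ltW// jbracket_gt0.
rewrite -[_ *+ (N - i)]mulr_natr /a.
have := ler_wpM2l nB Dn.
lra.
Qed.

Lemma exact_solution_measurable i : (i <= N)%N -> measurable_fun setT (y i).
Proof. by case/exact_solution_spec. Qed.

Lemma exact_solution_integrable i x : (i < N)%N ->
  P.-integrable setT (EFin \o payoff y i x).
Proof. by move=> iN; have [_ _] := exact_solution_spec (ltnW iN); apply. Qed.

(** The exponential of [Lstar] comes from (1 + a)^(N - i) <= exp (a N) with a N = c L_f T. *)
Lemma exact_solution_le_Lstar i x : (i <= N)%N -> `|y i x| <= Lstar m P W N x.
Proof.
move=> iN; have [_ h _] := exact_solution_spec iN; apply: le_trans (h x) _.
rewrite ler_wpM2r ?(ltW (jbracket_gt0 _ _))// ler_wpM2l ?mulr_ge0//.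
apply: (@le_trans _ _ (expR a ^+ (N - i))).
  apply: lerXn2r; last exact: expR_ge1Dx.
    by rewrite nnegrE addr_ge0.
  by rewrite nnegrE expR_ge0.
rewrite -expRM_natl ler_expR /a mulrCA ler_wpM2l ?mulr_ge0//.
rewrite -(step_sumT m N0) ler_wpM2r ?step_ge0// ler_nat.
exact: leq_subr.
Qed.

End brownian.
End exact_solution.

(** * Averages of pairwise independent samples *)

(** Nonnegativity of the sum of squared deviations from the mean. *)
Lemma sqr_sum_nat_le (R : realFieldType) (a : nat -> R) i N :
  (\sum_(i <= j < N) a j) ^+ 2 <= (N - i)%:R * \sum_(i <= j < N) a j ^+ 2.
Proof.
have [Ni|iN] := leqP N i; first by rewrite !big_geq// expr0n mulr0.
set n : R := (N - i)%:R; set s := \sum_(i <= j < N) a j.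
have n0 : 0 < n by rewrite ltr0n subn_gt0.
have : 0 <= \sum_(i <= j < N) (a j - s / n) ^+ 2 by apply: sumr_ge0 => j _; exact: sqr_ge0.
have -> : \sum_(i <= j < N) (a j - s / n) ^+ 2
    = \sum_(i <= j < N) a j ^+ 2 - s ^+ 2 / n.
  transitivity (\sum_(i <= j < N) (a j ^+ 2 - 2 * (s / n) * a j + (s / n) ^+ 2)).
    by apply: eq_bigr => j _; ring.
  rewrite big_split sumrB /= -mulr_sumr sumr_const_nat -[_ *+ (N - i)]mulr_natl -/n -/s.
  by field; rewrite gt_eqF.
by rewrite subr_ge0 ler_pdivrMr// mulrC.
Qed.

(* The cross terms E[Z_k Z_l] = b^2 encode pairwise independence. *)
Lemma mean_sqr_error d (T : measurableType d) (R : realType)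
    (P : probability T R) (M : nat) (Z : 'I_M -> T -> R) (a b v : R) :
  (0 < M)%N -> (forall n, sqintegrable P (Z n)) ->
  (forall n, \int[P]_w Z n w = b) -> (forall n, \int[P]_w Z n w ^+ 2 = v) ->
  (forall n n', n != n' -> \int[P]_w (Z n w * Z n' w) = b ^+ 2) ->
  \int[P]_w (M%:R^-1 * \sum_n Z n w - a) ^+ 2 <= M%:R^-1 * v + (b - a) ^+ 2.
Proof.
move=> M0 sZ EZ EZ2 EZZ; set c : R := M%:R^-1.
have Mc : M%:R * c = 1 by rewrite divff// pnatr_eq0 -lt0n.
have c0 : 0 <= c by rewrite invr_ge0.
have sS : sqintegrable P (fun w => c * \sum_n Z n w).
  by apply: sqintegrableZ; apply: sqintegrable_sum.
have sa : sqintegrable P (cst a) by exact: (@sqintegrable_bounded _ _ _ _ _ `|a|).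
have iS := sqintegrable_integrable sS.
have ES : \int[P]_w (c * \sum_n Z n w) = b.
  rewrite RintegralZl//; last exact/sqintegrable_integrable/sqintegrable_sum.
  rewrite Rintegral_sum; last by move=> n; exact: sqintegrable_integrable.
  rewrite (eq_bigr (fun=> b))// sumr_const card_ord -[_ *+ M]mulr_natl.
  by rewrite mulrA [c * _]mulrC Mc mul1r.
(* M diagonal terms v and M (M - 1) cross terms b^2, divided by M^2. *)
have ES2 : \int[P]_w (c * \sum_n Z n w) ^+ 2 = c * v + (1 - c) * b ^+ 2.
  rewrite (eq_Rintegral P (g := fun w => c ^+ 2 * \sum_n \sum_n' (Z n w * Z n' w))); last first.
    move=> w _; rewrite exprMn; congr (_ * _); rewrite expr2 mulr_suml.
    by apply: eq_bigr => n _; rewrite mulr_sumr.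
  have iZ n n' : P.-integrable setT (EFin \o (fun w => Z n w * Z n' w)).
    exact: sqintegrableM_integrable.
  have iZ2 n : P.-integrable setT (EFin \o (fun w => \sum_n' Z n w * Z n' w)).
    rewrite (_ : _ \o _ = fun w => (\sum_n' (Z n w * Z n' w)%:E)%E); last first.
      by apply/funext => w /=; rewrite sumEFin.
    by apply: integrable_sum => // n' _; exact: iZ.
  rewrite RintegralZl//; last first.
    rewrite (_ : _ \o _ = fun w => (\sum_n (\sum_n' Z n w * Z n' w)%:E)%E); last first.
      by apply/funext => w /=; rewrite sumEFin.
    by apply: integrable_sum => // n _; exact: iZ2.
  rewrite Rintegral_sum//.
  rewrite (eq_bigr (fun=> v + (M%:R - 1) * b ^+ 2)); last first.
    move=> n _; rewrite Rintegral_sum// (bigD1 n)//=; congr (_ + _).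
      by rewrite -(EZ2 n); apply: eq_Rintegral => w _; rewrite expr2.
    rewrite (eq_bigr (fun=> b ^+ 2)); last by move=> n' n'n; rewrite EZZ// eq_sym.
    rewrite sumr_const cardC1 card_ord -[_ *+ _.-1]mulr_natl; congr (_ * _).
    by rewrite -subn1 natrB.
  rewrite sumr_const card_ord -[_ *+ M]mulr_natl expr2.
  have -> : c * c * (M%:R * (v + (M%:R - 1) * b ^+ 2)) =
    (M%:R * c) * (c * v + ((M%:R * c) - c) * b ^+ 2) by ring.
  by rewrite Mc mul1r.
rewrite Rintegral_sqrB// ES2 (RintegralZr _ _ iS)// ES Rintegral_cst//.
rewrite (_ : fine _ = 1); last exact: (congr1 fine (@probability_setT _ _ _ P)).
(* The exact value is the bound minus c b^2. *)
have := mulr_ge0 c0 (sqr_ge0 b); nra.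
Qed.

(** * The regression functional *)

Lemma trunc_bound (R : realType) (L z : R) : 0 <= L -> `|trunc L z| <= L.
Proof.
move=> L0; rewrite /trunc ler_norml le_max lexx /= ge_max ge_min lexx orbT andbT.
lra.
Qed.

Lemma trunc_id (R : realType) (L z : R) : `|z| <= L -> trunc L z = z.
Proof. by rewrite ler_norml => /andP[h1 h2]; rewrite /trunc min_l// max_r. Qed.

Lemma max_contract (R : realDomainType) (a z z' : R) :
  `|Num.max a z - Num.max a z'| <= `|z - z'|.
Proof.
have h1 := ler_norm (z - z'); have h2 := ler_norm (z' - z).
rewrite distrC in h2; rewrite ler_norml.
by case: (leP a z) => ?; case: (leP a z') => ?; lra.
Qed.

Lemma min_contract (R : realDomainType) (a z z' : R) :
  `|Num.min z a - Num.min z' a| <= `|z - z'|.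
Proof.
have h1 := ler_norm (z - z'); have h2 := ler_norm (z' - z).
rewrite distrC in h2; rewrite ler_norml.
by case: (leP z a) => ?; case: (leP z' a) => ?; lra.
Qed.

Lemma trunc_contract (R : realType) (L z z' : R) :
  `|trunc L z - trunc L z'| <= `|z - z'|.
Proof. exact: le_trans (max_contract _ _ _) (min_contract _ _ _). Qed.

Lemma measurable_jbracketV (R : realType) n p :
  measurable_fun setT (fun x : n.-tuple R => (jbracket p x)^-1).
Proof.
rewrite (_ : (fun _ => _) = @jbracket R n (- p)); first exact: measurable_jbracket.
by apply/funext => x; rewrite /jbracket powRN.
Qed.

Section path_functional.
Context (R : realType) (d dW : nat) (m : model R d dW).
Hypothesis H1 : growth_assumption m.
Hypothesis H2 : coefficient_assumption m.
Hypothesis T_gt0 : 0 < mT m.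
Context dO (Omega : measurableType dO) (P : probability Omega R).
Context (W : R -> Omega -> dW.-tuple R).
Hypothesis BM : standard_brownian P W.
Variable N : nat.
Hypothesis N0 : (0 < N)%N.
Local Notation V := (d.-tuple R).
Local Notation brq := (jbracket (mq m / 2)).
Local Notation L := (Lstar m P W N).

Lemma measurable_trunc_comp dE (E : measurableType dE) (l z : E -> R) :
  measurable_fun setT l -> measurable_fun setT z ->
  measurable_fun setT (fun e => trunc (l e) (z e)).
Proof.
move=> ml mz; apply: measurable_maxr; first exact: measurableT_comp.
exact: measurable_minr.
Qed.

Lemma measurable_damped (v : V -> R) : measurable_fun setT v ->
  measurable_fun setT (damped m v).
Proof.
move=> mv; apply: measurable_funM => //.
exact: measurable_jbracketV.
Qed.

Lemma measurable_SqM dE (E : measurableType dE) (v : E -> nat -> V -> R)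
    (x : E -> nat -> V) i : (i <= N)%N ->
  (forall j, (i <= j <= N)%N -> measurable_fun setT (fun e => x e j)) ->
  (forall j, (i <= j < N)%N -> measurable_fun setT (fun e => v e j.+1 (x e j.+1))) ->
  measurable_fun setT (fun e => SqM m P W N (v e) i (x e)).
Proof.
move=> iN mx mv; have [_ mg_m _ _] := H1.
have mxi : measurable_fun setT (fun e => x e i) by apply: mx; rewrite leqnn.
have miq : measurable_fun setT (fun e => (brq (x e i))^-1).
  exact: measurableT_comp (measurable_jbracketV _) mxi.
apply: measurable_funD.
  apply: measurable_funM => //; apply: measurableT_comp mg_m _.
  by apply: mx; rewrite iN/=.
apply: measurable_sum_nat => j ijN; have /andP[ij jN] := ijN.
have mxS : measurable_fun setT (fun e => x e j.+1) by apply: mx; rewrite jN ltnW.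
apply: measurable_funM => //; apply: measurable_funM => //.
apply: measurable_mf => //; first by apply: mx; rewrite ij ltnW.
apply: measurable_trunc_comp.
  exact: measurableT_comp (measurable_Lstar _ _ _ _) mxS.
apply: measurable_funM; first exact: mv.
exact: measurableT_comp (measurable_jbracket _) mxS.
Qed.

Lemma eq_SqM (v v' : nat -> V -> R) (x x' : nat -> V) i : (i <= N)%N ->
  (forall j, (i < j <= N)%N -> v j = v' j) ->
  (forall j, (i <= j <= N)%N -> x j = x' j) ->
  SqM m P W N v i x = SqM m P W N v' i x'.
Proof.
move=> iN vv' xx'; have xN : x N = x' N by apply: xx'; rewrite iN leqnn.
have xi : x i = x' i by apply: xx'; rewrite leqnn iN.
rewrite /SqM xN xi; apply: (congr1 (fun s => _ + s)); apply: eq_big_nat => j /andP[ij jN].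
have xj : x j = x' j by apply: xx'; rewrite ij ltnW.
have xj1 : x j.+1 = x' j.+1 by apply: xx'; rewrite leqW.
by rewrite xj xj1 vv'// ltnS ij.
Qed.

(** Each ingredient is at most [Lstar]: g, T times f at zero (whence the factor 1 / T), and the
    truncated value. The bound is independent of v, which is what truncation buys. *)
Lemma SqM_bound v i x : (i <= N)%N ->
  `|SqM m P W N v i x| <= L (x N) / brq (x i) + \sum_(i <= j < N)
    ((mT m)^-1 * (L (x j) / brq (x i)) + mLf m * (L (x j.+1) / brq (x i))) * step m N.
Proof.
move=> iN; have [[Cg0 _ Lf0 Cf0 _] _ _ _] := H1.
have b0 : 0 <= (brq (x i))^-1 by rewrite invr_ge0 ltW// jbracket_gt0.
have st := step_ge0 T_gt0 N.
apply: le_trans (ler_normD _ _) _; apply: lerD.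
  rewrite normrM (ger0_norm b0) ler_wpM2r//; apply: le_trans (mg_bound H1 _) _.
  by apply: (br_le_Lstar H1 H2) => //; rewrite lerDl mulr_ge0// ltW.
apply: le_trans (ler_norm_sum _ _ _) _; rewrite big_nat_cond [leRHS]big_nat_cond.
apply: ler_sum => j /andP[/andP[ij jN] _].
rewrite normrM (ger0_norm st) ler_wpM2r// normrM (ger0_norm b0).
rewrite [_ * (L (x j) / _)]mulrA [_ * (L (x j.+1) / _)]mulrA -mulrDl ler_wpM2r//.
apply: le_trans (mf_bound H1 _ _ N0 jN) _.
apply: lerD; last by rewrite ler_wpM2l// trunc_bound// (Lstar_ge0 H1 H2).
rewrite [leRHS]mulrC ler_pdivlMr// mulrAC.
by apply: (br_le_Lstar H1 H2) => //; rewrite 1?mulrC ?lerDr// mulr_ge0// ltW.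
Qed.

Variable y : nat -> V -> R.
Hypothesis Hy : exact_solution m P W N y.

(** By the a priori bound the truncation does not act on the exact solution; both functionals thus
    become values of [SqM]. *)
Lemma SqE i x : Sq m N y i x = SqM m P W N (fun j => damped m (y j)) i x.
Proof.
congr (_ + _); apply: eq_big_nat => j /andP[ij jN].
rewrite trunc_id// /damped divfK ?jbracket_neq0//.
exact: (exact_solution_le_Lstar H1 H2 T_gt0 BM N0 Hy).
Qed.

(** Lipschitz continuity of f, contraction by truncation, then Cauchy-Schwarz over N - i terms: one
    factor Delta combines with N - i into T, the other remains for Gronwall. *)
Lemma SqMB_bound v v' i x : (i <= N)%N ->
  (SqM m P W N v i x - SqM m P W N v' i x) ^+ 2 <=
  mT m * mLf m ^+ 2 * step m N * \sum_(i <= j < N)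
    ((v j.+1 (x j.+1) - v' j.+1 (x j.+1)) * brq (x j.+1) / brq (x i)) ^+ 2.
Proof.
move=> iN; have [[_ _ Lf0 _ _] _ _ Hf] := H1.
have b0 : 0 <= (brq (x i))^-1 by rewrite invr_ge0 ltW// jbracket_gt0.
have st := step_ge0 T_gt0 N.
set D := fun j => (v j.+1 (x j.+1) - v' j.+1 (x j.+1)) * brq (x j.+1) / brq (x i).
have H : `|SqM m P W N v i x - SqM m P W N v' i x| <=
    mLf m * step m N * \sum_(i <= j < N) `|D j|.
  rewrite /SqM opprD addrACA subrr add0r -sumrB mulr_sumr.
  apply: le_trans (ler_norm_sum _ _ _) _; rewrite big_nat_cond [leRHS]big_nat_cond.
  apply: ler_sum => j /andP[/andP[ij jN] _].
  have [_ Lip _] := Hf N j N0 jN.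
  rewrite -!mulrBl normrM (ger0_norm st) normrM (ger0_norm b0) !normrM.
  rewrite (ger0_norm b0).
  rewrite [leRHS](_ : _ = mLf m * (`|v j.+1 (x j.+1) - v' j.+1 (x j.+1)| *
    `|brq (x j.+1)|) / brq (x i) * step m N); last by ring.
  rewrite ler_wpM2r// ler_wpM2r//; apply: le_trans (Lip _ _ _) _.
  rewrite ler_wpM2l// -normrM mulrBl; exact: trunc_contract.
have S0 : 0 <= \sum_(i <= j < N) D j ^+ 2 by apply: sumr_ge0 => j _; exact: sqr_ge0.
apply: (@le_trans _ _ ((mLf m * step m N * \sum_(i <= j < N) `|D j|) ^+ 2)).
  by rewrite -real_normK ?num_real// lerXn2r// nnegrE ?(le_trans _ H).
have H' := sqr_sum_nat_le (fun j => `|D j|) i N.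
have DE : \sum_(i <= j < N) `|D j| ^+ 2 = \sum_(i <= j < N) D j ^+ 2.
  by apply: eq_bigr => j _; rewrite real_normK ?num_real.
rewrite DE in H'.
rewrite exprMn exprMn; apply: le_trans (ler_wpM2l _ H') _; first by rewrite mulr_ge0 ?sqr_ge0.
rewrite mulrA ler_wpM2r//.
have : (N - i)%:R * step m N <= mT m.
  by rewrite -(step_sumT m N0) ler_wpM2r// ler_nat leq_subr.
move=> /(ler_wpM2l (mulr_ge0 (sqr_ge0 (mLf m)) st)); nra.
Qed.

End path_functional.

(** * One regression step *)

(** Undoes [segment] at absolute times from i to N; outside this range truncated subtraction and the
    default of [inord] give the starting point. *)
Definition unsegment (R : realType) d (N i : nat) (s : (N - i).+1.-tuple (d.-tuple R))
  (j : nat) : d.-tuple R := tnth s (inord (j - i)).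

Lemma segmentK (R : realType) d N i (x : nat -> d.-tuple R) j : (i <= j <= N)%N ->
  unsegment (segment N i x) j = x j.
Proof.
move=> /andP[ij jN]; rewrite /unsegment tnth_mktuple inordK ?subnKC//.
by rewrite ltnS leq_sub2r.
Qed.

Lemma phi_le_sup (R : realType) d dW (m : model R d dW) k x :
  `|phi m k x| <= sup [set `|phi m k x| | x in setT].
Proof.
apply: ub_le_sup; last by exists x.
by exists (Num.sqrt 2 ^+ d) => _ [z _ <-]; exact: phi_bound.
Qed.

Section one_step.
Context (R : realType) (d dW : nat) (m : model R d dW).
Hypothesis H1 : growth_assumption m.
Hypothesis H2 : coefficient_assumption m.
Hypothesis H3 : density_assumption m.
Hypothesis T_gt0 : 0 < mT m.
Local Notation V := (d.-tuple R).
Local Notation brq := (jbracket (mq m / 2)).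
Variable Q : probability V R.
Hypothesis QE : forall A, measurable A ->
  Q A = (\int[lebesgue_tuple R d]_(x in A) (nu m x)%:E)%E.
Context dO (Omega : measurableType dO) (P : probability Omega R).
Context (W : R -> Omega -> dW.-tuple R).
Hypothesis BM : standard_brownian P W.
Variable N : nat.
Hypothesis N0 : (0 < N)%N.
Local Notation L := (Lstar m P W N).
Hypothesis HL : in_L2nu m (damped m L).
Variables (i : nat) (xi : Omega -> V).
Hypothesis iN : (i < N)%N.
Hypothesis Hxi : initial_condition m P W N i xi.
Variable c_nu : R.
Local Notation X := (pathX m W N i xi).
Hypothesis Hst : forall j gamma, (i <= j <= N)%N -> in_L2nu m gamma ->
  ('E_P[fun w => (`|gamma (X j w)| ^+ 2 * jbracket (mq m) (X j w)
                  / jbracket (mq m) (X i w))%R]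
   <= c_nu%:E * 'E_P[fun w => (`|gamma (X i w)| ^+ 2)%R])%E.
Variable y : nat -> V -> R.
Hypothesis Hy : exact_solution m P W N y.

Let mxi : measurable_fun setT xi. Proof. by have [[]] := Hxi. Qed.

Let xi_law A : measurable A -> Q A = P (xi @^-1` A).
Proof. by have [[_ h] _] := Hxi; move=> mA; rewrite h// QE. Qed.

Let X_start w : X i w = xi w. Proof. exact: euler_start. Qed.

Let mX j : (j <= N)%N -> measurable_fun setT (X j).
Proof.
move=> jN; apply: (measurable_euler H2 T_gt0 (u := id)) => // j' _.
by apply: (measurable_incr BM); exact: grid_ge0.
Qed.

Let integral_xi (f : V -> R) : measurable_fun setT f ->
  (\int[Q]_x (f x)%:E = \int[P]_w (f (xi w))%:E)%E.
Proof.
by move=> mf; apply: (integral_image mxi xi_law (f := fun x => (f x)%:E)); exact/measurable_EFinP.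
Qed.

Let sqintegrable_xi f : sqintegrable Q f -> sqintegrable P (f \o xi).
Proof.
move=> [mf sf]; split; first exact: measurableT_comp.
by rewrite -(integral_xi (f := fun x => f x ^+ 2))//; exact: measurable_funX.
Qed.

Let phi_xi_sq k : sqintegrable P (phi m k \o xi).
Proof. exact/sqintegrable_xi/phi_sqintegrable. Qed.

Let phi_xi_on j k : \int[P]_w ((phi m j \o xi) w * (phi m k \o xi) w) = (j == k)%:R.
Proof.
rewrite -(phi_orthonormal H3 QE j k) /Rintegral (integral_xi (f := fun x => phi m j x * phi m k x))//.
by apply: measurable_funM; exact: measurable_phi.
Qed.

(** The stability assumption with the weights moved inside the square, the form in which differences
    of [SqM] produce them. *)
Lemma weighted_stability gamma j : (i <= j <= N)%N -> in_L2nu m gamma ->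
  sqintegrable P (fun w => gamma (X j w) * brq (X j w) / brq (xi w)) /\
  (\int[P]_w ((gamma (X j w) * brq (X j w) / brq (xi w)) ^+ 2)%:E
   <= c_nu%:E * sqnorm_nu m gamma)%E.
Proof.
move=> ijN Lg; have /andP[_ jN] := ijN.
have [mg sg] := (in_L2nuE H3 QE _).1 Lg.
have H := Hst ijN Lg; rewrite !expectationE in H.
have E1 : (\int[P]_w (`|gamma (X i w)| ^+ 2)%:E)%E = sqnorm_nu m gamma.
  rewrite (sqnorm_nuE H3 QE)// (integral_xi (f := fun x => gamma x ^+ 2)); last exact: measurable_funX.
  by apply: eq_integral => w _; rewrite X_start real_normK ?num_real.
have E2 : (\int[P]_w (`|gamma (X j w)| ^+ 2 * jbracket (mq m) (X j w)
                  / jbracket (mq m) (X i w))%:E =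
   \int[P]_w ((gamma (X j w) * brq (X j w) / brq (xi w)) ^+ 2)%:E)%E.
  apply: eq_integral => w _.
  by rewrite X_start real_normK ?num_real// exprMn exprMn exprVn !jbracket_sqr.
rewrite E1 E2 in H; split => //; split.
  apply: measurable_funM; first apply: measurable_funM.
  - exact: measurableT_comp mg (mX jN).
  - exact: measurableT_comp (measurable_jbracket _) (mX jN).
  - exact: measurableT_comp (measurable_jbracketV _) mxi.
apply: le_lt_trans H _; rewrite (sqnorm_nuE H3 QE)// -(EFin_Rintegral_sqr (conj mg sg)).
by rewrite -EFinM ltry.
Qed.

Let S v w := SqM m P W N v i (fun j => X j w).

(** Stability for the damped [Lstar] makes every term of [SqM_bound] square integrable. *)
Lemma sqintegrable_S v : (forall j, (i < j <= N)%N -> measurable_fun setT (v j)) ->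
  sqintegrable P (S v).
Proof.
move=> mv.
have sZ j : (i <= j <= N)%N -> sqintegrable P (fun w => L (X j w) / brq (xi w)).
  move=> ijN; have [h _] := weighted_stability ijN HL.
  rewrite (_ : (fun _ => _) = (fun w => damped m L (X j w) * brq (X j w) / brq (xi w)))//.
  by apply/funext => w; rewrite /damped divfK ?jbracket_neq0.
apply: (@sqintegrable_le _ _ _ _ _ (fun w => L (X N w) / brq (xi w) + \sum_(i <= j < N)
    ((mT m)^-1 * (L (X j w) / brq (xi w)) + mLf m * (L (X j.+1 w) / brq (xi w))) * step m N)).
- apply: (measurable_SqM H1 P W N0 (v := fun=> v) (x := fun w j => X j w) (ltnW iN)).
  + by move=> j /andP[_ jN]; exact: mX.
  + move=> j /andP[ij jN]; apply: measurableT_comp (mX jN).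
    by apply: mv; rewrite ltnS ij.
- move=> w; rewrite -(X_start w); apply: (le_trans _ (ler_norm _)).
  exact: (SqM_bound H1 H2 T_gt0 BM N0 v (fun j => X j w) (ltnW iN)).
- apply: sqintegrableD; first by apply: sZ; rewrite leqnn ltnW.
  apply: sqintegrable_sum_nat => j /andP[ij jN].
  rewrite (_ : (fun _ => _) = (fun w => step m N * ((mT m)^-1 * (L (X j w) / brq (xi w))
     + mLf m * (L (X j.+1 w) / brq (xi w))))); last by apply/funext => w; rewrite mulrC.
  apply: sqintegrableZ; apply: sqintegrableD; apply: sqintegrableZ; apply: sZ.
    by rewrite ij ltnW.
  by rewrite jN leqW.
Qed.

Lemma damped_y_sq j : (j <= N)%N -> sqintegrable Q (damped m (y j)).
Proof.
move=> jN; have my := exact_solution_measurable H1 H2 T_gt0 BM N0 Hy jN.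
apply: sqintegrable_le ((in_L2nuE H3 QE _).1 HL); first exact: measurable_damped.
move=> x; have b0 : 0 <= (brq x)^-1 by rewrite invr_ge0 ltW// jbracket_gt0.
rewrite /damped normrM [leRHS]normrM (ger0_norm b0) ler_wpM2r//; apply: (le_trans _ (ler_norm _)).
exact: (exact_solution_le_Lstar H1 H2 T_gt0 BM N0 Hy).
Qed.

Lemma alpha_regression k : alpha m y i k = \int[Q]_x (damped m (y i) x * phi m k x).
Proof.
have [my _] := damped_y_sq (ltnW iN).
rewrite /alpha /Rintegral (integral_density (measurable_nu H3) (nu_ge0 H3) QE)//.
by apply: measurable_funM => //; exact: measurable_phi.
Qed.

Lemma Sq_payoff w : Sq m N y i (fun j => X j w) = payoff m W N y i (xi w) w / brq (xi w).
Proof.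
rewrite /Sq /payoff X_start mulrDl mulr_suml; congr (_ + _).
apply: eq_bigr => j _; rewrite /damped divfK ?jbracket_neq0//; ring.
Qed.

Lemma measurable_payoff dE (E : measurableType dE) (x : E -> V) (u : E -> Omega) :
  measurable_fun setT x ->
  (forall j, (i <= j < N)%N ->
    measurable_fun setT (fun e => incr W (grid m N j) (grid m N j.+1) (u e))) ->
  measurable_fun setT (fun e => payoff m W N y i (x e) (u e)).
Proof.
move=> mx mu.
have me j : (j <= N)%N -> measurable_fun setT (fun e => euler m W N i (x e) j (u e)).
  by move=> jN; exact: measurable_euler.
apply: measurable_funD.
  by have [_ h _ _] := H1; apply: measurableT_comp h _; exact: me.
apply: measurable_sum_nat => j /andP[ij jN]; apply: measurable_funM => //.
apply: measurable_mf => //; first exact/me/ltnW.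
exact: measurableT_comp (exact_solution_measurable H1 H2 T_gt0 BM N0 Hy jN) (me _ _).
Qed.

(** The start is independent of the later increments: once it is frozen at x, the inner expectation
    of the payoff is y_i(x) by definition. *)
Lemma alphaE k : \int[P]_w (Sq m N y i (fun j => X j w) * phi m k (xi w)) = alpha m y i k.
Proof.
have mphi := measurable_phi H3 k.
have [my _] := damped_y_sq (ltnW iN).
have sSq : sqintegrable P (fun w => Sq m N y i (fun j => X j w)).
  under eq_fun do rewrite (SqE H1 H2 T_gt0 BM N0 Hy).
  by apply: sqintegrable_S => j /andP[_ jN]; have [] := damped_y_sq jN.
pose G := future_gen W (grid m N i).
have Gm : G `<=` measurable.
  move=> _ [s [t [B [sg st mB ->]]]]; rewrite -[X in measurable X]setTI.
  have s0 : 0 <= s := le_trans (grid_ge0 T_gt0 N i) sg.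
  exact: (measurable_incr BM s0 (le_trans s0 st)).
(* Omega with the sigma-algebra of the increments after t_i; the identity into it is the variable
   independent of [xi]. *)
pose E2 := g_sigma_algebraType G.
have mid : measurable_fun setT (id : Omega -> E2).
  move=> _ A sA; rewrite setTI preimage_id; move: A sA.
  by apply: smallest_sub => //; exact: sigma_algebra_measurable.
pose H (z : V * E2) : \bar R := (payoff m W N y i z.1 z.2 / brq z.1 * phi m k z.1)%:E.
have mH : measurable_fun setT H.
  apply/measurable_EFinP; apply: measurable_funM.
    apply: measurable_funM.
      apply: (@measurable_payoff _ (V * E2)%type fst snd) => // j /andP[ij jN].
      apply: (measurableT_comp _ (@measurable_snd _ _ V E2)) => //.
      move=> _ B mB; rewrite setTI; apply: sub_gen_smallest.
      exists (grid m N j), (grid m N j.+1), B; split => //; exact: le_grid.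
    exact: measurableT_comp (measurable_jbracketV _) _.
  exact: measurableT_comp mphi _.
rewrite alpha_regression /Rintegral (integral_xi (f := fun x => damped m (y i) x * phi m k x)); last first.
  exact: measurable_funM.
congr fine; transitivity (\int[P]_w H (xi w, w))%E.
  by apply: eq_integral => w _; rewrite Sq_payoff.
rewrite (@integral_decoupling _ _ _ P _ V _ E2 xi id mxi mid _ H mH).
- apply: eq_integral => w _; set x := xi w.
  have ip := exact_solution_integrable H1 H2 T_gt0 BM N0 Hy x iN.
  transitivity (\int[P]_w' (payoff m W N y i x w' * (phi m k x / brq x))%:E)%E.
    by apply: eq_integral => w' _; rewrite /H /= mulrAC mulrA.
  under eq_integral do rewrite EFinM.
  rewrite integralZr//.
  have [_ yi] := Hy; rewrite -EFin_Rintegral// /damped yi// expectationE -/(Rintegral _ _ _).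
  by rewrite -EFinM; congr EFin; rewrite mulrA mulrAC.
- by have [_] := Hxi; move=> h A B mA sB; exact: h.
- have := sqintegrableM_integrable sSq (phi_xi_sq k); apply: eq_integrable => // w _ /=.
  by rewrite Sq_payoff.
Qed.

Let yd j := damped m (y j).

Lemma S_stability v : (forall j, (i < j <= N)%N -> in_L2nu m (v j)) ->
  \int[P]_w (S v w - S yd w) ^+ 2 <=
  mT m * mLf m ^+ 2 * step m N *
  \sum_(i <= j < N) (c_nu * \int[Q]_x (v j.+1 x - yd j.+1 x) ^+ 2).
Proof.
move=> Lv.
pose D j w := (v j.+1 (X j.+1 w) - yd j.+1 (X j.+1 w)) * brq (X j.+1 w) / brq (xi w).
have sB j : (i <= j < N)%N -> sqintegrable Q (fun x => v j.+1 x - yd j.+1 x).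
  move=> /andP[ij jN]; apply: sqintegrableB; last exact: damped_y_sq.
  by apply: ((in_L2nuE H3 QE _).1 (Lv _ _)); rewrite ltnS ij.
have HD j : (i <= j < N)%N -> sqintegrable P (D j) /\
    \int[P]_w D j w ^+ 2 <= c_nu * \int[Q]_x (v j.+1 x - yd j.+1 x) ^+ 2.
  move=> ijN; have /andP[ij jN] := ijN.
  have ij1 : (i <= j.+1 <= N)%N by rewrite jN leqW.
  have [h1 h2] := weighted_stability ij1 ((in_L2nuE H3 QE _).2 (sB j ijN)).
  split => //; move: h2; rewrite -(EFin_Rintegral_sqr h1).
  rewrite (sqnorm_nuE H3 QE); last by have [] := sB j ijN.
  by rewrite -(EFin_Rintegral_sqr (sB j ijN)) -EFinM lee_fin.
have iD2 j : (i <= j < N)%N -> P.-integrable setT (EFin \o (fun w => D j w ^+ 2)).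
  by move=> /HD[h _]; exact: sqintegrable_integrable_sqr.
have iS := integrable_sum_nat iD2.
have mS : sqintegrable P (fun w => S v w - S yd w).
  apply: sqintegrableB; apply: sqintegrable_S => j ijN; first by have [] := Lv j ijN.
  by have /andP[_ /damped_y_sq[]] := ijN.
set K := mT m * mLf m ^+ 2 * step m N.
have K0 : 0 <= K.
  by apply: mulr_ge0; [rewrite mulr_ge0 ?sqr_ge0// ltW|exact: step_ge0].
apply: (@le_trans _ _ (\int[P]_w (K * \sum_(i <= j < N) D j w ^+ 2))).
  apply: le_Rintegral => //.
  - exact: sqintegrable_integrable_sqr.
  - by have := integrableZl measurableT K iS; apply: eq_integrable.
  move=> w _; rewrite /D -(X_start w).
  exact: (SqMB_bound H1 T_gt0 P W N0 v yd (fun j => X j w) (ltnW iN)).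
rewrite RintegralZl// Rintegral_sum_nat// ler_wpM2l//.
rewrite big_nat_cond [leRHS]big_nat_cond; apply: ler_sum => j /andP[ijN _].
by have [] := HD j ijN.
Qed.

(** By [alphaE] the biases are the coefficients of S v - S yd along the phi_k(xi), orthonormal in
    L^2(P); Bessel bounds their sum with no factor depending on the size of G. *)
Lemma bias_bessel v (G : {fset d.-tuple nat}) :
  (forall j, (i < j <= N)%N -> measurable_fun setT (v j)) ->
  \sum_(k <- G) (\int[P]_w (S v w * phi m k (xi w)) - alpha m y i k) ^+ 2 <=
  \int[P]_w (S v w - S yd w) ^+ 2.
Proof.
move=> mv; have sS := sqintegrable_S mv.
have sSy : sqintegrable P (S yd).
  by apply: sqintegrable_S => j /andP[_ /damped_y_sq[]].
have := bessel phi_xi_sq phi_xi_on G (sqintegrableB sS sSy).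
congr (_ <= _); apply: eq_bigr => k _; congr (_ ^+ 2).
rewrite -alphaE (eq_Rintegral P (g := fun w => S v w * phi m k (xi w) - S yd w * phi m k (xi w))); last first.
  by move=> w _; rewrite mulrBl.
rewrite RintegralB//; [|exact: sqintegrableM_integrable sS (phi_xi_sq k)
  |exact: sqintegrableM_integrable sSy (phi_xi_sq k)].
congr (_ - _); apply: eq_Rintegral => w _.
by rewrite (SqE H1 H2 T_gt0 BM N0 Hy).
Qed.

Section regression.
Variables (M : nat) (cl : 'I_M -> nat -> Omega -> V).
Hypothesis M0 : (0 < M)%N.
Let seg n w := segment N i (fun j => cl n j w).
Let segX w := segment N i (fun j => X j w).
Hypothesis mseg : forall n, measurable_fun setT (seg n).
Hypothesis seg_law : forall n B, measurable B -> P (seg n @^-1` B) = P (segX @^-1` B).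
Hypothesis seg_indep : forall n n' A B, n != n' -> measurable A -> measurable B ->
  P (seg n @^-1` A `&` seg n' @^-1` B) = (P (seg n @^-1` A) * P (seg n' @^-1` B))%E.
Variable v : nat -> V -> R.
Hypothesis Lv : forall j, (i < j <= N)%N -> in_L2nu m (v j).

(** The regression sample as a function of a finite segment, the object whose law and independence
    are prescribed for the clouds. *)
Let h k (s : (N - i).+1.-tuple V) :=
  SqM m P W N v i (unsegment s) * phi m k (unsegment s i).

Let mh k : measurable_fun setT (h k).
Proof.
have mu j : measurable_fun setT (fun s : (N - i).+1.-tuple V => unsegment s j).
  exact: measurable_tnth.
apply: measurable_funM; last exact: measurableT_comp (measurable_phi H3 k) (mu i).
apply: (measurable_SqM H1 P W N0 (v := fun=> v) (x := @unsegment R d N i) (ltnW iN)) => // j /andP[ij jN].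
by apply: measurableT_comp (mu j.+1); have [] := Lv (j := j.+1); rewrite ?ltnS ?ij.
Qed.

Let hE k (x : nat -> V) : h k (segment N i x) = SqM m P W N v i x * phi m k (x i).
Proof.
have e : SqM m P W N v i (unsegment (segment N i x)) = SqM m P W N v i x.
  by apply: eq_SqM => //; [exact: ltnW|move=> j; exact: segmentK].
by rewrite /h e segmentK// leqnn ltnW.
Qed.

Let msegX : measurable_fun setT segX.
Proof.
apply/measurable_fun_tnthP => j.
rewrite (_ : _ \o _ = X (i + j)%N); last by apply/funext => w /=; rewrite tnth_mktuple.
by apply: mX; have := ltn_ord j; rewrite ltnS leq_subRL// ltnW.
Qed.

Let integral_seg n (f : (N - i).+1.-tuple V -> R) : measurable_fun setT f ->
  (\int[P]_w (f (seg n w))%:E = \int[P]_w (f (segX w))%:E)%E.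
Proof.
move=> mf; have [Qn QnE] := law_exists P (mseg n).
have mEf : measurable_fun setT (fun s => (f s)%:E) by exact/measurable_EFinP.
rewrite -(integral_image (mseg n) QnE mEf).
apply: (@integral_image _ _ _ _ _ P Qn segX (fun s => (f s)%:E)) => // A mA.
exact: etrans (QnE A mA) (seg_law n mA).
Qed.

Let Rintegral_seg n (f : (N - i).+1.-tuple V -> R) : measurable_fun setT f ->
  \int[P]_w f (seg n w) = \int[P]_w f (segX w).
Proof. by move=> mf; rewrite /Rintegral integral_seg. Qed.

Let sS : sqintegrable P (S v).
Proof. by apply: sqintegrable_S => j /Lv[]. Qed.

Let sSphi k : sqintegrable P (fun w => S v w * phi m k (xi w)).
Proof.
apply: (sqintegrableM_bounded (c := Num.sqrt 2 ^+ d)) => //.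
  exact: measurableT_comp (measurable_phi H3 k) mxi.
by move=> w; exact: phi_bound.
Qed.

Let hX k w : h k (segX w) = S v w * phi m k (xi w).
Proof. by rewrite /segX hE X_start. Qed.

Let sh k n : sqintegrable P (fun w => h k (seg n w)).
Proof.
split; first exact: measurableT_comp (mh k) (mseg n).
rewrite (@integral_seg n (fun s => h k s ^+ 2)); last exact: measurable_funX.
by under eq_integral do rewrite hX; have [] := sSphi k.
Qed.

Lemma coefficient_error k :
  \int[P]_w (M%:R^-1 * \sum_n SqM m P W N v i (fun j => cl n j w) * phi m k (cl n i w)
    - alpha m y i k) ^+ 2 <=
  M%:R^-1 * \int[P]_w (S v w * phi m k (xi w)) ^+ 2
  + (\int[P]_w (S v w * phi m k (xi w)) - alpha m y i k) ^+ 2.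
Proof.
rewrite (eq_Rintegral P (g := fun w => (M%:R^-1 * \sum_n h k (seg n w) - alpha m y i k) ^+ 2)); last first.
  by move=> w _; under [in RHS]eq_bigr do rewrite hE.
have Eh n : \int[P]_w h k (seg n w) = \int[P]_w (S v w * phi m k (xi w)).
  by rewrite (Rintegral_seg n (mh k)); apply: eq_Rintegral => w _; exact: hX.
apply: (@mean_sqr_error _ _ _ P M (fun n w => h k (seg n w)) (alpha m y i k)
  (\int[P]_w (S v w * phi m k (xi w))) (\int[P]_w (S v w * phi m k (xi w)) ^+ 2) M0 (sh k) Eh).
- move=> n; rewrite (@Rintegral_seg n (fun s => h k s ^+ 2)); last exact: measurable_funX.
  by apply: eq_Rintegral => w _; rewrite hX.
- move=> n n' nn'; rewrite expr2 -[in X in _ = X * _](Eh n) -(Eh n').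
  apply: (integral_indepM (mseg n) (mseg n') _ (mh k) (mh k)) => //; [|exact: sh|exact: sh].
  by move=> A B mA mB; exact: seg_indep.
Qed.

(** The error of one step with the later outputs frozen in v. [local_error] at i reads the family of
    starts at i only, hence the constant family. *)
Lemma regression_error (Gamma : {fset d.-tuple nat}) (kappa : R) :
  LGamma m Gamma / M%:R <= kappa ->
  (\int[P]_w sqnorm_nu m (fun x => (\sum_(k <- Gamma)
      (M%:R^-1 * \sum_n SqM m P W N v i (fun j => cl n j w) * phi m k (cl n i w)) * phi m k x)
      - damped m (y i) x)%R
   <= 2%:E * local_error m P W N M Gamma (fun=> xi) y i
      + ((1 + 2 * kappa) * (mT m * mLf m ^+ 2 * step m N * c_nu))%:E
        * \sum_(i <= j < N) sqnorm_nu m (fun x => v j.+1 x - damped m (y j.+1) x)%R)%E.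
Proof.
move=> Hkappa.
pose A k w := M%:R^-1 * \sum_n SqM m P W N v i (fun j => cl n j w) * phi m k (cl n i w).
have sA k : sqintegrable P (A k).
  rewrite (_ : A k = fun w => M%:R^-1 * \sum_n h k (seg n w)); last first.
    by apply/funext => w; rewrite /A; under [in RHS]eq_bigr do rewrite hE.
  by apply: sqintegrableZ; apply: sqintegrable_sum.
have sAa k : sqintegrable P (fun w => A k w - alpha m y i k).
  by apply: sqintegrableB => //; apply: (@sqintegrable_bounded _ _ _ _ _ `|alpha m y i k|).
have sy := damped_y_sq (ltnW iN).
pose tail := \int[Q]_x yd i x ^+ 2 - \sum_(k <- Gamma) alpha m y i k ^+ 2.
have sq w : sqnorm_nu m (fun x => \sum_(k <- Gamma) A k w * phi m k x - damped m (y i) x)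
    = (tail + \sum_(k <- Gamma) (A k w - alpha m y i k) ^+ 2)%:E.
  have sphi : sqintegrable Q (fun x => \sum_(k <- Gamma) A k w * phi m k x).
    by apply: sqintegrable_sum => k _; apply: sqintegrableZ; exact: phi_sqintegrable.
  have sd := sqintegrableB sphi sy.
  rewrite (sqnorm_nuE H3 QE); last by case: sd.
  rewrite -(EFin_Rintegral_sqr sd); congr EFin.
  rewrite (eq_Rintegral Q (g := fun x => (yd i x - \sum_(k <- Gamma) A k w * phi m k x) ^+ 2)); last first.
    by move=> x _; rewrite -sqrrN opprB.
  rewrite (orthonormal_decomp (phi_sqintegrable H3 Q) (phi_orthonormal H3 QE) Gamma (fun k => A k w) sy).
  rewrite /tail; congr (_ - _ + _); apply: eq_bigr => k _; by rewrite alpha_regression.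
have tail_le : (tail%:E <= \esum_(k in [set k | k \notin Gamma]) (alpha m y i k ^+ 2)%:E)%E.
  apply: (parseval_tail (phi_sqintegrable H3 Q) (phi_orthonormal H3 QE)).
    exact: phi_dense.
  by move=> k; exact: alpha_regression.
under eq_integral do rewrite sq.
have sSy : sqintegrable P (S yd).
  by apply: sqintegrable_S => j /andP[_ /damped_y_sq[]].
pose E2 := \int[P]_w S yd w ^+ 2.
pose D := \int[P]_w (S v w - S yd w) ^+ 2.
have lam0 : 0 <= LGamma m Gamma / M%:R.
  by apply: divr_ge0 => //; apply: sumr_ge0 => k _; exact: sqr_ge0.
have ES : \int[P]_w S v w ^+ 2 <= 2 * E2 + 2 * D.
  have := Rintegral_sqrB sS sSy; rewrite -/D -/E2.
  have i1 := sqintegrable_integrable_sqr (sqintegrableB sS (sqintegrableZ 2 sSy)).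
  (* With a = S v and s = S yd, the gap 2 s^2 + 2 (a - s)^2 - a^2 is the square (a - 2 s)^2. *)
  have : 0 <= \int[P]_w (S v w - 2 * S yd w) ^+ 2.
    by apply: Rintegral_ge0 => w _; exact: sqr_ge0.
  rewrite (Rintegral_sqrB sS (sqintegrableZ 2 sSy)).
  have -> : \int[P]_w (S v w * (2 * S yd w)) = 2 * \int[P]_w (S v w * S yd w).
    rewrite -RintegralZl//; last exact: sqintegrableM_integrable.
    by apply: eq_Rintegral => w _; rewrite mulrCA.
  have -> : \int[P]_w (2 * S yd w) ^+ 2 = 2 ^+ 2 * E2.
    rewrite -RintegralZl//; last exact: sqintegrable_integrable_sqr.
    by apply: eq_Rintegral => w _; rewrite exprMn.
  lra.
have HA : \sum_(k <- Gamma) \int[P]_w (A k w - alpha m y i k) ^+ 2 <=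
    2 * (LGamma m Gamma / M%:R * E2) + (1 + 2 * kappa) * D.
  apply: (@le_trans _ _ (LGamma m Gamma / M%:R * (\int[P]_w S v w ^+ 2) + D)).
    apply: (@le_trans _ _ (\sum_(k <- Gamma) (M%:R^-1 * \int[P]_w (S v w * phi m k (xi w)) ^+ 2
      + (\int[P]_w (S v w * phi m k (xi w)) - alpha m y i k) ^+ 2))).
      by apply: ler_sum => k _; exact: coefficient_error.
    rewrite big_split /=; apply: lerD; last by apply: bias_bessel => j /Lv[].
    rewrite /LGamma mulrAC [leRHS]mulrC -mulr_sumr ler_wpM2l ?invr_ge0//.
    rewrite mulr_suml; apply: ler_sum => k _.
    set s := sup _.
    rewrite -RintegralZl//; last exact: sqintegrable_integrable_sqr.
    apply: le_Rintegral => //.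
    - exact: sqintegrable_integrable_sqr.
    - by have := integrableZl measurableT (s ^+ 2) (sqintegrable_integrable_sqr sS); apply: eq_integrable.
    move=> w _; rewrite exprMn mulrC ler_wpM2r ?sqr_ge0// -real_normK ?num_real//.
    have ks := phi_le_sup m k (xi w).
    by rewrite lerXn2r// nnegrE (le_trans _ ks).
  have D0 : 0 <= D by apply: Rintegral_ge0 => w _; exact: sqr_ge0.
  have h1 := ler_wpM2l lam0 ES; have h2 := ler_wpM2r D0 Hkappa; lra.
have -> : (\int[P]_w (tail + \sum_(k <- Gamma) (A k w - alpha m y i k) ^+ 2)%:E =
    (tail + \sum_(k <- Gamma) \int[P]_w (A k w - alpha m y i k) ^+ 2)%:E)%E.
  have iA k : P.-integrable setT (EFin \o (fun w => (A k w - alpha m y i k) ^+ 2)).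
    exact: sqintegrable_integrable_sqr.
  have iSA : P.-integrable setT (EFin \o (fun w => \sum_(k <- Gamma) (A k w - alpha m y i k) ^+ 2)).
    rewrite (_ : _ \o _ = fun w => (\sum_(k <- Gamma) ((A k w - alpha m y i k) ^+ 2)%:E)%E).
      by apply: integrable_sum => // k _; exact: iA.
    by apply/funext => w /=; rewrite sumEFin.
  have ic : P.-integrable setT (EFin \o cst tail).
    exact/sqintegrable_integrable/(@sqintegrable_bounded _ _ _ _ _ `|tail|).
  rewrite -EFin_Rintegral; last by have := integrableD measurableT ic iSA.
  rewrite RintegralD// Rintegral_sum// Rintegral_cst//.
  by rewrite (_ : fine _ = 1) ?mulr1//; exact: (congr1 fine (@probability_setT _ _ _ P)).
rewrite /local_error expectationE.
have -> : (\int[P]_w (Sq m N y i (fun j => X j w) ^+ 2)%:E = E2%:E)%E.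
  rewrite EFin_Rintegral_sqr//; apply: eq_integral => w _.
  by rewrite (SqE H1 H2 T_gt0 BM N0 Hy).
have -> : (\sum_(i <= j < N) sqnorm_nu m (fun x => v j.+1 x - damped m (y j.+1) x)%R =
    (\sum_(i <= j < N) \int[Q]_x (v j.+1 x - yd j.+1 x) ^+ 2)%R%:E)%E.
  rewrite -sumEFin; apply: eq_big_nat => j /andP[ij jN].
  have s1 : sqintegrable Q (fun x => v j.+1 x - yd j.+1 x).
    apply: sqintegrableB; last exact: damped_y_sq.
    by apply: ((in_L2nuE H3 QE _).1 (Lv _)); rewrite ltnS ij.
  by rewrite EFin_Rintegral_sqr// (sqnorm_nuE H3 QE)//; case: s1.
have kap0 : 0 <= 1 + 2 * kappa by have := le_trans lam0 Hkappa; lra.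
have DE := ler_wpM2l kap0 (S_stability Lv); rewrite -/D in DE.
set e := esum _ _ in tail_le *.
have e0 : (0 <= e)%E by apply: esum_ge0 => k _; rewrite lee_fin sqr_ge0.
have E20 : 0 <= E2 by apply: Rintegral_ge0 => w _; exact: sqr_ge0.
rewrite ge0_muleDr//; last by rewrite -EFinM lee_fin mulr_ge0.
rewrite -!EFinM -addeA -EFinD [leLHS]EFinD; apply: leeD.
  (* The tail sum is an extended real; an infinite value makes the bound trivial. *)
  apply: le_trans tail_le _; case: e e0 => [r|_|//].
    by rewrite -EFinM !lee_fin => r0; lra.
  by rewrite gt0_muley ?leey// lte_fin.
rewrite lee_fin; apply: le_trans HA _; rewrite lerD2l.
apply: le_trans DE _; rewrite -mulr_sumr; lra.
Qed.

End regression.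
End one_step.

(** * Cylinder sigma-algebras *)

Section cylinders.
Context (R : realType) dO (Omega : measurableType dO) (P : probability Omega R).
Variables (I K : finType) (dT : I -> measure_display)
  (T : forall i, measurableType (dT i)).
Variable Y : forall i : I, K -> Omega -> T i.
Hypothesis mY : forall i k, measurable_fun setT (Y i k).
Hypothesis indepY : forall B : forall i, K -> set (T i),
  (forall i k, measurable (B i k)) ->
  P [set w | forall i k, B i k (Y i k w)] =
  (\prod_i \prod_k P [set w | B i k (Y i k w)])%E.

(** A pi-system generating the sigma-algebra of the [Y i k] selected by J. *)
Definition cylinder (J : I -> K -> bool) : set (set Omega) :=
  [set E | exists B : forall i, K -> set (T i),
     [/\ forall i k, measurable (B i k), forall i k, ~~ J i k -> B i k = setT &
         E = [set w | forall i k, B i k (Y i k w)]]].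

Lemma cylinder_measurable J : cylinder J `<=` measurable.
Proof.
move=> _ [B [mB _ ->]].
rewrite (_ : [set _ | _] = \bigcap_(i in [set: I]) \bigcap_(k in [set: K]) (Y i k @^-1` B i k)).
  apply: fin_bigcap_measurable => // i _; apply: fin_bigcap_measurable => // k _.
  by rewrite -[X in measurable X]setTI; exact: mY.
by apply/seteqP; split => w H i; [move=> _ k _; exact: H|move=> k; exact: (H i Logic.I k Logic.I)].
Qed.

Lemma cylinder_setT J : cylinder J setT.
Proof. by exists (fun i k => setT); split => //; apply/seteqP; split. Qed.

Lemma setI_closed_cylinder J : setI_closed (cylinder J).
Proof.
move=> _ _ [B [mB BT ->]] [B' [mB' BT' ->]].
exists (fun i k => B i k `&` B' i k); split.
- by move=> i k; exact: measurableI.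
- by move=> i k Jik; rewrite BT// BT'// setTI.
- apply/seteqP; split => w; first by move=> [H H'] i k; split; [exact: H|exact: H'].
  by move=> H; split => i k; have [] := H i k.
Qed.

(** The spaces depend on the index, so A is transported along the equality of indices. *)
Definition at_index i (A : set (T i)) (j : I) : set (T j) :=
  if i =P j is ReflectT e then ecast j (set (T j)) e A else setT.
Arguments at_index {i} A j _.

Lemma at_indexE i (A : set (T i)) : at_index A i = A.
Proof. by rewrite /at_index; case: eqP => // e; rewrite (eq_axiomK e). Qed.

Lemma measurable_at_index i (A : set (T i)) j : measurable A -> measurable (at_index A j).
Proof. by move=> mA; rewrite /at_index; case: eqP => // e; case: _ / e. Qed.

Lemma at_index_neq i (A : set (T i)) j : i != j -> at_index A j = setT.
Proof. by rewrite /at_index; case: eqP. Qed.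

Lemma cylinder_coordinate (J : I -> K -> bool) i k (A : set (T i)) :
  J i k -> measurable A -> cylinder J (Y i k @^-1` A).
Proof.
move=> Jik mA; exists (fun i' k' => if k' == k then at_index A i' else setT); split.
- by move=> i' k'; case: eqP => // _; exact: measurable_at_index.
- move=> i' k'; case: eqP => // -> nJ; rewrite at_index_neq//.
  by apply: contra nJ => /eqP <-.
- apply/seteqP; split => w /=.
    move=> H i' k'; case: eqP => // ->; have [e|ne] := eqVneq i i'.
      by case: _ / e; rewrite at_indexE.
    by rewrite at_index_neq.
  by move=> /(_ i k); rewrite eqxx at_indexE.
Qed.

Lemma measurable_coordinate (J : I -> K -> bool) i k : J i k ->
  measurable_fun setT (Y i k : g_sigma_algebraType (cylinder J) -> T i).
Proof.
move=> Jik _ A mA; rewrite setTI; apply: sub_gen_smallest.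
exact: cylinder_coordinate.
Qed.

Lemma measurable_cylinder_id J :
  measurable_fun setT (id : Omega -> g_sigma_algebraType (cylinder J)).
Proof.
move=> _ A sA; rewrite setTI preimage_id; move: A sA.
by apply: smallest_sub; [exact: sigma_algebra_measurable|exact: cylinder_measurable].
Qed.

(** At each coordinate at least one of the two sets is full, so the product formula for the
    intersection splits factor by factor. *)
Let indep_cylinder (J J' : I -> K -> bool) A A' :
  (forall i k, ~~ (J i k && J' i k)) -> cylinder J A -> cylinder J' A' ->
  P (A `&` A') = (P A * P A')%E.
Proof.
move=> JJ' [B [mB BT ->]] [B' [mB' BT' ->]].
rewrite (_ : _ `&` _ = [set w | forall i k, (B i k `&` B' i k) (Y i k w)]); last first.
  apply/seteqP; split => w; first by move=> [H H'] i k; split; [exact: H|exact: H'].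
  by move=> H; split => i k; have [] := H i k.
rewrite (indepY mB) (indepY mB').
rewrite (indepY (fun i k => measurableI _ _ (mB i k) (mB' i k))).
rewrite -big_split /=; apply: eq_bigr => i _; rewrite -big_split /=; apply: eq_bigr => k _.
have PT : P [set w | [set: T i] (Y i k w)] = 1%E.
  by rewrite (_ : [set _ | _] = setT) ?probability_setT//; apply/seteqP; split.
have := JJ' i k; rewrite negb_and => /orP[/BT ->|/BT' ->].
  rewrite PT mul1e; congr (P _).
  by apply/seteqP; split => w /=; [case|split].
rewrite PT mule1; congr (P _).
by apply/seteqP; split => w /=; [case|split].
Qed.

(** The pi-system argument applied twice, extending one side at a time. *)
Lemma indep_g_cylinder (J J' : I -> K -> bool) A A' :
  (forall i k, ~~ (J i k && J' i k)) -> <<s cylinder J >> A -> <<s cylinder J' >> A' ->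
  P (A `&` A') = (P A * P A')%E.
Proof.
move=> JJ' sA sA'.
have mA' : measurable A'.
  move: A' sA'; apply: smallest_sub; [exact: sigma_algebra_measurable|exact: cylinder_measurable].
apply: (indep_g_sigma_algebra (@cylinder_measurable J) (@setI_closed_cylinder J)
  (cylinder_setT J) mA' _ sA) => {A sA mA'} A cA.
have mA := cylinder_measurable cA.
rewrite setIC muleC.
apply: (indep_g_sigma_algebra (@cylinder_measurable J') (@setI_closed_cylinder J')
  (cylinder_setT J') mA _ sA') => {A' sA'} A' cA'.
by rewrite setIC muleC; exact: indep_cylinder cA cA'.
Qed.

End cylinders.

(** The unknown is the tail sum s_i = sum_(j >= i) e_(j+1), for which s_i <= x_(i+1) + (1 + K)
    s_(i+1). Nothing is subtracted, so infinite values are harmless. *)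
Lemma gronwall_sum (R : realType) (K : R) N (e x : nat -> \bar R) : 0 <= K ->
  (forall j, (0 <= e j)%E) -> (forall j, (0 <= x j)%E) ->
  (forall i, (i <= N)%N -> (e i <= x i + K%:E * \sum_(i <= j < N) e j.+1)%E) ->
  forall i, (i <= N)%N ->
  (\sum_(i <= j < N) e j.+1 <= ((1 + K) ^+ (N - i))%:E * \sum_(i <= j < N) x j.+1)%E.
Proof.
move=> K0 e0 x0 H i iN; have := subnKC iN; move: (N - i)%N => k {iN}.
elim: k i => [|k IH] i ikN; first by rewrite -ikN addn0 !big_geq// mule0.
have iN : (i < N)%N by rewrite -ikN -[ltnLHS]addn0 ltn_add2l.
have := IH i.+1; rewrite addSnnS => /(_ ikN) {}IH.
rewrite !(big_ltn iN); have Hi := H i.+1 iN.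
set s := (\sum_(i.+1 <= j < N) e j.+1)%E in Hi IH *.
set u := (\sum_(i.+1 <= j < N) x j.+1)%E in IH *.
have s0 : (0 <= s)%E by apply: sume_ge0 => j _.
have u0 : (0 <= u)%E by apply: sume_ge0 => j _.
have K1 : 1 <= 1 + K by rewrite lerDl.
rewrite ge0_muleDr//.
apply: (@le_trans _ _ (x i.+1 + ((1 + K)%:E * s))%E).
  apply: le_trans (leeD2r _ Hi) _; rewrite -addeA leeD2l//.
  by rewrite EFinD ge0_muleDl ?lee_fin// mul1e addeC.
apply: leeD.
  by rewrite -[leLHS]mul1e lee_wpmul2r// lee_fin exprn_ege1.
rewrite exprS EFinM -muleA lee_wpmul2l// lee_fin; lra.
Qed.

(** * Propagation of the error *)

Section error_propagation.
Context (R : realType) (d dW : nat) (m : model R d dW).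
Hypothesis H1 : growth_assumption m.
Hypothesis H2 : coefficient_assumption m.
Hypothesis H3 : density_assumption m.
Hypothesis T_gt0 : 0 < mT m.
Local Notation V := (d.-tuple R).
Variable Q : probability V R.
Hypothesis QE : forall A, measurable A ->
  Q A = (\int[lebesgue_tuple R d]_(x in A) (nu m x)%:E)%E.
Context dO (Omega : measurableType dO) (P : probability Omega R).
Context (W : R -> Omega -> dW.-tuple R).
Hypothesis BM : standard_brownian P W.
Variables N M : nat.
Hypotheses (N0 : (0 < N)%N) (M0 : (0 < M)%N).
Hypothesis HL : in_L2nu m (damped m (Lstar m P W N)).
Variable c_nu : R.
Hypothesis c_nu0 : 0 <= c_nu.
Hypothesis Hst : forall i j xi gamma, (i <= j <= N)%N ->
  initial_condition m P W N i xi -> in_L2nu m gamma ->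
  ('E_P[fun w => (`|gamma (pathX m W N i xi j w)| ^+ 2 * jbracket (mq m) (pathX m W N i xi j w)
                  / jbracket (mq m) (pathX m W N i xi i w))%R]
   <= c_nu%:E * 'E_P[fun w => (`|gamma (pathX m W N i xi i w)| ^+ 2)%R])%E.
Variables (Gamma : {fset d.-tuple nat}) (xi : nat -> Omega -> V).
Variables (cl : 'I_N -> 'I_M -> nat -> Omega -> V).
Variables (y : nat -> V -> R) (ybar : nat -> Omega -> V -> R).
Hypothesis Hxi : forall i, (i <= N)%N -> initial_condition m P W N i (xi i).
Hypothesis Hcl : clouds m P W xi cl.
Hypothesis Hy : exact_solution m P W N y.
Hypothesis Hybar : gqrmdp m P W Gamma cl ybar.

Let Y (i : 'I_N) (k : 'I_M) (w : Omega) : (N - i).+1.-tuple V :=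
  segment N i (fun j => cl i k j w).
Let mY i k : measurable_fun setT (Y i k). Proof. have [h _ _] := Hcl; exact: h. Qed.
Let indepY (B : forall i : 'I_N, 'I_M -> set ((N - i).+1.-tuple V)) :
  (forall i k, measurable (B i k)) ->
  P [set w | forall i k, B i k (Y i k w)] =
  (\prod_i \prod_k P [set w | B i k (Y i k w)])%E.
Proof. by have [_ _ h] := Hcl; exact: h. Qed.

(** Omega with the sigma-algebra of the paths selected by J. *)
Local Notation sub J := (g_sigma_algebraType (cylinder Y J)).

Let measurable_cl (J : 'I_N -> 'I_M -> bool) i k j : J i k -> (i <= j <= N)%N ->
  measurable_fun setT (fun w : sub J => cl i k j w).
Proof.
move=> Jik ijN.
rewrite (_ : (fun _ => _) = (fun w : sub J => unsegment (Y i k w) j)); last first.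
  by apply/funext => w; rewrite /Y segmentK.
apply: (measurableT_comp (measurable_tnth _)).
exact: (measurable_coordinate (Y := Y) Jik).
Qed.

(** Backward induction: the output at j is built from the clouds of index at least j, and joint
    measurability in w and x is needed to evaluate it at random points of other clouds. *)
Let measurable_ybar (J : 'I_N -> 'I_M -> bool) j : (j <= N)%N ->
  (forall (i : 'I_N) k, (j <= i)%N -> J i k) ->
  measurable_fun setT (fun z : sub J * V => ybar j z.1 z.2).
Proof.
have [yN yi] := Hybar.
move=> jN; rewrite -(subKn jN); move: (N - j)%N (leq_subr j N) => k {j jN}.
elim/ltn_ind: k => k IH kN HJ.
have [k0|k0] := posnP k.
  rewrite k0 subn0 (_ : (fun z => _) = fun z : sub J * V => damped m (mg m) z.2); last first.
    by apply/funext => z; rewrite yN.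
  apply: (measurableT_comp _ measurable_snd); apply: measurable_damped.
  by have [_ h _ _] := H1.
have jN : (N - k < N)%N by rewrite ltn_subrL k0 N0.
pose j := Ordinal jN.
rewrite (_ : (fun z => _) = fun z : sub J * V =>
    \sum_(l <- Gamma) alphabar m P W cl ybar j l z.1 * phi m l z.2); last first.
  by apply/funext => z; rewrite -yi.
apply: measurable_sum => l; apply: measurable_funM; last first.
  exact: measurableT_comp (measurable_phi H3 l) measurable_snd.
apply: (measurableT_comp _ (@measurable_fst _ _ (sub J) V)).
apply: measurable_funM => //; apply: measurable_sum => n; apply: measurable_funM.
  apply: (measurable_SqM H1 P W N0 (v := fun (w : sub J) j' => ybar j' w)
    (x := fun (w : sub J) j' => cl j n j' w) (i := j) (ltnW jN)) => j' /andP[jj' j'N].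
    by apply: measurable_cl; [exact: HJ|rewrite jj'].
  have IH' : measurable_fun setT (fun z : sub J * V => ybar j'.+1 z.1 z.2).
    rewrite -(subKn j'N); apply: IH; first by move: jj' j'N kN k0; rewrite /=; clear; lia.
      exact: leq_subr.
    by move=> i k'; rewrite subKn// => /ltnW j'i; apply: HJ; exact: leq_trans j'i.
  apply: (measurableT_comp IH' (g := fun w : sub J => (w, cl j n j'.+1 w))); apply: measurable_fun_pair => //.
  by apply: measurable_cl; [exact: HJ|rewrite j'N leqW].
apply: (measurableT_comp (measurable_phi H3 l)).
by apply: measurable_cl; [exact: HJ|rewrite leqnn ltnW].
Qed.

Let ybar_L2 j w : (j <= N)%N -> in_L2nu m (ybar j w).
Proof.
have [yN yi] := Hybar.
rewrite leq_eqVlt => /predU1P[->|jN].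
  rewrite yN; apply/(in_L2nuE H3 QE); have [<- _] := Hy.
  exact: (damped_y_sq H1 H2 H3 T_gt0 QE BM N0 HL Hy (leqnn N)).
rewrite (_ : ybar j w = fun x => \sum_(k <- Gamma) alphabar m P W cl ybar (Ordinal jN) k w * phi m k x).
  apply/(in_L2nuE H3 QE); apply: sqintegrable_sum => k _; apply: sqintegrableZ.
  exact: phi_sqintegrable.
by apply/funext => x; rewrite -yi.
Qed.

Let err j : \bar R := (\int[P]_w sqnorm_nu m (fun x => ybar j w x - damped m (y j) x)%R)%E.

Let sqnorm_nu_ge0 (v : V -> R) : (0 <= sqnorm_nu m v)%E.
Proof.
by apply: integral_ge0 => x _; rewrite lee_fin mulr_ge0 ?sqr_ge0// (nu_ge0 H3).
Qed.

Let measurable_err j : (j <= N)%N ->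
  measurable_fun setT (fun w => sqnorm_nu m (fun x => ybar j w x - damped m (y j) x)).
Proof.
move=> jN; pose J (_ : 'I_N) (_ : 'I_M) := true.
have mz : measurable_fun setT (fun z : sub J * V => ybar j z.1 z.2 - damped m (y j) z.2).
  apply: measurable_funB; first exact: measurable_ybar.
  apply: measurableT_comp measurable_snd; apply: measurable_damped.
  exact: (exact_solution_measurable H1 H2 T_gt0 BM N0 Hy).
have mI := @measurable_fun_integral _ (sub J) _ V R Q
  (fun z => ((ybar j z.1 z.2 - damped m (y j) z.2) ^+ 2)%:E).
rewrite (_ : (fun w => _) = (fun w : sub J => \int[Q]_x
    ((ybar j w x - damped m (y j) x) ^+ 2)%:E)%E \o id).
  have mI2 : measurable_fun setT (fun w : sub J => \int[Q]_x
      ((ybar j w x - damped m (y j) x) ^+ 2)%:E)%E.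
    by apply: mI; apply/measurable_EFinP; exact: measurable_funX.
  exact: (measurableT_comp mI2 (measurable_cylinder_id mY (J := J))).
apply/funext => w /=; rewrite (sqnorm_nuE H3 QE)//.
exact: (measurableT_comp mz (@measurable_pair1 _ _ (sub J) V w)).
Qed.

(** The error is a function H of two copies of w, one feeding the later outputs and one the i-th
    cloud. Decoupling freezes the first copy, [regression_error] bounds the inner integral, and the
    bound is integrated. *)
Lemma error_recursion (kappa : R) i : LGamma m Gamma / M%:R <= kappa -> (i < N)%N ->
  (err i <= 2%:E * local_error m P W N M Gamma xi y i
    + ((1 + 2 * kappa) * (mT m * mLf m ^+ 2 * step m N * c_nu))%:E
      * \sum_(i <= j < N) err j.+1)%E.
Proof.
move=> Hkappa iN; pose i' := Ordinal iN.
have [_ yi] := Hybar; have [_ seg_law _] := Hcl.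
(* Strict inequality: [SqM] at i reads the outputs from index i + 1 on, so [J1] and [J2] are
   disjoint. *)
pose J1 (j : 'I_N) (_ : 'I_M) := (i < j)%N.
pose J2 (j : 'I_N) (_ : 'I_M) := (j == i :> nat).
pose G (z : (sub J1 * sub J2) * V) := (\sum_(k <- Gamma)
   (M%:R^-1 * \sum_n SqM m P W N (fun j => ybar j z.1.1) i (fun j => cl i' n j z.1.2)
      * phi m k (cl i' n i z.1.2)) * phi m k z.2) - damped m (y i) z.2.
have mG : measurable_fun setT G.
  have m1 : measurable_fun setT (fun z : (sub J1 * sub J2) * V => z.1.1).
    exact: measurableT_comp measurable_fst measurable_fst.
  have m2 n j : (i <= j <= N)%N ->
      measurable_fun setT (fun z : (sub J1 * sub J2) * V => cl i' n j z.1.2).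
    move=> ijN; have h : measurable_fun setT (fun w : sub J2 => cl i' n j w).
      by apply: measurable_cl => //; rewrite /J2 /=.
    apply: (measurableT_comp h); exact: measurableT_comp measurable_snd measurable_fst.
  apply: measurable_funB; last first.
    apply: measurableT_comp measurable_snd; apply: measurable_damped.
    exact: (exact_solution_measurable H1 H2 T_gt0 BM N0 Hy (ltnW iN)).
  apply: measurable_sum => k; apply: measurable_funM; last first.
    exact: measurableT_comp (measurable_phi H3 k) measurable_snd.
  apply: measurable_funM => //; apply: measurable_sum => n; apply: measurable_funM.
    apply: (measurable_SqM H1 P W N0
      (v := fun (z : (sub J1 * sub J2) * V) j => ybar j z.1.1)
      (x := fun z j => cl i' n j z.1.2) (ltnW iN)).
      by move=> j; exact: m2.
    move=> j /andP[ij jN].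
    have h : measurable_fun setT (fun z : sub J1 * V => ybar j.+1 z.1 z.2).
      by apply: measurable_ybar => // i0 k0; exact: leq_ltn_trans.
    apply: (measurableT_comp h (g := fun z : (sub J1 * sub J2) * V => (z.1.1, cl i' n j.+1 z.1.2))).
    apply: measurable_fun_pair => //.
    by apply: m2; rewrite jN leqW.
  apply: measurableT_comp (measurable_phi H3 k) _.
  by apply: m2; rewrite leqnn ltnW.
pose H (z : sub J1 * sub J2) : \bar R := (\int[Q]_x ((G (z, x)) ^+ 2)%:E)%E.
have mH : measurable_fun setT H.
  apply: (@measurable_fun_integral _ _ _ V R Q (fun z => (G z ^+ 2)%:E)).
  by apply/measurable_EFinP; exact: measurable_funX.
have H0 z : (0 <= H z)%E by apply: integral_ge0 => x _; rewrite lee_fin sqr_ge0.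
have HE z : H z = sqnorm_nu m (fun x => G (z, x)).
  rewrite (sqnorm_nuE H3 QE)//; exact: measurableT_comp mG (measurable_pair1 _).
have -> : err i = (\int[P]_w H (w, w))%E.
  apply: eq_integral => w _; rewrite HE; congr (sqnorm_nu m _).
  by apply/funext => x; rewrite -[i in LHS]/(nat_of_ord i') yi.
rewrite (@ge0_integral_decoupling _ Omega _ P _ (sub J1) _ (sub J2) id id)//; first last.
- move=> A B sA sB; apply: (indep_g_cylinder mY indepY _ sA sB) => j k.
  by rewrite /J1 /J2; case: ltngtP.
- exact: measurable_cylinder_id.
- exact: measurable_cylinder_id.
set K := (1 + 2 * kappa) * _; set LE := local_error _ _ _ _ _ _ _ _ _.
have LG0 : 0 <= LGamma m Gamma / M%:R.
  by apply: divr_ge0 => //; apply: sumr_ge0 => k _; exact: sqr_ge0.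
have K0 : 0 <= K.
  apply: mulr_ge0; first by have := le_trans LG0 Hkappa; lra.
  apply: mulr_ge0 => //; apply: mulr_ge0; last exact: step_ge0.
  by rewrite mulr_ge0 ?sqr_ge0// ltW.
have LE0 : (0 <= LE)%E.
  apply: adde_ge0; first by apply: esum_ge0 => k _; rewrite lee_fin sqr_ge0.
  apply: mule_ge0; first by rewrite lee_fin.
  by rewrite expectationE; apply: integral_ge0 => w _; rewrite lee_fin sqr_ge0.
have mH' : measurable_fun setT (fun z : Omega * Omega => H (z.1, z.2)).
  apply: (measurableT_comp mH (g := fun z : Omega * Omega => (z.1 : sub J1, z.2 : sub J2))).
  apply: measurable_fun_pair.
    exact: measurableT_comp (measurable_cylinder_id mY (J := J1)) measurable_fst.
  exact: measurableT_comp (measurable_cylinder_id mY (J := J2)) measurable_snd.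
have ms j : (i <= j < N)%N -> measurable_fun setT
    (fun w => sqnorm_nu m (fun x => ybar j.+1 w x - damped m (y j.+1) x)).
  by move=> /andP[_ jN]; exact: measurable_err.
(* Extended by 0 so that it is measurable for every index. *)
pose s j w := if (i <= j < N)%N then
  sqnorm_nu m (fun x => ybar j.+1 w x - damped m (y j.+1) x) else 0%E.
have msj j : measurable_fun setT (s j).
  by rewrite /s; have [/ms//|_] := boolP (i <= j < N)%N; exact: measurable_cst.
have s0 j w : (0 <= s j w)%E by rewrite /s; case: ifP.
have mS : measurable_fun setT (fun w => \sum_(i <= j < N) s j w)%E.
  exact: emeasurable_sum.
have S0 w : (0 <= \sum_(i <= j < N) s j w)%E by apply: sume_ge0.
apply: (@le_trans _ _ (\int[P]_w (2%:E * LE + K%:E * \sum_(i <= j < N) s j w))%E).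
  apply: ge0_le_integral => //.
  - by move=> w _; apply: integral_ge0.
  - exact: (@measurable_fun_integral _ Omega _ Omega R P (fun z => H (z.1, z.2)) mH').
  - apply: emeasurable_funD => //; exact: emeasurable_funM.
  - move=> w _.
    under eq_integral do rewrite HE.
    have -> : (\sum_(i <= j < N) s j w = \sum_(i <= j < N)
        sqnorm_nu m (fun x => ybar j.+1 w x - damped m (y j.+1) x)%R)%E.
      by apply: eq_big_nat => j ijN; rewrite /s ijN.
    have Hst' j gamma : (i <= j <= N)%N -> in_L2nu m gamma -> _ :=
      fun ijN => @Hst i j (xi i) gamma ijN (Hxi (ltnW iN)).
    have seg_indep n n' A B : n != n' -> measurable A -> measurable B ->
        P (Y i' n @^-1` A `&` Y i' n' @^-1` B) =
        (P (Y i' n @^-1` A) * P (Y i' n' @^-1` B))%E.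
      (* Pairwise independence within the cloud: each sigma-algebra is that of a single path. *)
      move=> nn' mA mB; pose J k0 (j : 'I_N) k := (j == i') && (k == k0 :> 'I_M).
      apply: (@indep_g_cylinder _ _ _ _ _ _ _ _ _ mY indepY (J n) (J n')).
      - move=> j k; apply: contra nn' => /andP[/andP[_ /eqP <-] /andP[_ /eqP <-]].
        exact: eqxx.
      - by apply: sub_gen_smallest; apply: cylinder_coordinate => //; rewrite /J !eqxx.
      - by apply: sub_gen_smallest; apply: cylinder_coordinate => //; rewrite /J !eqxx.
    have Lv j : (i < j <= N)%N -> in_L2nu m (ybar j w).
      by move=> /andP[_ jN]; exact: ybar_L2.
    exact: (regression_error H1 H2 H3 T_gt0 QE BM N0 HL iN (Hxi (ltnW iN)) Hst' Hy M0
      (@mY i') (seg_law i') seg_indep Lv Hkappa).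
rewrite ge0_integralD//; [|by move=> w _; exact: mule_ge0|by move=> w _; exact: mule_ge0
  |exact: emeasurable_funM].
rewrite [X in (X + _ <= _)%E](_ : _ = 2%:E * LE)%E; last first.
  by rewrite integral_cst//= probability_setT mule1.
rewrite leeD2l//.
rewrite ge0_integralZl//.
rewrite lee_wpmul2l ?lee_fin// ge0_integral_sum//.
rewrite le_eqVlt; apply/orP; left; apply/eqP.
by apply: eq_big_nat => j ijN; apply: eq_integral => w _; rewrite /s ijN.
Qed.

Lemma error_bound (kappa : R) : 0 <= kappa -> LGamma m Gamma / M%:R <= kappa ->
  let K := (1 + 2 * kappa) * (mT m * mLf m ^+ 2 * c_nu) in
  forall i, (i < N)%N ->
  (err i <= (2 + 2 * K * expR (K * mT m))%:E * (local_error m P W N M Gamma xi y i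
     + \sum_(i <= j < N) local_error m P W N M Gamma xi y j.+1 * (step m N)%:E))%E.
Proof.
move=> kappa0 Hkappa K i iN.
set LE := local_error m P W N M Gamma xi y.
have st := step_ge0 T_gt0 N.
have LG0 : 0 <= LGamma m Gamma / M%:R.
  by apply: divr_ge0 => //; apply: sumr_ge0 => k _; exact: sqr_ge0.
have LE0 j : (0 <= LE j)%E.
  apply: adde_ge0; first by apply: esum_ge0 => k _; rewrite lee_fin sqr_ge0.
  apply: mule_ge0; first by rewrite lee_fin.
  by rewrite expectationE; apply: integral_ge0 => w _; rewrite lee_fin sqr_ge0.
have K0 : 0 <= K.
  apply: mulr_ge0; first lra.
  apply: mulr_ge0 => //; apply: mulr_ge0; [exact: ltW|exact: sqr_ge0].
have err0 j : (0 <= err j)%E by apply: integral_ge0.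
(* The terminal value is exact, which extends the recursion to the index N that [gronwall_sum]
   includes. *)
have errN : err N = 0%E.
  apply: integral0_eq => w _; apply: integral0_eq => x _.
  have [yN _] := Hy; have [-> _] := Hybar.
  by rewrite yN subrr expr0n mul0r.
have Ks : 0 <= K * step m N by rewrite mulr_ge0.
have KE : (1 + 2 * kappa) * (mT m * mLf m ^+ 2 * step m N * c_nu) = K * step m N.
  by rewrite /K; ring.
have rec j : (j <= N)%N -> (err j <= 2%:E * LE j + (K * step m N)%:E * \sum_(j <= l < N) err l.+1)%E.
  rewrite leq_eqVlt => /predU1P[->|jN]; last by rewrite -KE; exact: error_recursion.
  by rewrite errN adde_ge0 ?mule_ge0 ?lee_fin// sume_ge0.
have x0 j : (0 <= 2%:E * LE j)%E by apply: mule_ge0.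
have Hg := gronwall_sum Ks err0 x0 rec (ltnW iN).
set s := (\sum_(i <= j < N) LE j.+1)%E.
have s0 : (0 <= s)%E by apply: sume_ge0.
have -> : (\sum_(i <= j < N) LE j.+1 * (step m N)%:E = (step m N)%:E * s)%E.
  by rewrite ge0_sume_distrr//; apply: eq_bigr => j _; rewrite muleC.
rewrite -ge0_sume_distrr// -/s in Hg.
have pexp : (1 + K * step m N) ^+ (N - i) <= expR (K * mT m).
  apply: (@le_trans _ _ (expR (K * step m N) ^+ (N - i))).
    apply: lerXn2r; last exact: expR_ge1Dx.
      by rewrite nnegrE addr_ge0.
    by rewrite nnegrE expR_ge0.
  rewrite -expRM_natl ler_expR mulrCA ler_wpM2l//.
  by rewrite -(step_sumT m N0) ler_wpM2r// ler_nat leq_subr.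
apply: (le_trans (rec i (ltnW iN))).
(* The recursion contributes K Delta, Gronwall at most exp (K T), and the factor 2 is that of the
   local errors. *)
apply: (@le_trans _ _ (2%:E * LE i + (2 * K * expR (K * mT m))%:E * ((step m N)%:E * s))%E).
  rewrite leeD2l//; apply: le_trans (lee_wpmul2l _ Hg) _; first by rewrite lee_fin.
  rewrite !muleA -!EFinM lee_wpmul2r// lee_fin.
  have := ler_wpM2l Ks pexp; set p := (1 + _) ^+ _; lra.
have D0 : 0 <= 2 * K * expR (K * mT m).
  by rewrite mulr_ge0 ?expR_ge0// mulr_ge0.
have ss0 : (0 <= (step m N)%:E * s)%E by apply: mule_ge0; rewrite ?lee_fin.
rewrite [leRHS]ge0_muleDr//; apply: leeD; apply: lee_wpmul2r => //.
  by rewrite lee_fin lerDl.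
by rewrite lee_fin lerDr.
Qed.

End error_propagation.

Theorem theorem2 (R : realType) (d dW : nat) (m : model R d dW)
    (d_ge1 : (0 < d)%N) (dW_ge1 : (0 < dW)%N)
    (T_gt0 : 0 < mT m) (q_ge0 : 0 <= mq m)
    (H1 : growth_assumption m) (H2 : coefficient_assumption m)
    (H3 : density_assumption m) (H3' : Lstar_assumption m)
    (H4 : stability_assumption m) :
  forall kappa : R, 0 < kappa ->
  exists C : R, 0 < C /\
  forall (N M : nat) (Gamma : {fset d.-tuple nat}),
    (0 < N)%N -> (0 < M)%N -> LGamma m Gamma / M%:R <= kappa ->
  forall (dO : measure_display) (Omega : measurableType dO)
    (P : probability Omega R) (W : R -> Omega -> dW.-tuple R)
    (xi : nat -> Omega -> d.-tuple R)
    (cl : 'I_N -> 'I_M -> nat -> Omega -> d.-tuple R)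
    (y : nat -> d.-tuple R -> R) (ybar : nat -> Omega -> d.-tuple R -> R),
    standard_brownian P W ->
    (forall i, (i <= N)%N -> initial_condition m P W N i (xi i)) ->
    clouds m P W xi cl ->
    exact_solution m P W N y ->
    gqrmdp m P W Gamma cl ybar ->
  forall i, (i < N)%N ->
  (\int[P]_w sqnorm_nu m (fun x => ybar i w x - damped m (y i) x)%R
   <= C%:E * (local_error m P W N M Gamma xi y i
              + \sum_(i <= j < N)
                  local_error m P W N M Gamma xi y j.+1 * (step m N)%:E))%E.
Proof.
move=> kappa kappa0; have [c_nu [c_nu0 Hst]] := H4.
have [Q QE] := density_probability (measurable_nu H3) (nu_ge0 H3) (integral_nu H3).
(* Fixed before N, M, Gamma and the probability space; the leading 2 makes it positive even when L_f
   = 0. *)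
exists (2 + 2 * ((1 + 2 * kappa) * (mT m * mLf m ^+ 2 * c_nu))
    * expR ((1 + 2 * kappa) * (mT m * mLf m ^+ 2 * c_nu) * mT m)); split.
  have k0 : 0 <= (1 + 2 * kappa) * (mT m * mLf m ^+ 2 * c_nu).
    apply: mulr_ge0; first lra.
    by apply: mulr_ge0; [apply: mulr_ge0; [exact: ltW|exact: sqr_ge0]|exact: ltW].
  by rewrite ltr_pwDl// mulr_ge0 ?expR_ge0// mulr_ge0.
move=> N M Gamma N0 M0 Hk dO Omega P W xi cl y ybar BM Hxi Hcl Hy Hybar i iN.
have QE' A : measurable A -> Q A = (\int[lebesgue_tuple R d]_(x in A) (nu m x)%:E)%E.
  by move=> _; exact: QE.
have Hst' i' j xi' gamma ij := @Hst _ _ P W BM N i' j xi' gamma N0 ij.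
exact: (error_bound H1 H2 H3 T_gt0 QE' BM N0 M0 (H3' _ _ _ _ BM _ N0) (ltW c_nu0) Hst'
  Hxi Hcl Hy Hybar (ltW kappa0) Hk iN).
Qed.
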